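(* Let $n=1$, $s \geq \tfrac12$, and let $p:\mathbb{R}\to\mathbb{R}$ be a continuous function satisfying $A|\xi|^{2s} + c \leq p(\xi) \leq B|\xi|^{2s}$ for all $\xi \in \mathbb{R}$, with constants $A>0$, $B>0$, $c\in\mathbb{R}$. Let $v \in \mathbb{R}$, where if $s = \tfrac12$ we additionally assume $|v| < A$. Let $\Sigma_v := \inf_{\xi\in\mathbb{R}}\{p(\xi) - v\xi\}$, let $\omega > -\Sigma_v$, and let $\sigma \in \mathbb{N}$ be an integer with $0 < \sigma < \sigma_*(s,1)$. Then every boosted ground state $Q_{\omega,v} \in H^s(\mathbb{R})$ is of the form $$Q_{\omega,v}(x) = e^{\mathrm{i}\alpha}\, Q_{\omega,v}^{\bullet}(x + x_0) \quad \text{for a.e. } x \in \mathbb{R},$$ for some constants $\alpha\in\mathbb{R}$ and $x_0 \in \mathbb{R}$. In particular, up to translation and multiplication by a constant phase, every such $Q_{\omega,v}$ satisfies $Q_{\omega,v}(x) = \overline{Q_{\omega,v}(-x)}$ for a.e. $x\in\mathbb{R}$.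
   Context: Fourier transform: $\widehat{u}(\xi) = (2\pi)^{-1/2}\int_{\mathbb{R}} u(x)e^{-\mathrm{i}\xi x}\,dx$, extended to $L^2$. $\sigma_*(s,1) = \frac{2s}{1-2s}$ if $s<1/2$ and $+\infty$ if $s \geq 1/2$ (so here $\sigma_*=+\infty$). For $u \in H^s(\mathbb{R})$, $u\not\equiv 0$, define $$\mathcal{J}_{v,\omega,\sigma}(u) = \frac{\left(\int_{\mathbb{R}}(p(\xi) - v\xi + \omega)|\widehat{u}(\xi)|^2\,d\xi\right)^{\sigma+1}}{\|u\|_{L^{2\sigma+2}}^{2\sigma+2}};$$ a boosted ground state is a minimizer of $\mathcal{J}_{v,\omega,\sigma}$ over $H^s(\mathbb{R})\setminus\{0\}$. For $f \in L^2(\mathbb{R})$, $f^\bullet := \mathcal{F}^{-1}\{|\mathcal{F}f|\}$. *)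

(* Defs.v *)
From HB Require Import structures.
From mathcomp Require Import all_boot all_order all_algebra.
From mathcomp Require Import all_classical all_reals all_analysis.
Set Implicit Arguments. Unset Strict Implicit. Unset Printing Implicit Defensive.
Import Order.TTheory GRing.Theory Num.Theory.
Import numFieldNormedType.Exports.
Local Open Scope classical_set_scope.
Local Open Scope ring_scope.

Section Defs.
Variable R : realType.

Definition cplx := (R * R)%type.
Definition cnorm2 (z : cplx) : R := z.1 ^+ 2 + z.2 ^+ 2.
Definition cabs (z : cplx) : R := Num.sqrt (cnorm2 z).
Definition csub (z w : cplx) : cplx := (z.1 - w.1, z.2 - w.2).
Definition cmul (z w : cplx) : cplx := (z.1 * w.1 - z.2 * w.2, z.1 * w.2 + z.2 * w.1).
Definition cconj (z : cplx) : cplx := (z.1, - z.2).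
Definition cexpi (t : R) : cplx := (cos t, sin t).

Definition leb := (@lebesgue_measure R).

Definition L2 (u : R -> cplx) : Prop :=
  measurable_fun setT (fun x => (u x).1) /\ measurable_fun setT (fun x => (u x).2) /\
  (\int[leb]_x (cnorm2 (u x))%:E < +oo)%E.

(* truncated Fourier transform (2 pi)^{-1/2} \int_{-N}^{N} u(x) e^{-i xi x} dx *)
Definition FT_trunc (u : R -> cplx) (N : nat) (xi : R) : cplx :=
  ((Num.sqrt (2 * pi))^-1 *
     Rintegral leb `[(- N%:R), N%:R] (fun x => (u x).1 * cos (xi * x) + (u x).2 * sin (xi * x)),
   (Num.sqrt (2 * pi))^-1 *
     Rintegral leb `[(- N%:R), N%:R] (fun x => (u x).2 * cos (xi * x) - (u x).1 * sin (xi * x))).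

(* w is (a representative of) the L^2 Fourier transform of u (Plancherel extension:
   L^2-limit of the truncated transforms) *)
Definition is_FT (u w : R -> cplx) : Prop :=
  L2 u /\ L2 w /\
  ((fun N : nat => (\int[leb]_xi (cnorm2 (csub (w xi) (FT_trunc u N xi)))%:E)%E)
     @ \oo --> 0%E).

Definition Hs (s : R) (u : R -> cplx) : Prop :=
  L2 u /\ exists w, is_FT u w /\
    (\int[leb]_xi (((1 + xi ^+ 2) `^ s) * cnorm2 (w xi))%:E < +oo)%E.

Definition ae_zero (u : R -> cplx) : Prop := {ae leb, forall x, u x = (0, 0)}.

(* J_{v,omega,sigma}(u), computed with a Fourier transform w of u *)
Definition Jfun (p : R -> R) (v omega : R) (sigma : nat) (u w : R -> cplx) : R :=
  (Rintegral leb setT (fun xi => (p xi - v * xi + omega) * cnorm2 (w xi))) ^+ sigma.+1 /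
  Rintegral leb setT (fun x => cnorm2 (u x) ^+ sigma.+1).

Definition boosted_ground_state (p : R -> R) (s v omega : R) (sigma : nat)
    (Q : R -> cplx) : Prop :=
  Hs s Q /\ ~ ae_zero Q /\
  forall wQ, is_FT Q wQ ->
  forall u wu, Hs s u -> ~ ae_zero u -> is_FT u wu ->
    Jfun p v omega sigma Q wQ <= Jfun p v omega sigma u wu.

End Defs.

(* Main.v *)
(** Put [w = FT Q] and [g = |w|]. By Plancherel, [int |Q|^(2 sigma + 2)] is a constant times the
    squared [L2] norm of the convolution power [w * ... * w] with [sigma + 1] factors, which is
    dominated pointwise by [g * ... * g]; the quadratic form in the numerator only sees [g].
    Minimality therefore forces equality, and since a gap between [|w * w|] and [g * g] would
    persist through the remaining convolutions, [|w * w| = g * g] almost everywhere. Perturbing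
    [g] on the set where it vanishes shows that [w] has full support. Equality in the triangle
    inequality for [w * w] then says that the phase [phi = w / |w|] satisfies
    [phi (x - y) phi y = c x], so [phi] is, up to a constant, a measurable character, that is
    [w x = e^(i (al + be x)) |w x|]. Modulating [w] translates [Q], which is the first claim; the
    second follows since the conjugate reflection of the function with transform [|w|] has the
    same transform. *)
Require Import Defs.
From HB Require Import structures.
From mathcomp Require Import all_boot all_order all_algebra.
From mathcomp Require Import all_classical all_reals all_analysis.
From mathcomp Require Import measurable_realfun ring lra.
Import Order.TTheory GRing.Theory Num.Theory.
Import numFieldNormedType.Exports.
Local Open Scope classical_set_scope.
Local Open Scope ring_scope.
Set Implicit Arguments.
Unset Strict Implicit.
Unset Printing Implicit Defensive.

(** * Complex numbers as pairs of reals *)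

Section CplxAlgebra.
Variable R : realType.
Implicit Types (z w : cplx R) (a b : R).

(** At [s = 1/2] the weight [(1 + xi^2)^s] just fails to make [w] integrable, so [w * ... * w] need
    not converge absolutely and cannot be transformed directly. This shapes the proof. Powers of
    [|w|] are taken as extended nonnegative functions ([epw]), meaningful without any finiteness and
    continuous along increasing truncations; powers of [w] itself are only taken for [truncf w n],
    bounded with bounded support. These truncations are tied to [Q] by lower semicontinuity alone:
    their inverse transforms tend to [Q] in [L^2], so in the limit their powers are at least the
    power of [Q]. Minimality, tested on nonnegative functions, bounds the power of [|w|] by the same
    constant, and the two bounds meet. Full support cannot be skipped: across a gap in the support
    the phase could jump without spoiling the alignment of [w * w]. It is obtained from one-sided
    perturbations, with no Euler-Lagrange equation. As the transform is defined as an [L^2] limit of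
    truncated integrals, Plancherel and inversion are proved along the way. *)

Definition caddc z w : cplx R := (z.1 + w.1, z.2 + w.2).
(** The real part of [z] times the conjugate of [w]: a real inner product keeps every pairing real
    valued. *)
Definition cdot z w : R := z.1 * w.1 + z.2 * w.2.
Definition cscalec a z : cplx R := (a * z.1, a * z.2).

Lemma cnorm2_ge0 z : 0 <= cnorm2 z.
Proof. by rewrite addr_ge0 ?sqr_ge0. Qed.

Lemma cabs_ge0 z : 0 <= cabs z.
Proof. exact: sqrtr_ge0. Qed.

Lemma cabs_sqr z : cabs z ^+ 2 = cnorm2 z.
Proof. by rewrite /cabs sqr_sqrtr ?cnorm2_ge0. Qed.

Lemma cnorm2M z w : cnorm2 (cmul z w) = cnorm2 z * cnorm2 w.
Proof. by rewrite /cnorm2 /cmul /=; ring. Qed.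

Lemma cabsM z w : cabs (cmul z w) = cabs z * cabs w.
Proof. by rewrite /cabs cnorm2M sqrtrM ?cnorm2_ge0. Qed.

Lemma cdotzz z : cdot z z = cnorm2 z.
Proof. by rewrite /cdot /cnorm2; ring. Qed.

Lemma cnorm2_expi a : cnorm2 (cexpi a) = 1.
Proof. by rewrite /cnorm2 /cexpi /= cos2Dsin2. Qed.

Lemma cabs_expi a : cabs (cexpi a) = 1.
Proof. by rewrite /cabs cnorm2_expi sqrtr1. Qed.

Lemma cexpiD a b : cexpi (a + b) = cmul (cexpi a) (cexpi b).
Proof. by rewrite /cexpi /cmul /= cosD sinD addrC (addrC (sin a * _)). Qed.

Lemma cexpi0 : cexpi (0 : R) = (1, 0).
Proof. by rewrite /cexpi cos0 sin0. Qed.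

Lemma cexpiN a : cexpi (- a) = cconj (cexpi a).
Proof. by rewrite /cexpi /cconj cosN sinN. Qed.

Lemma cabs_conj z : cabs (cconj z) = cabs z.
Proof. by rewrite /cabs /cnorm2 /cconj /= sqrrN. Qed.

Lemma cnorm2_conj z : cnorm2 (cconj z) = cnorm2 z.
Proof. by rewrite /cnorm2 /cconj /= sqrrN. Qed.

Lemma cdot_le z w : cdot z w <= cabs z * cabs w.
Proof.
rewrite /cabs -sqrtrM ?cnorm2_ge0//.
have [h|h] := leP (cdot z w) 0; first by rewrite (le_trans h)// sqrtr_ge0.
rewrite -(ler_sqr (ltW h)) ?nnegrE ?sqrtr_ge0//= ?(ltW h)//.
rewrite sqr_sqrtr ?mulr_ge0 ?cnorm2_ge0//.
(* Lagrange's identity: the defect is the square of the determinant of the two vectors. *)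
rewrite -subr_ge0; have -> : cnorm2 z * cnorm2 w - cdot z w ^+ 2
  = (z.1 * w.2 - z.2 * w.1) ^+ 2 by rewrite /cnorm2 /cdot; ring.
exact: sqr_ge0.
Qed.

Lemma cabsD z w : cabs (caddc z w) <= cabs z + cabs w.
Proof.
suff : cabs (caddc z w) ^+ 2 <= (cabs z + cabs w) ^+ 2.
  by rewrite ler_sqr ?nnegrE ?cabs_ge0 ?addr_ge0 ?cabs_ge0.
rewrite sqrrD !cabs_sqr.
have -> : cnorm2 (caddc z w) = cnorm2 z + cdot z w *+ 2 + cnorm2 w.
  by rewrite /cnorm2 /cdot /caddc /=; ring.
by rewrite lerD2r lerD2l lerMn2r/= cdot_le.
Qed.

Lemma cabs_re z : `|z.1| <= cabs z.
Proof.
have : `|z.1| ^+ 2 <= cabs z ^+ 2 by rewrite cabs_sqr real_normK ?num_real// lerDl sqr_ge0.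
by rewrite ler_sqr ?nnegrE ?cabs_ge0.
Qed.

Lemma cabs_im z : `|z.2| <= cabs z.
Proof.
have : `|z.2| ^+ 2 <= cabs z ^+ 2 by rewrite cabs_sqr real_normK ?num_real// lerDr sqr_ge0.
by rewrite ler_sqr ?nnegrE ?cabs_ge0.
Qed.

Lemma cabs_le z : cabs z <= `|z.1| + `|z.2|.
Proof.
suff : cabs z ^+ 2 <= (`|z.1| + `|z.2|) ^+ 2.
  by rewrite ler_sqr ?nnegrE ?cabs_ge0 ?addr_ge0.
rewrite cabs_sqr sqrrD !real_normK ?num_real//.
by rewrite /cnorm2 lerD2r lerDl mulrn_wge0// mulr_ge0.
Qed.

Lemma cnorm2_eq0 z : (cnorm2 z == 0) = (z == (0, 0)).
Proof.
rewrite /cnorm2 paddr_eq0 ?sqr_ge0// !sqrf_eq0.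
by case: z => x y /=; rewrite xpair_eqE.
Qed.

Lemma cabs_eq0 z : (cabs z == 0) = (z == (0, 0)).
Proof. by rewrite -cnorm2_eq0 -(cabs_sqr z) sqrf_eq0. Qed.

Lemma cabs0 : cabs ((0, 0) : cplx R) = 0.
Proof. by apply/eqP; rewrite cabs_eq0. Qed.

Lemma cabs_real a : 0 <= a -> cabs (a, 0) = a.
Proof. by move=> a0; rewrite /cabs /cnorm2 /= expr0n addr0 sqrtr_sqr ger0_norm. Qed.

Lemma cabs_scale a z : cabs (cscalec a z) = `|a| * cabs z.
Proof.
rewrite /cabs -sqrtr_sqr -sqrtrM ?sqr_ge0//; congr Num.sqrt.
by rewrite /cnorm2 /cscalec /=; ring.
Qed.

Lemma cnorm2_scale a z : cnorm2 (cscalec a z) = a ^+ 2 * cnorm2 z.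
Proof. by rewrite /cnorm2 /cscalec /=; ring. Qed.

Lemma cmulC z w : cmul z w = cmul w z.
Proof. by rewrite /cmul; congr pair; ring. Qed.

Lemma cmulA z w u : cmul z (cmul w u) = cmul (cmul z w) u.
Proof. by rewrite /cmul/=; congr pair; ring. Qed.

Lemma cmul1 z : cmul (1, 0) z = z.
Proof. by case: z => x y; rewrite /cmul/=; congr pair; ring. Qed.

Lemma cmul0 z : cmul (0, 0) z = (0, 0).
Proof. by rewrite /cmul/=; congr pair; ring. Qed.

Lemma cmulconj z : cmul (cconj z) z = (cnorm2 z, 0).
Proof. by rewrite /cmul/cnorm2/=; congr pair; ring. Qed.

Lemma cmul_conj z w : cconj (cmul z w) = cmul (cconj z) (cconj w).
Proof. by rewrite /cmul/cconj/=; congr pair; ring. Qed.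

End CplxAlgebra.

(** * Integration on the line *)

Ltac mfun := repeat (match goal with
  | |- measurable_fun _ (fun _ => ?c) => exact: measurable_cst
  | |- measurable_fun _ _ => first [ assumption | exact: measurable_id
    | exact: measurable_fst | exact: measurable_snd
    | apply: measurable_funD | apply: measurable_funB | apply: measurable_funN
    | apply: measurable_funM | apply: measurable_funX ]
  end).

Section Integration.
Variable R : realType.
Local Notation mu := (@lebesgue_measure R).
Local Notation L1 f := (integrable mu setT (EFin \o f)).
Implicit Types (f g : R -> R) (F G : R -> \bar R).

Lemma L1_of_lty f : measurable_fun setT f ->
  (\int[mu]_x (`|f x|)%:E < +oo)%E -> L1 f.
Proof.
by move=> mf h; apply/integrableP; split => //; exact/measurable_EFinP.
Qed.

Lemma L1_measurable f : L1 f -> measurable_fun setT f.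
Proof. by move=> /measurable_int/measurable_EFinP. Qed.

Lemma L1_lty f : L1 f -> (\int[mu]_x (`|f x|)%:E < +oo)%E.
Proof. by case/integrableP. Qed.

Lemma le_L1 f g : measurable_fun setT f -> (forall x, `|f x| <= g x) -> L1 g -> L1 f.
Proof.
move=> mf fg; apply: le_integrable => //; first exact/measurable_EFinP.
by move=> x _ /=; rewrite lee_fin (le_trans (fg x))// ler_norm.
Qed.

Lemma ge0_Rint_EFin f : L1 f ->
  ((Rintegral mu setT f)%:E = \int[mu]_x (f x)%:E)%E.
Proof. by move=> h; rewrite /Rintegral fineK//; exact: integrable_fin_num h. Qed.

(** An integrable function is infinite on a null set only, so replacing its infinite values by 0, as
    [fine] does, affects neither integrability nor the integral. This is how inner integrals are
    treated in [RFubini]. *)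
Lemma fine_L1 G : mu.-integrable setT G ->
  L1 (fine \o G) /\ Rintegral mu setT (fine \o G) = fine (\int[mu]_x G x)%E.
Proof.
move=> iG; have mG := measurable_int mu iG.
have mfG : measurable_fun setT (EFin \o (fine \o G)).
  apply/measurable_EFinP; apply: measurableT_comp mG; exact: fine_measurable.
have e : ae_eq mu setT (EFin \o (fine \o G)) G.
  move: (integrable_ae measurableT iG); apply: filterS => x h _ /=.
  by rewrite fineK// h.
split; last by congr fine; apply: ae_eq_integral.
apply/integrableP; split => //.
rewrite (@ae_eq_integral _ _ _ mu setT (abse \o G))//; first by case/integrableP: iG.
- exact: measurableT_comp.
- exact: measurableT_comp.
- exact: (ae_eq_abse e).
Qed.

Lemma RFubini (f : R * R -> R) : measurable_fun setT f ->
  (\int[mu]_x \int[mu]_y (`|f (x, y)|)%:E < +oo)%E ->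
  Rintegral mu setT (fun x => Rintegral mu setT (fun y => f (x, y))) =
  Rintegral mu setT (fun y => Rintegral mu setT (fun x => f (x, y))).
Proof.
move=> mf fi.
have mEf : measurable_fun setT (EFin \o f) by exact/measurable_EFinP.
have iF : ((mu \x mu)%E).-integrable setT (EFin \o f).
  by apply/(integrable12ltyP mu mu mEf).
have i1 := integrable_fubini_F iF.
have e1 := (fine_L1 i1).2.
have i2 : mu.-integrable setT (fubini_G mu (EFin \o f)).
  apply/integrableP; split; first exact: (measurable_fubini_G iF).
  apply: le_lt_trans ((integrable21ltyP mu mu mEf).1 iF).
  apply: ge0_le_integral => //.
  - by apply: measurableT_comp => //; exact: (measurable_fubini_G iF).
  - refine (measurable_fun_fubini_tonelli_G (m1 := mu) (abse \o (EFin \o f)) _ _) => //=.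
    exact: measurableT_comp.
  - move=> y _; apply: le_abse_integral => //.
    exact/measurable_EFinP/measurableT_comp.
have e2 := (fine_L1 i2).2.
rewrite -[LHS]/(Rintegral mu setT (fine \o fubini_F mu (EFin \o f))) e1.
rewrite -[RHS]/(Rintegral mu setT (fine \o fubini_G mu (EFin \o f))) e2.
by congr fine; exact: Fubini.
Qed.

(** No integrability is assumed: the integral is the difference of those of the positive and
    negative parts, each measurable by Tonelli, and [fine] is measurable. *)
Lemma measurable_Rint2 (f : R * R -> R) : measurable_fun setT f ->
  measurable_fun setT (fun x => Rintegral mu setT (fun y => f (x, y))).
Proof.
move=> mf.
apply: (measurableT_comp (f := fine) (g := fun x => \int[mu]_y (f (x, y))%:E)%E).
  exact: fine_measurable.
have mEf : measurable_fun setT (EFin \o f) by exact/measurable_EFinP.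
have -> : (fun x => \int[mu]_y (f (x, y))%:E)%E =
    (fun x => fubini_F mu (EFin \o f)^\+%E x - fubini_F mu (EFin \o f)^\-%E x)%E.
  apply/funext => x; rewrite integralE; congr (_ - _)%E.
  - by apply: eq_integral => y _; rewrite !funeposE.
  - by apply: eq_integral => y _; rewrite !funenegE.
apply: emeasurable_funB.
- refine (measurable_fun_fubini_tonelli_F (m2 := mu) _ _ _) => //.
  exact: measurable_funepos.
- refine (measurable_fun_fubini_tonelli_F (m2 := mu) _ _ _) => //.
  exact: measurable_funeneg.
Qed.

Section Preserving.
Variable phi : R -> R.
Hypothesis mphi : measurable_fun setT phi.
Hypothesis phiP : forall A : set R, measurable A -> mu (phi @^-1` A) = mu A.

Lemma ge0_int_preserving F : measurable_fun setT F -> (forall x, (0 <= F x)%E) ->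
  (\int[mu]_x F (phi x) = \int[mu]_x F x)%E.
Proof.
move=> mF F0.
have := @ge0_integral_pushforward _ _ _ _ R (phi : measurableTypeR R -> measurableTypeR R) mphi mu setT F measurableT mF (fun x _ => F0 x).
rewrite preimage_setT => <-.
by apply: eq_measure_integral => A mA _; exact: phiP.
Qed.

Lemma int_preserving F : measurable_fun setT F ->
  (\int[mu]_x F (phi x) = \int[mu]_x F x)%E.
Proof.
move=> mF; rewrite integralE [RHS]integralE; congr (_ - _)%E.
- rewrite -[RHS](@ge0_int_preserving (F^\+)%E)//; last exact: measurable_funepos.
  by apply: eq_integral => x _; rewrite !funeposE.
- rewrite -[RHS](@ge0_int_preserving (F^\-)%E)//; last exact: measurable_funeneg.
  by apply: eq_integral => x _; rewrite !funenegE.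
Qed.

Lemma Rint_preserving f : measurable_fun setT f ->
  Rintegral mu setT (fun x => f (phi x)) = Rintegral mu setT f.
Proof.
move=> mf; congr fine; rewrite -(@int_preserving (EFin \o f))//.
exact/measurable_EFinP.
Qed.

Lemma ae_preserving (P : R -> Prop) : {ae mu, forall x, P x} -> {ae mu, forall x, P (phi x)}.
Proof.
move=> [N [mN N0 PN]]; exists (phi @^-1` N); split.
- by rewrite -[X in measurable X]setTI; exact: mphi.
- by rewrite -N0; exact: phiP.
- by move=> x /= h; apply: PN.
Qed.

End Preserving.

(** The image measure agrees with Lebesgue measure on intervals, and these determine it. *)
Lemma leb_shift (a : R) (A : set R) : measurable A ->
  mu ((fun x => x + a) @^-1` A) = mu A.
Proof.
move=> mA.
have mphi : measurable_fun setT (fun x : R => x + a : measurableTypeR R) by mfun.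
pose mphi_mixin := isMeasurableFun.Build _ _ _ _ _ mphi.
pose mphi_pack : {mfun _ >-> _} := HB.pack (fun x : R => x + a : measurableTypeR R) mphi_mixin.
apply/esym/(lebesgue_measure_unique (mu := pushforward mu mphi_pack)) => //.
move=> _ [[x y]] _ <-; rewrite /pushforward.
transitivity (mu `]x - a, y - a]%classic); last first.
  by congr (mu _); apply/seteqP; split => t /=; rewrite !in_itv/= ltrBlDr lerBrDr.
rewrite !lebesgue_measure_itv/= !lte_fin ltrD2r.
by case: ifP => // _; rewrite -!EFinD opprB addrA subrK.
Qed.

Lemma leb_reflect (a : R) (A : set R) : measurable A ->
  mu ((fun x => a - x) @^-1` A) = mu A.
Proof.
move=> mA.
have mS : measurable ((fun x => x + a) @^-1` A).
  rewrite -[X in measurable X]setTI; have : measurable_fun setT (fun x : R => x + a) by mfun.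
  exact.
rewrite -(leb_shift a mA) -(lebesgue_measureN mS).
by congr (mu _); apply/seteqP; split => x /=; rewrite addrC.
Qed.

Lemma mshift (a : R) : measurable_fun setT (fun x : R => x + a).
Proof. by mfun. Qed.
Lemma mreflect (a : R) : measurable_fun setT (fun x : R => a - x).
Proof. by mfun. Qed.

End Integration.

(** * Convolution of extended nonnegative functions *)

Section EConv.
Variable R : realType.
Local Notation mu := (@lebesgue_measure R).
Implicit Types (F G H : R -> \bar R).
Local Open Scope ereal_scope.

(** The value [+oo] is allowed, so self-convolutions of [|w|] make sense before any finiteness is
    known. *)
Definition econv F G (x : R) := \int[mu]_y (F (x - y)%R * G y).

Lemma measurable_sub2 : measurable_fun setT (fun z : R * R => (z.1 - z.2)%R).
Proof. by mfun. Qed.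

Lemma emeasurable_conv_kernel F G : measurable_fun setT F -> measurable_fun setT G ->
  measurable_fun setT (fun z : R * R => F (z.1 - z.2)%R * G z.2).
Proof.
move=> mF mG; apply: emeasurable_funM.
  exact: (measurableT_comp mF measurable_sub2).
exact: (measurableT_comp mG measurable_snd).
Qed.

Lemma econv_ge0 F G x : (forall x, 0 <= F x) -> (forall x, 0 <= G x) -> 0 <= econv F G x.
Proof. by move=> F0 G0; apply: integral_ge0 => y _; rewrite mule_ge0. Qed.

Lemma measurable_econv F G : measurable_fun setT F -> measurable_fun setT G ->
  (forall x, 0 <= F x) -> (forall x, 0 <= G x) -> measurable_fun setT (econv F G).
Proof.
move=> mF mG F0 G0.
refine (measurable_fun_fubini_tonelli_F (m2 := mu)
  (fun z : R * R => F (z.1 - z.2)%R * G z.2) _ _).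
  exact: emeasurable_conv_kernel.
by move=> z; rewrite mule_ge0.
Qed.

Lemma integral_econv F G : measurable_fun setT F -> measurable_fun setT G ->
  (forall x, 0 <= F x) -> (forall x, 0 <= G x) ->
  \int[mu]_x econv F G x = (\int[mu]_x F x) * (\int[mu]_x G x).
Proof.
move=> mF mG F0 G0.
have := @fubini_tonelli _ _ _ _ R mu mu (fun z : R * R => F (z.1 - z.2)%R * G z.2)
  (emeasurable_conv_kernel mF mG) (fun z => mule_ge0 (F0 _) (G0 _)).
rewrite /econv => -> /=.
rewrite -ge0_integralZl//; last exact: integral_ge0.
apply: eq_integral => y _.
have mFy : measurable_fun setT (fun x : R => F (x - y)%R).
  by apply: (measurableT_comp mF); mfun.
rewrite ge0_integralZr//.
by rewrite (@ge0_int_preserving R (fun x => x - y)%R (mshift (- y)) (leb_shift (- y)) F).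
Qed.

Lemma le_econv F F' G G' x : measurable_fun setT F -> measurable_fun setT G ->
  measurable_fun setT F' -> measurable_fun setT G' ->
  (forall x, 0 <= F x) -> (forall x, 0 <= G x) ->
  (forall x, F x <= F' x) -> (forall x, G x <= G' x) -> econv F G x <= econv F' G' x.
Proof.
move=> mF mG mF' mG' F0 G0 FF GG.
have k A B : measurable_fun setT A -> measurable_fun setT B ->
   measurable_fun setT (fun y : R => A (x - y)%R * B y).
  move=> mA mB; apply: emeasurable_funM => //.
  by apply: (measurableT_comp mA); mfun.
apply: ge0_le_integral => //; [|exact: k|exact: k|].
- by move=> y _; rewrite mule_ge0.
- by move=> y _; rewrite lee_pmul.
Qed.

End EConv.

(** * Integration and convolution of complex-valued functions *)

Section ComplexIntegral.
Variable R : realType.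
Local Notation mu := (@lebesgue_measure R).
Local Notation L1 f := (integrable mu setT (EFin \o f)).

Definition cmeas d (T : measurableType d) (f : T -> cplx R) :=
  measurable_fun setT (fun x => (f x).1) /\ measurable_fun setT (fun x => (f x).2).

Section Cmeas.
Context d (T : measurableType d).
Implicit Types f g : T -> cplx R.

Lemma cmeas_mul f g : cmeas f -> cmeas g -> cmeas (fun x => cmul (f x) (g x)).
Proof. by move=> [? ?] [? ?]; split => /=; mfun. Qed.
Lemma cmeas_add f g : cmeas f -> cmeas g -> cmeas (fun x => caddc (f x) (g x)).
Proof. by move=> [? ?] [? ?]; split => /=; mfun. Qed.
Lemma cmeas_sub f g : cmeas f -> cmeas g -> cmeas (fun x => csub (f x) (g x)).
Proof. by move=> [? ?] [? ?]; split => /=; mfun. Qed.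
Lemma cmeas_scale (a : T -> R) f : measurable_fun setT a -> cmeas f -> cmeas (fun x => cscalec (a x) (f x)).
Proof. by move=> ? [? ?]; split => /=; mfun. Qed.
Lemma cmeas_conj f : cmeas f -> cmeas (fun x => cconj (f x)).
Proof. by move=> [? ?]; split => //=; mfun. Qed.
Lemma cmeas_cst (c : cplx R) : cmeas (fun _ : T => c).
Proof. by split; mfun. Qed.
Lemma cmeas_pair (a b : T -> R) : measurable_fun setT a -> measurable_fun setT b ->
  cmeas (fun x => (a x, b x)).
Proof. by split. Qed.
Lemma measurable_cnorm2 f : cmeas f -> measurable_fun setT (fun x => cnorm2 (f x)).
Proof. by move=> [? ?]; rewrite /cnorm2; mfun. Qed.
Lemma measurable_cdot f g : cmeas f -> cmeas g -> measurable_fun setT (fun x => cdot (f x) (g x)).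
Proof. by move=> [? ?] [? ?]; rewrite /cdot; mfun. Qed.
Lemma measurable_cabs f : cmeas f -> measurable_fun setT (fun x => cabs (f x)).
Proof.
move=> mf; apply: (measurableT_comp (f := @Num.sqrt R)); last exact: measurable_cnorm2.
by apply: continuous_measurable_fun; exact: sqrt_continuous.
Qed.
Lemma cmeas_expi (a : T -> R) : measurable_fun setT a -> cmeas (fun x => cexpi (a x)).
Proof.
move=> ma; split => /=; (apply: measurableT_comp; last exact: ma); apply: continuous_measurable_fun.
  exact: continuous_cos.
exact: continuous_sin.
Qed.
Lemma emeasurable_cabs f : cmeas f -> measurable_fun setT (fun x => (cabs (f x))%:E).
Proof. by move=> mf; apply/measurable_EFinP; exact: measurable_cabs. Qed.
Lemma emeasurable_cnorm2 f : cmeas f -> measurable_fun setT (fun x => (cnorm2 (f x))%:E).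
Proof. by move=> mf; apply/measurable_EFinP; exact: measurable_cnorm2. Qed.
End Cmeas.

Lemma cmeas_comp d1 d2 (T1 : measurableType d1) (T2 : measurableType d2)
  (f : T2 -> cplx R) (g : T1 -> T2) : cmeas f -> measurable_fun setT g -> cmeas (fun x => f (g x)).
Proof.
by move=> [m1 m2] mg; split; [exact: (measurableT_comp m1 mg)|exact: (measurableT_comp m2 mg)].
Qed.

Implicit Types f g h : R -> cplx R.

Definition CL1 f := cmeas f /\ (\int[mu]_x (cabs (f x))%:E < +oo)%E.
Definition Cint f : cplx R :=
  (Rintegral mu setT (fun x => (f x).1), Rintegral mu setT (fun x => (f x).2)).

Lemma le_CL1 f (g : R -> R) : cmeas f -> (forall x, cabs (f x) <= g x) -> L1 g -> CL1 f.
Proof.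
move=> mf fg ig; split=> //.
suff : L1 (fun x => cabs (f x)).
  by move/L1_lty; under eq_integral do rewrite ger0_norm ?cabs_ge0//.
by apply: le_L1 ig; [exact: measurable_cabs|move=> x; rewrite ger0_norm ?cabs_ge0].
Qed.

Lemma CL1_cabs f : CL1 f -> L1 (fun x => cabs (f x)).
Proof.
move=> [mf fi]; apply: L1_of_lty; first exact: measurable_cabs.
by under eq_integral do rewrite ger0_norm ?cabs_ge0//.
Qed.

Lemma CL1_re f : CL1 f -> L1 (fun x => (f x).1).
Proof.
move=> fi; apply: (le_L1 _ _ (CL1_cabs fi)); first by case: fi => -[].
by move=> x; exact: cabs_re.
Qed.

Lemma CL1_im f : CL1 f -> L1 (fun x => (f x).2).
Proof.
move=> fi; apply: (le_L1 _ _ (CL1_cabs fi)); first by case: fi => -[].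
by move=> x; exact: cabs_im.
Qed.

Lemma L1_add (f g : R -> R) : L1 f -> L1 g -> L1 (fun x => f x + g x).
Proof. by move=> h k; exact: (integrableD measurableT h k). Qed.

Lemma L1_sub (f g : R -> R) : L1 f -> L1 g -> L1 (fun x => f x - g x).
Proof. by move=> h k; exact: (integrableB measurableT h k). Qed.

Lemma L1_scale (a : R) (f : R -> R) : L1 f -> L1 (fun x => a * f x).
Proof. by move=> h; apply: (integrableZl measurableT a h). Qed.

Lemma CL1_add f g : CL1 f -> CL1 g -> CL1 (fun x => caddc (f x) (g x)).
Proof.
move=> fi gi; apply: (@le_CL1 _ (fun x => cabs (f x) + cabs (g x))).
- by apply: cmeas_add; [case: fi|case: gi].
- by move=> x; exact: cabsD.
- by apply: L1_add; exact: CL1_cabs.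
Qed.

Lemma CL1_bmul f g (C : R) : cmeas g -> (forall x, cabs (g x) <= C) -> CL1 f ->
  CL1 (fun x => cmul (g x) (f x)).
Proof.
move=> mg gC fi; apply: (@le_CL1 _ (fun x => C * cabs (f x))).
- by apply: cmeas_mul => //; case: fi.
- by move=> x; rewrite cabsM ler_wpM2r ?cabs_ge0.
- by apply: L1_scale; exact: CL1_cabs.
Qed.

Lemma CL1_cmul (c : cplx R) f : CL1 f -> CL1 (fun x => cmul c (f x)).
Proof. by move=> fi; apply: (@CL1_bmul f (fun _ => c) (cabs c)) => //; exact: cmeas_cst. Qed.

Lemma Cint_add f g : CL1 f -> CL1 g ->
  Cint (fun x => caddc (f x) (g x)) = caddc (Cint f) (Cint g).
Proof.
move=> fi gi; rewrite /Cint /caddc /=; congr pair; rewrite RintegralD//.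
all: first [exact: CL1_re|exact: CL1_im].
Qed.

Lemma Cint_cmul (c : cplx R) f : CL1 f ->
  Cint (fun x => cmul c (f x)) = cmul c (Cint f).
Proof.
move=> fi; have f1 := CL1_re fi; have f2 := CL1_im fi.
rewrite /Cint /cmul /=; congr pair.
- by rewrite RintegralB ?RintegralZl//; exact: L1_scale.
- by rewrite RintegralD ?RintegralZl//; exact: L1_scale.
Qed.

(** Pair with [z = Cint f] itself: [|z|^2] is the integral of [cdot (f x) z], hence at most [|z|]
    times the integral of [|f|]. If [f] is not integrable the right-hand side is infinite. *)
Lemma cabs_Cint f : cmeas f -> ((cabs (Cint f))%:E <= \int[mu]_x (cabs (f x))%:E)%E.
Proof.
move=> mf.
have [|] := leP +oo%E (\int[mu]_x (cabs (f x))%:E)%E.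
  by apply: le_trans; rewrite leey.
move=> foo; have fi : CL1 f by [].
have f1 := CL1_re fi; have f2 := CL1_im fi.
rewrite -(ge0_Rint_EFin (CL1_cabs fi)) lee_fin.
set z := Cint f.
have [z0|z0] := eqVneq (cabs z) 0; first by rewrite z0; apply: Rintegral_ge0 => x _; exact: cabs_ge0.
have zp : 0 < cabs z by rewrite lt_neqAle eq_sym z0 cabs_ge0.
rewrite -(ler_pM2l zp) -expr2 cabs_sqr -cdotzz {2}/z /Cint /cdot /=.
have e1 := CL1_cabs fi.
rewrite -!RintegralZl// -?RintegralD//; last 2 first.
- exact: L1_scale.
- exact: L1_scale.
apply: le_Rintegral => //.
- by apply: L1_add; exact: L1_scale.
- exact: L1_scale.
- by move=> x _; exact: (cdot_le z (f x)).
Qed.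

Lemma eq_Cint f g : (forall x, f x = g x) -> Cint f = Cint g.
Proof. by move=> /funext ->. Qed.

Lemma Cint_swap (f : R * R -> cplx R) : cmeas f ->
  (\int[mu]_x \int[mu]_y (cabs (f (x, y)))%:E < +oo)%E ->
  Cint (fun x => Cint (fun y => f (x, y))) = Cint (fun y => Cint (fun x => f (x, y))).
Proof.
move=> mf fi; have [m1 m2] := mf.
have aux (u : R * R -> R) : measurable_fun setT u -> (forall z, `|u z| <= cabs (f z)) ->
   (\int[mu]_x \int[mu]_y (`|u (x, y)|)%:E < +oo)%E.
  move=> mu' uf; apply: le_lt_trans fi.
  apply: ge0_le_integral => //.
  - by move=> x _; exact: integral_ge0.
  - refine (measurable_fun_fubini_tonelli_F (m2 := mu) (fun z => (`|u z|)%:E) _ _) => //.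
    by apply/measurable_EFinP; exact: measurableT_comp.
  - refine (measurable_fun_fubini_tonelli_F (m2 := mu) (fun z => (cabs (f z))%:E) _ _) => //.
      exact: emeasurable_cabs.
    by move=> z; rewrite lee_fin cabs_ge0.
  - move=> x _; apply: ge0_le_integral => //.
    + by apply/measurable_EFinP; apply: measurableT_comp => //; exact: measurableT_comp.
    + by apply: emeasurable_cabs; apply: cmeas_comp.
    + by move=> y _; rewrite lee_fin.
have e1 := RFubini m1 (aux (fun z => (f z).1) m1 (fun z => cabs_re (f z))).
have e2 := RFubini m2 (aux (fun z => (f z).2) m2 (fun z => cabs_im (f z))).
exact: (f_equal2 pair e1 e2).
Qed.

Lemma cmeas_Cint2 (f : R * R -> cplx R) : cmeas f ->
  cmeas (fun x => Cint (fun y => f (x, y))).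
Proof.
move=> [m1 m2]; split => /=.
- exact: (measurable_Rint2 (f := fun z => (f z).1)).
- exact: (measurable_Rint2 (f := fun z => (f z).2)).
Qed.

Lemma CL1_Cint2 (f : R * R -> cplx R) : cmeas f ->
  (\int[mu]_x \int[mu]_y (cabs (f (x, y)))%:E < +oo)%E ->
  CL1 (fun x => Cint (fun y => f (x, y))).
Proof.
move=> mf fi; split; first exact: cmeas_Cint2.
apply: le_lt_trans fi; apply: ge0_le_integral => //.
- by move=> x _; rewrite lee_fin cabs_ge0.
- by apply: emeasurable_cabs; exact: cmeas_Cint2.
- refine (measurable_fun_fubini_tonelli_F (m2 := mu) (fun z => (cabs (f z))%:E) _ _) => //.
    exact: emeasurable_cabs.
  by move=> z; rewrite lee_fin cabs_ge0.
- by move=> x _; apply: cabs_Cint; apply: cmeas_comp.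
Qed.

Lemma Cint_preserving (phi : R -> R) : measurable_fun setT phi ->
  (forall A : set R, measurable A -> mu (phi @^-1` A) = mu A) ->
  forall f, cmeas f -> Cint (fun x => f (phi x)) = Cint f.
Proof.
by move=> mphi phiP f [m1 m2]; rewrite /Cint; congr pair; rewrite (Rint_preserving mphi phiP
   (f := fun x => _ (f x))).
Qed.

Lemma Cint_conj f : CL1 f -> Cint (fun x => cconj (f x)) = cconj (Cint f).
Proof.
move=> fi; rewrite /Cint/cconj/=; congr pair.
under eq_Rintegral do rewrite -mulN1r; rewrite RintegralZl ?mulN1r//; exact: CL1_im.
Qed.

Definition cconv f g x := Cint (fun y => cmul (f (x - y)) (g y)).

Lemma cmeas_conv_kernel f g : cmeas f -> cmeas g ->
  cmeas (fun z : R * R => cmul (f (z.1 - z.2)) (g z.2)).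
Proof.
move=> mf mg; apply: cmeas_mul; last by apply: cmeas_comp.
by apply: cmeas_comp => //; exact: measurable_sub2.
Qed.

Lemma CL1_conv_kernel f g : CL1 f -> CL1 g ->
  (\int[mu]_x \int[mu]_y (cabs (cmul (f (x - y)) (g y)))%:E < +oo)%E.
Proof.
move=> [mf fi] [mg gi].
under eq_integral do under eq_integral do rewrite cabsM EFinM.
rewrite (integral_econv (F := fun x => (cabs (f x))%:E) (G := fun x => (cabs (g x))%:E)).
- by rewrite lte_mul_pinfty// ?integral_ge0// => [x _|]; rewrite ?lee_fin ?cabs_ge0// ge0_fin_numE// integral_ge0// => x _; rewrite lee_fin cabs_ge0.
- exact: emeasurable_cabs.
- exact: emeasurable_cabs.
- by move=> x; rewrite lee_fin cabs_ge0.
- by move=> x; rewrite lee_fin cabs_ge0.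
Qed.

Lemma CL1_conv f g : CL1 f -> CL1 g -> CL1 (cconv f g).
Proof.
move=> fi gi; apply: (CL1_Cint2 (f := fun z => cmul (f (z.1 - z.2)) (g z.2))).
  by apply: cmeas_conv_kernel; [case: fi|case: gi].
have := CL1_conv_kernel fi gi; by [].
Qed.

End ComplexIntegral.

(** * The Fourier transform of integrable functions *)

Section Fourier.
Variable R : realType.
Local Notation mu := (@lebesgue_measure R).
Local Notation L1 f := (integrable mu setT (EFin \o f)).
Implicit Types f g h : R -> cplx R.

Definition FI f (xi : R) : cplx R := Cint (fun x => cmul (f x) (cexpi (- (xi * x)))).
Definition k0 : R := (Num.sqrt (2 * pi))^-1.
Definition FT f xi := cscalec k0 (FI f xi).

Lemma k0_gt0 : 0 < k0.
Proof. by rewrite invr_gt0 sqrtr_gt0 mulr_gt0// pi_gt0. Qed.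

Lemma k0_sqr : k0 ^+ 2 = (2 * pi)^-1.
Proof. by rewrite exprVn sqr_sqrtr// mulr_ge0// pi_ge0. Qed.

Lemma cmeas_FI_kernel f : cmeas f ->
  cmeas (fun z : R * R => cmul (f z.2) (cexpi (- (z.1 * z.2)))).
Proof.
move=> mf; apply: cmeas_mul; first exact: cmeas_comp.
by apply: cmeas_expi; mfun.
Qed.

Lemma cmeas_FI f : cmeas f -> cmeas (FI f).
Proof. by move=> mf; exact: (cmeas_Cint2 (cmeas_FI_kernel mf)). Qed.

Lemma CL1_expi f (a : R -> R) : measurable_fun setT a -> CL1 f -> CL1 (fun x => cmul (f x) (cexpi (a x))).
Proof.
move=> ma fi; under eq_fun do rewrite cmulC.
apply: (@CL1_bmul _ _ _ 1) => //; first exact: cmeas_expi.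
by move=> x; rewrite cabs_expi.
Qed.


Definition bdd f := exists C, forall x, cabs (f x) <= C.

Lemma CL1_convk f g x : cmeas f -> bdd f -> CL1 g -> CL1 (fun y => cmul (f (x - y)) (g y)).
Proof.
move=> mf [C fC] gi; apply: (@CL1_bmul _ _ _ C) => //.
by apply: cmeas_comp => //; exact: mreflect.
Qed.

(** Boundedness of [f] makes the convolution integral converge at every point, so the exponential
    can be moved inside it everywhere and not only almost everywhere. *)
Lemma FI_conv f g xi : CL1 f -> bdd f -> CL1 g ->
  FI (cconv f g) xi = cmul (FI f xi) (FI g xi).
Proof.
move=> fi fb gi; have [mf _] := fi; have [mg _] := gi.
rewrite {1}/FI.
have mxi : measurable_fun setT (fun x : R => - (xi * x)) by mfun.
pose f' x := cmul (f x) (cexpi (- (xi * x))).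
pose g' x := cmul (g x) (cexpi (- (xi * x))).
have f'i : CL1 f' by exact: CL1_expi.
have g'i : CL1 g' by exact: CL1_expi.
transitivity (Cint (cconv f' g')).
  apply: eq_Cint => x; rewrite cmulC /cconv.
  rewrite -Cint_cmul; last by apply: CL1_convk.
  apply: eq_Cint => y.
  have -> : - (xi * x) = - (xi * (x - y)) + - (xi * y) by ring.
  rewrite cexpiD /f' /g'; set a := cexpi _; set b := cexpi _.
  by rewrite /cmul/=; congr pair; ring.
have mk := cmeas_conv_kernel (proj1 f'i) (proj1 g'i).
have := Cint_swap mk; rewrite /= /cconv => ->; last exact: CL1_conv_kernel.
rewrite -/(FI g xi) -Cint_cmul//; apply: eq_Cint => y /=.
have f'y : CL1 (fun x => f' (x - y)).
  split; first by apply: cmeas_comp (proj1 f'i) (mshift _).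
  rewrite (@ge0_int_preserving R (fun x => x - y) (mshift (- y)) (leb_shift (- y)) (fun x => (cabs (f' x))%:E)).
  - by case: f'i.
  - by apply: emeasurable_cabs; case: f'i.
  - by move=> x; rewrite lee_fin cabs_ge0.
under eq_fun do rewrite cmulC.
rewrite Cint_cmul// cmulC; congr cmul.
by rewrite (@Cint_preserving R (fun x => x - y) (mshift (- y)) (leb_shift (- y)))//; case: f'i.
Qed.

Lemma FT_conv f g xi : CL1 f -> bdd f -> CL1 g ->
  FT (cconv f g) xi = cscalec k0^-1 (cmul (FT f xi) (FT g xi)).
Proof.
move=> fi fb gi; rewrite /FT FI_conv//.
have k := gt_eqF k0_gt0.
by rewrite /cscalec /cmul /=; congr pair; field; rewrite k.
Qed.

Lemma Rint_cdot f (z : cplx R) : CL1 f ->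
  Rintegral mu setT (fun x => cdot (f x) z) = cdot (Cint f) z.
Proof.
move=> fi; have f1 := CL1_re fi; have f2 := CL1_im fi.
rewrite /cdot RintegralD ?RintegralZr//.
- by under eq_fun do rewrite mulrC; exact: L1_scale.
- by under eq_fun do rewrite mulrC; exact: L1_scale.
Qed.

Definition ip f g : R := Rintegral mu setT (fun x => cdot (f x) (g x)).
Definition n2 f : R := Rintegral mu setT (fun x => cnorm2 (f x)).

Lemma cdotC (z w : cplx R) : cdot z w = cdot w z.
Proof. by rewrite /cdot; ring. Qed.

Lemma cdot_abs (z w : cplx R) : `|cdot z w| <= cabs z * cabs w.
Proof.
rewrite ler_norml cdot_le andbT lerNl.
have -> : - cdot z w = cdot z (cscalec (-1) w) by rewrite /cdot/=; ring.
by rewrite (le_trans (cdot_le _ _))// cabs_scale normrN1 mul1r.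
Qed.

(** Fubini for the kernel [e^(-i x y)]. The reflection appears because [cdot] conjugates one of its
    arguments. *)
Lemma ip_FI f g : CL1 f -> CL1 g -> ip (FI f) g = ip f (fun x => FI g (- x)).
Proof.
move=> fi gi; have [mf _] := fi; have [mg _] := gi.
rewrite /ip.
pose K (z : R * R) := cdot (cmul (f z.2) (cexpi (- (z.1 * z.2)))) (g z.1).
have mK : measurable_fun setT K.
  by apply: measurable_cdot; [exact: cmeas_FI_kernel|exact: cmeas_comp].
transitivity (Rintegral mu setT (fun x => Rintegral mu setT (fun y => K (x, y)))).
  apply: eq_Rintegral => x _ /=; rewrite /K /= Rint_cdot//.
  by apply: CL1_expi => //; mfun.
rewrite RFubini//.
  apply: eq_Rintegral => x _ /=; rewrite /K /= cdotC /FI -Rint_cdot; last first.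
    by apply: CL1_expi => //; mfun.
  apply: eq_Rintegral => y _ /=.
  have -> : - (- x * y) = y * x by ring.
  by rewrite cexpiN; set a := cexpi _; rewrite /cdot/=; ring.
apply: (@le_lt_trans _ _ (\int[mu]_x \int[mu]_y ((cabs (g x))%:E * (cabs (f y))%:E))%E).
  apply: ge0_le_integral => //.
  - by move=> x _; exact: integral_ge0.
  - refine (measurable_fun_fubini_tonelli_F (m2 := mu) (fun z => (`|K z|)%:E) _ _) => //.
    by apply/measurable_EFinP; exact: measurableT_comp.
  - refine (measurable_fun_fubini_tonelli_F (m2 := mu) (fun z => ((cabs (g z.1))%:E * (cabs (f z.2))%:E)%E) _ _).
      by apply: emeasurable_funM; apply: emeasurable_cabs; apply: cmeas_comp.
    by move=> z; rewrite mule_ge0// lee_fin cabs_ge0.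
  - move=> x _; apply: ge0_le_integral => //.
    + by apply/measurable_EFinP; apply: measurableT_comp => //; exact: measurableT_comp.
    + by apply: emeasurable_funM; [|apply: emeasurable_cabs].
    + move=> y _; rewrite lee_fin /K /= (le_trans (cdot_abs _ _))//.
      by rewrite cabsM cabs_expi mulr1 mulrC.
have k h : cmeas h -> (forall x, 0 <= (cabs (h x))%:E)%E by move=> _ x; rewrite lee_fin cabs_ge0.
rewrite (_ : (\int[mu]_x _)%E =
    (\int[mu]_x ((cabs (g x))%:E * \int[mu]_y (cabs (f y))%:E))%E); last first.
  apply: eq_integral => x _; rewrite ge0_integralZl//.
  - exact: (emeasurable_cabs mf).
  - by move=> y _; exact: (k f).
  - exact: (k g).
rewrite ge0_integralZr//; last 3 first.
- exact: (emeasurable_cabs mg).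
- by move=> y _; exact: (k g).
- by apply: integral_ge0 => y _; exact: (k f).
rewrite lte_mul_pinfty//.
- by apply: integral_ge0 => y _; exact: (k g).
- by rewrite ge0_fin_numE; [case: gi|apply: integral_ge0 => y _; exact: (k g)].
- by case: fi.
Qed.

Lemma L2P f : L2 f <-> cmeas f /\ (\int[mu]_x (cnorm2 (f x))%:E < +oo)%E.
Proof. by split => [[? [? ?]]|[[? ?] ?]]. Qed.

Lemma L2_cmeas f : L2 f -> cmeas f. Proof. by case/L2P. Qed.

Lemma L2_n2 f : L2 f -> L1 (fun x => cnorm2 (f x)).
Proof.
move=> /L2P[mf fi]; apply: L1_of_lty; first exact: measurable_cnorm2.
by under eq_integral do rewrite ger0_norm ?cnorm2_ge0//.
Qed.

Lemma n2_EFin f : L2 f -> ((n2 f)%:E = \int[mu]_x (cnorm2 (f x))%:E)%E.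
Proof. by move=> fi; rewrite ge0_Rint_EFin//; exact: L2_n2. Qed.

Lemma le_L2 f (g : R -> R) : cmeas f -> (forall x, cnorm2 (f x) <= g x) -> L1 g -> L2 f.
Proof.
move=> mf fg ig; apply/L2P; split=> //.
suff : L1 (fun x => cnorm2 (f x)).
  by move/L1_lty; under eq_integral do rewrite ger0_norm ?cnorm2_ge0//.
by apply: le_L1 ig; [exact: measurable_cnorm2|move=> x; rewrite ger0_norm ?cnorm2_ge0].
Qed.

Lemma cdot_le2 (z w : cplx R) : `|cdot z w| <= cnorm2 z + cnorm2 w.
Proof.
rewrite ler_norml -subr_ge0 opprK -[X in _ && X]subr_ge0 /cdot /cnorm2.
apply/andP; split.
- suff : 0 <= (z.1 + w.1)^+2 + (z.2 + w.2)^+2 + z.1^+2 + z.2^+2 + w.1^+2 + w.2^+2 by lra.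
  by rewrite !addr_ge0 ?sqr_ge0.
- suff : 0 <= (z.1 - w.1)^+2 + (z.2 - w.2)^+2 + z.1^+2 + z.2^+2 + w.1^+2 + w.2^+2 by lra.
  by rewrite !addr_ge0 ?sqr_ge0.
Qed.

Lemma L2_dot f g : L2 f -> L2 g -> L1 (fun x => cdot (f x) (g x)).
Proof.
move=> f2 g2; apply: (@le_L1 _ _ (fun x => cnorm2 (f x) + cnorm2 (g x))).
- by apply: measurable_cdot; exact: L2_cmeas.
- by move=> x; exact: cdot_le2.
- by apply: L1_add; exact: L2_n2.
Qed.

Lemma L2_sub f g : L2 f -> L2 g -> L2 (fun x => csub (f x) (g x)).
Proof.
move=> f2 g2; apply: (@le_L2 _ (fun x => 2 * cnorm2 (f x) + 2 * cnorm2 (g x))).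
- by apply: cmeas_sub; exact: L2_cmeas.
- move=> x; rewrite /cnorm2 /csub /=; set a := (f x).1; set b := (f x).2.
  set c := (g x).1; set d := (g x).2.
  suff : 0 <= (a + c) ^+ 2 + (b + d)^+2 by lra.
  by rewrite addr_ge0 ?sqr_ge0.
- by apply: L1_add; apply: L1_scale; exact: L2_n2.
Qed.

Lemma L2_scale (a : R) f : L2 f -> L2 (fun x => cscalec a (f x)).
Proof.
move=> f2; apply: (@le_L2 _ (fun x => a ^+ 2 * cnorm2 (f x))).
- by apply: cmeas_scale; [mfun|exact: L2_cmeas].
- by move=> x; rewrite cnorm2_scale.
- by apply: L1_scale; exact: L2_n2.
Qed.

Lemma n2_ge0 f : 0 <= n2 f.
Proof. by apply: Rintegral_ge0 => x _; exact: cnorm2_ge0. Qed.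

Lemma ipC f g : ip f g = ip g f.
Proof. by apply: eq_Rintegral => x _; rewrite cdotC. Qed.

Lemma ip_ff f : ip f f = n2 f.
Proof. by apply: eq_Rintegral => x _; rewrite cdotzz. Qed.

Lemma n2_scale (a : R) f : L2 f -> n2 (fun x => cscalec a (f x)) = a ^+ 2 * n2 f.
Proof.
move=> f2; rewrite /n2 -RintegralZl//; last exact: L2_n2.
by apply: eq_Rintegral => x _; rewrite cnorm2_scale.
Qed.

Lemma ip_scale (a : R) f g : L2 f -> L2 g -> ip f (fun x => cscalec a (g x)) = a * ip f g.
Proof.
move=> f2 g2; rewrite /ip -RintegralZl//; last exact: L2_dot.
by apply: eq_Rintegral => x _; rewrite /cdot /=; ring.
Qed.

Lemma ip_sub f g h : L2 f -> L2 g -> L2 h ->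
  ip f (fun x => csub (g x) (h x)) = ip f g - ip f h.
Proof.
move=> f2 g2 h2; rewrite /ip -RintegralB//; [|exact: L2_dot..].
by apply: eq_Rintegral => x _; rewrite /cdot /=; ring.
Qed.

Lemma n2_sub f g : L2 f -> L2 g ->
  n2 (fun x => csub (f x) (g x)) = n2 f - 2 * ip f g + n2 g.
Proof.
move=> f2 g2; have fg := L2_dot f2 g2; have ff := L2_n2 f2; have gg := L2_n2 g2.
rewrite /n2 /ip -RintegralZl// -RintegralB//; last exact: L1_scale.
rewrite -RintegralD//; last by apply: L1_sub => //; exact: L1_scale.
by apply: eq_Rintegral => x _; rewrite /cdot /cnorm2 /=; ring.
Qed.

Lemma ip_CS f g : L2 f -> L2 g -> ip f g ^+ 2 <= n2 f * n2 g.
Proof.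
move=> f2 g2.
have q t : 0 <= n2 f - 2 * t * ip f g + t ^+ 2 * n2 g.
  have := n2_ge0 (fun x => csub (f x) (cscalec t (g x))).
  rewrite n2_sub//; last exact: L2_scale.
  by rewrite ip_scale// n2_scale// mulrA.
have [g0|g0] := eqVneq (n2 g) 0.
  rewrite g0 mulr0.
  (* With [n2 g = 0] the quadratic is affine in [t], and at this [t] it would equal [- n2 f - 2],
     unless [ip f g = 0]. *)
  have := q ((n2 f + 1) / ip f g); rewrite g0 mulr0 addr0.
  have [->|i0] := eqVneq (ip f g) 0; first by rewrite expr0n.
  have -> : 2 * ((n2 f + 1) / ip f g) * ip f g = 2 * (n2 f + 1) by field.
  by have := n2_ge0 f; lra.
have gp : 0 < n2 g by rewrite lt_neqAle eq_sym g0 n2_ge0.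
(* The minimiser of the quadratic. *)
have := q (ip f g / n2 g).
have -> : n2 f - 2 * (ip f g / n2 g) * ip f g + (ip f g / n2 g) ^+ 2 * n2 g =
  n2 f - ip f g ^+ 2 / n2 g by field.
by rewrite subr_ge0 ler_pdivrMr.
Qed.

Lemma n2_eq0 f : L2 f -> n2 f = 0 -> {ae mu, forall x, f x = (0, 0)}.
Proof.
move=> f2 h.
have mf := L2_cmeas f2.
have e : (\int[mu]_x `|(cnorm2 (f x))%:E|)%E = 0%E.
  under eq_integral do rewrite /= ger0_norm ?cnorm2_ge0//.
  by rewrite -n2_EFin// h.
move/ae_eq_integral_abs : e => /(_ measurableT (emeasurable_cnorm2 mf)).
by apply: filterS => x /(_ I)/= [] /eqP; rewrite cnorm2_eq0 => /eqP.
Qed.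

(** Bounded with bounded support: a class inside both [L^1] and [L^2], stable under convolution, in
    which every integral converges absolutely, and from which [truncf] approximates any square
    integrable function. One [M] bounds both values and support. *)
Definition nice f := cmeas f /\ exists M, [/\ 0 < M, forall x, cabs (f x) <= M
  & forall x, M < `|x| -> f x = (0, 0)].

Lemma L1_box (M : R) : L1 (\1_(`[- M, M])).
Proof. exact: integrable_indic_itv. Qed.

Lemma in_box (M x : R) : (\1_(`[- M, M]) x : R) = ((`|x| <= M)%R : bool)%:R.
Proof. by rewrite indicE mem_setE in_itv/= ler_norml. Qed.

Lemma nice_CL1 f : nice f -> CL1 f.
Proof.
move=> [mf [M [M0 fM fM0]]]; apply: (@le_CL1 _ _ (fun x => M * \1_(`[- M, M]) x)) => //.
- move=> x; rewrite in_box; case: (leP `|x| M) => h /=; first by rewrite mulr1.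
  by rewrite fM0// cabs0 mulr0.
- by apply: L1_scale; exact: L1_box.
Qed.

Lemma nice_bdd f : nice f -> bdd f.
Proof. by move=> [_ [M [_ h _]]]; exists M. Qed.

Lemma nice_L2 f : nice f -> L2 f.
Proof.
move=> [mf [M [M0 fM fM0]]]; apply: (@le_L2 _ (fun x => M ^+ 2 * \1_(`[- M, M]) x)) => //.
- move=> x; rewrite in_box -cabs_sqr; case: (leP `|x| M) => h /=.
    by rewrite mulr1 lerXn2r ?nnegrE ?cabs_ge0 ?(ltW M0).
  by rewrite fM0// cabs0 expr0n mulr0.
- by apply: L1_scale; exact: L1_box.
Qed.

Lemma cconv_abs f g x : cmeas f -> cmeas g ->
  ((cabs (cconv f g x))%:E <= econv (fun x => (cabs (f x))%:E) (fun x => (cabs (g x))%:E) x)%E.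
Proof.
move=> mf mg; apply: le_trans (cabs_Cint _) _.
  by apply: cmeas_mul => //; apply: cmeas_comp => //; exact: mreflect.
by under eq_integral do rewrite cabsM EFinM.
Qed.

Lemma nice_conv f g : nice f -> nice g -> nice (cconv f g).
Proof.
move=> nf ng; have [mf [M [M0 fM fM0]]] := nf; have [mg [N [N0 gN gN0]]] := ng.
split; first by case: (CL1_conv (nice_CL1 nf) (nice_CL1 ng)).
have gi := nice_CL1 ng.
pose I := Rintegral mu setT (fun x => cabs (g x)).
have I0 : 0 <= I by apply: Rintegral_ge0 => x _; exact: cabs_ge0.
(* [M + N] bounds the support and [M * I] the values; a single constant has to do both. *)
exists (M + N + M * I); split.
- by rewrite ltr_wpDr ?addr_gt0// mulr_ge0// ltW.
- move=> x; have : cabs (cconv f g x) <= M * I.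
    rewrite -lee_fin; apply: le_trans (cconv_abs x mf mg) _.
    rewrite /I -RintegralZl//; last exact: CL1_cabs.
    rewrite ge0_Rint_EFin; last by apply: L1_scale; exact: CL1_cabs.
    apply: ge0_le_integral => //.
    + by move=> y _; rewrite mule_ge0// lee_fin cabs_ge0.
    + by apply: emeasurable_funM; apply: emeasurable_cabs => //; apply: cmeas_comp => //; exact: mreflect.
    + by apply/measurable_EFinP; apply: measurable_funM => //; exact: measurable_cabs.
    + by move=> y _; rewrite -EFinM lee_fin ler_wpM2r ?cabs_ge0.
  by move=> h; rewrite (le_trans h)// lerDr addr_ge0// ltW.
- move=> x hx; rewrite /cconv.
  have -> : (fun y => cmul (f (x - y)) (g y)) = (fun=> (0, 0)).
    apply/funext => y.
    have [yN|yN] := ltP N `|y|; first by rewrite gN0// /cmul/=; congr pair; ring.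
    rewrite fM0 ?cmul0//.
    have : `|x| <= `|x - y| + `|y| by rewrite -{1}(subrK y x) ler_normD.
    have : 0 <= M * I by rewrite mulr_ge0// ltW.
    lra.
  by rewrite /Cint; congr pair; rewrite Rintegral_cst// mul0r.
Qed.

Definition cutf (D : set R) f x := if x \in D then f x else (0, 0).

Lemma cutE (D : set R) f x : cutf D f x = cscalec (\1_D x) (f x).
Proof.
rewrite /cutf /cscalec indicE; case: ifP => _ /=; first by case: (f x) => a b; rewrite !mul1r.
by rewrite !mul0r.
Qed.

Lemma cmeas_cut (D : set R) f : measurable D -> cmeas f -> cmeas (cutf D f).
Proof.
move=> mD mf; rewrite (_ : cutf D f = fun x => cscalec (\1_D x) (f x)).
  by apply: cmeas_scale => //; exact: measurable_indic.
by apply/funext => x; rewrite cutE.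
Qed.

Lemma cnorm2_cut (D : set R) f x : cnorm2 (cutf D f x) = \1_D x * cnorm2 (f x).
Proof. by rewrite cutE cnorm2_scale indicE; case: (_ \in _); rewrite ?expr0n ?expr1n. Qed.

Lemma cnorm2_cut_le (D : set R) f x : cnorm2 (cutf D f x) <= cnorm2 (f x).
Proof. by rewrite cnorm2_cut indicE; case: (_ \in _); rewrite ?mul1r ?mul0r ?cnorm2_ge0. Qed.

Lemma L2_cut (D : set R) f : measurable D -> L2 f -> L2 (cutf D f).
Proof.
move=> mD f2; apply: (@le_L2 _ (fun x => cnorm2 (f x))).
- by apply: cmeas_cut => //; exact: L2_cmeas.
- exact: cnorm2_cut_le.
- exact: L2_n2.
Qed.

Lemma cabs_cut (D : set R) f x : cabs (cutf D f x) = \1_D x * cabs (f x).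
Proof. by rewrite cutE cabs_scale indicE ger0_norm. Qed.

Lemma CL1_cut (D : set R) f : measurable D -> L1 (\1_D) -> L2 f -> CL1 (cutf D f).
Proof.
move=> mD D1 f2; apply: (@le_CL1 _ _ (fun x => \1_D x + cnorm2 (f x))).
- by apply: cmeas_cut => //; exact: L2_cmeas.
- move=> x; rewrite cabs_cut indicE; case: (_ \in _).
    by rewrite mul1r -cabs_sqr /=; have := sqr_ge0 (cabs (f x) - 1); have := cabs_ge0 (f x); nra.
  by rewrite mul0r add0r cnorm2_ge0.
- by apply: L1_add => //; exact: L2_n2.
Qed.

Lemma CL1_cut_itv (a b : R) f : L2 f -> CL1 (cutf `[a, b] f).
Proof. by move=> f2; apply: CL1_cut => //; exact: integrable_indic_itv. Qed.

Lemma FT_truncE f (N : nat) xi : FT_trunc f N xi = FT (cutf `[- N%:R, N%:R] f) xi.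
Proof.
rewrite /FT_trunc /FT /cscalec /k0 /FI /Cint /=; congr (_ * _, _ * _).
- rewrite Rintegral_mkcond; apply: eq_Rintegral => x _; rewrite patchE /cutf; case: ifP => _ /=.
    by rewrite cosN sinN; ring.
  by rewrite !mul0r subr0.
- rewrite Rintegral_mkcond; apply: eq_Rintegral => x _; rewrite patchE /cutf; case: ifP => _ /=.
    by rewrite cosN sinN; ring.
  by rewrite !mul0r addr0.
Qed.

End Fourier.

(** * Plancherel's theorem *)

Section Poisson.
Variable R : realType.
Local Notation mu := (@lebesgue_measure R).
Local Notation L1 f := (integrable mu setT (EFin \o f)).

Lemma is_derive1_continuous (f : R -> R) (x d : R) : is_derive x 1 f d -> {for x, continuous f}.
Proof. by move=> h; apply: differentiable_continuous; apply/derivable1_diffP; exact: ex_derive. Qed.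

(** Evenness reduces the integral to the half-line, where the absolute values in the integrands
    treated below disappear and an explicit antiderivative exists. *)
Lemma integral_even_FTC (f f' F : R -> R) (l : R) :
  (forall x, 0 <= f x) -> continuous f -> (forall x, f (- x) = f x) ->
  (forall x : R, 0 <= x -> is_derive x (1 : R) F (f' x)) -> (forall x, 0 < x -> f x = f' x) ->
  F x @[x --> +oo] --> l -> (\int[mu]_x (f x)%:E)%E = (2 * (l - F 0))%:E.
Proof.
move=> f0 cf ev dF ff' Fl.
rewrite ge0_symfun_integralT//; last by move=> x /=; rewrite ev.
rewrite -set_itvcy (@ge0_continuous_FTC2y R f F 0 l)//.
- exact: continuous_subspaceT.
- by move=> x x0; have := dF x (ltW x0) => h; exact: ex_derive.
- by apply: cvg_at_right_filter; exact: is_derive1_continuous (dF 0 (lexx 0)).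
- move=> x; rewrite in_itv/= andbT => x0; rewrite derive1E.
  by have := dF x (ltW x0) => h; rewrite derive_val ff'.
Qed.

Variable e : R.
Hypothesis e0 : 0 < e.

(** An Abel summation factor: it increases to 1 as [e] decreases to 0, and its transform is the
    Poisson kernel [2 e / (e^2 + x^2)], which is positive with a mass independent of [e]. *)
Definition pkernel (x : R) : R := expR (- (e * `|x|)).

Lemma cvgy_expRN : expR (- (e * x)) @[x --> +oo] --> 0.
Proof.
apply: (cvg_comp (fun x => e * x) (fun x => expR (- x))); last exact: cvgr_expR.
exact: gt0_cvgMry.
Qed.

Lemma continuous_pkernel : continuous pkernel.
Proof.
move=> x; apply: continuous_comp; last exact: continuous_expR.
apply: continuousN; apply: continuousM; first exact: cst_continuous.
exact: norm_continuous.
Qed.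

(** The summand 1 makes the integrand nonnegative, as [integral_even_FTC] requires;
    [Rint_pkernel_cos] removes it again by comparison with [xi = 0]. *)
Lemma pkernel_cos (xi : R) :
  (\int[mu]_x (pkernel x * (1 + cos (xi * x)))%:E)%E = (2 / e + 2 * e / (e ^+ 2 + xi ^+ 2))%:E.
Proof.
have en := lt0r_neq0 e0.
have d0 : 0 < e ^+ 2 + xi ^+ 2 by rewrite ltr_pwDl ?sqr_ge0// exprn_gt0.
have dn := lt0r_neq0 d0.
pose F x := expR (- (e * x)) * ((xi * sin (xi * x) - e * cos (xi * x)) / (e ^+ 2 + xi ^+ 2) - e^-1).
pose f' x := expR (- (e * x)) * (1 + cos (xi * x)).
have dF (x : R) : is_derive x (1 : R) F (f' x).
  rewrite /F /f'; apply: is_derive_eq.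
  rewrite /GRing.scale /=.
  by field; rewrite dn en.
have cf : continuous (fun x : R => pkernel x * (1 + cos (xi * x))).
  move=> x; apply: continuousM; first exact: continuous_pkernel.
  apply: continuousD; first exact: cst_continuous.
  apply: continuous_comp; last exact: continuous_cos.
  by apply: continuousM; first exact: cst_continuous.
rewrite (@integral_even_FTC _ f' F 0)//.
- by rewrite /F !mulr0 oppr0 expR0 sin0 cos0; congr EFin; field; rewrite dn en.
- by move=> x; rewrite mulr_ge0 ?expR_ge0//; have := cos_geN1 (xi * x); lra.
- by move=> x; rewrite /pkernel normrN mulrN cosN.
- by move=> x x0; rewrite /pkernel /f' gtr0_norm.
- pose C := (`|xi| + e) / (e ^+ 2 + xi ^+ 2) + e^-1.
  have FC x : `|F x| <= C * expR (- (e * x)).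
    rewrite /F normrM ger0_norm ?expR_ge0// mulrC ler_wpM2r ?expR_ge0//.
    rewrite /C (le_trans (ler_normB _ _))// (gtr0_norm (x := e^-1)) ?invr_gt0// lerD2r.
    rewrite normrM normfV (gtr0_norm d0) ler_wpM2r ?invr_ge0 ?(ltW d0)//.
    rewrite (le_trans (ler_normB _ _))// !normrM (gtr0_norm e0) lerD//.
      by rewrite ler_piMr// ler_norml sin_geN1 sin_le1.
    by rewrite ler_piMr ?(ltW e0)// ler_norml cos_geN1 cos_le1.
  have C0 : C * expR (- (e * x)) @[x --> +oo] --> 0.
    rewrite -[X in _ --> X](mulr0 C); apply: cvgM; [exact: cvg_cst|exact: cvgy_expRN].
  apply: (@squeeze_cvgr _ _ _ _ (fun x => - (C * expR (- (e * x)))) (fun x => C * expR (- (e * x)))) => //.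
  + by apply: nearW => x; rewrite -ler_norml.
  + by rewrite -[X in _ --> X]oppr0; apply: cvgN.
Qed.

Lemma pkernel_gt0 x : 0 < pkernel x. Proof. exact: expR_gt0. Qed.
Lemma measurable_pkernel : measurable_fun setT pkernel.
Proof. exact: continuous_measurable_fun continuous_pkernel. Qed.

Lemma measurable_cos_lin (xi : R) : measurable_fun setT (fun x : R => cos (xi * x)).
Proof.
apply: measurableT_comp; last by mfun.
by apply: continuous_measurable_fun; exact: continuous_cos.
Qed.

Lemma measurable_sin_lin (xi : R) : measurable_fun setT (fun x : R => sin (xi * x)).
Proof.
apply: measurableT_comp; last by mfun.
by apply: continuous_measurable_fun; exact: continuous_sin.
Qed.

Lemma pkernel_L1 : L1 pkernel.
Proof.
apply: (@le_L1 _ _ (fun x => pkernel x * (1 + cos (0 * x)))).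
- exact: measurable_pkernel.
- move=> x; rewrite gtr0_norm ?pkernel_gt0// mul0r cos0.
  by have := pkernel_gt0 x; lra.
- apply: L1_of_lty.
    apply: measurable_funM; first exact: measurable_pkernel.
    by apply: measurable_funD; [mfun|exact: measurable_cos_lin].
  under eq_integral => x _.
    rewrite ger0_norm; last by rewrite mulr_ge0 ?(ltW (pkernel_gt0 x))// mul0r cos0; lra.
    over.
  by rewrite /= pkernel_cos ltry.
Qed.

Lemma L1_pkernelM (h : R -> R) : measurable_fun setT h -> (forall x, `|h x| <= 1) ->
  L1 (fun x => pkernel x * h x).
Proof.
move=> mh h1; apply: (le_L1 _ _ pkernel_L1).
  by apply: measurable_funM => //; exact: measurable_pkernel.
by move=> x; rewrite normrM gtr0_norm ?pkernel_gt0// ler_piMr// ltW// pkernel_gt0.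
Qed.

Lemma Rint_pkernel_cos (xi : R) :
  Rintegral mu setT (fun x => pkernel x * cos (xi * x)) = 2 * e / (e ^+ 2 + xi ^+ 2).
Proof.
have k (xi' : R) : L1 (fun x => pkernel x * cos (xi' * x)).
  apply: L1_pkernelM; first exact: measurable_cos_lin.
  by move=> x; rewrite ler_norml cos_geN1 cos_le1.
have h (xi' : R) : Rintegral mu setT pkernel + Rintegral mu setT (fun x => pkernel x * cos (xi' * x))
   = 2 / e + 2 * e / (e ^+ 2 + xi' ^+ 2).
  rewrite -RintegralD//; last exact: pkernel_L1.
  rewrite -[RHS]/(fine (2 / e + 2 * e / (e ^+ 2 + xi' ^+ 2))%:E) -pkernel_cos.
  by apply: eq_Rintegral => x _; rewrite mulrDr mulr1.
have := h 0.
have -> : Rintegral mu setT (fun x => pkernel x * cos (0 * x)) = Rintegral mu setT pkernel.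
  by apply: eq_Rintegral => x _; rewrite mul0r cos0 mulr1.
have := h xi; rewrite expr0n/= addr0.
have -> : 2 * e / e ^+ 2 = 2 / e by field; exact: lt0r_neq0.
have lin (a b c d : R) : a + b = c + d -> a + a = c + c -> b = d by lra.
exact: lin.
Qed.

Lemma FI_pkernel (x : R) : FI (fun y => (pkernel y, 0)) x = (2 * e / (e ^+ 2 + x ^+ 2), 0).
Proof.
rewrite /FI /Cint; congr pair.
- rewrite -Rint_pkernel_cos; apply: eq_Rintegral => y _ /=.
  by rewrite cosN mul0r subr0.
(* The imaginary part is the integral of an odd function, so it equals its own opposite. *)
- set I := Rintegral _ _ _.
  have II : I = - I.
    rewrite {1}/I -(@Rint_preserving R (fun y => 0 - y) (mreflect 0) (leb_reflect 0)
      (fun y => (cmul (pkernel y, 0) (cexpi (- (x * y)))).2)).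
      rewrite /I -[RHS]mulN1r -RintegralZl//.
        apply: eq_Rintegral => y _ /=; rewrite /pkernel sub0r normrN.
        by rewrite mulrN opprK sinN; ring.
      rewrite /=; apply: (@eq_integrable _ _ _ mu setT measurableT (EFin \o (fun y => pkernel y * (- sin (x * y))))).
        by move=> y _ /=; rewrite mul0r addr0 sinN.
      apply: L1_pkernelM; first by apply: measurable_funN; exact: measurable_sin_lin.
      by move=> y; rewrite normrN ler_norml sin_geN1 sin_le1.
    apply: measurable_funD; apply: measurable_funM => //=.
    + exact: measurable_pkernel.
    + by under eq_fun do rewrite sinN; apply: measurable_funN; exact: measurable_sin_lin.
    + by under eq_fun do rewrite cosN; exact: measurable_cos_lin.
  by lra.
Qed.

Lemma int_poisson : (\int[mu]_x (2 * e / (e ^+ 2 + x ^+ 2))%:E)%E = (2 * pi)%:E.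
Proof.
have en := lt0r_neq0 e0.
have d0 x : 0 < e ^+ 2 + x ^+ 2 by rewrite ltr_pwDl ?sqr_ge0// exprn_gt0.
have dF (x : R) : is_derive x 1 (fun x => 2 * atan (x / e)) (2 * e / (e ^+ 2 + x ^+ 2)).
  apply: is_derive_eq.
  rewrite /GRing.scale /=; field.
  by rewrite en (lt0r_neq0 (d0 x)).
have cf : continuous (fun x : R => 2 * e / (e ^+ 2 + x ^+ 2)).
  move=> x; apply: (@cvgM _ R); first exact: cvg_cst.
  apply: cvgV; first exact: lt0r_neq0.
  apply: cvgD; first exact: cvg_cst.
  exact: exprn_continuous.
rewrite (@integral_even_FTC _ (fun x => 2 * e / (e ^+ 2 + x ^+ 2)) (fun x => 2 * atan (x / e)) pi)//.
- by rewrite mul0r atan0 mulr0 subr0.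
- by move=> x; rewrite mulr_ge0 ?invr_ge0 ?(ltW (d0 x))// mulr_ge0// ltW.
- by move=> x; rewrite sqrrN.
- rewrite (_ : pi = 2 * (pi / 2)); last by field.
  apply: cvgM; first exact: cvg_cst.
  apply: (cvg_comp (fun x => x / e) (@atan R)); last exact: cvgy_atan.
  by apply: gt0_cvgMly => //; rewrite invr_gt0.
Qed.

End Poisson.

(** * Continuity of translations in the mean *)

Section TranslationContinuity.
Variable R : realType.
Local Notation mu := (@lebesgue_measure R).
Local Notation L1 f := (integrable mu setT (EFin \o f)).

Lemma unif_continuous_shift (g : R -> R) (K : set R) (eta : R) : continuous g -> compact K ->
  0 < eta -> exists2 d : R, 0 < d & forall t, `|t| < d -> forall y, K y -> `|g (y + t) - g y| < eta.
Proof.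
move=> cg /compact_near_coveringP cK eta0.
have := cK R (nbhs (0 : R)) (fun t y => `|g (y + t) - g y| < eta) (nbhs_filter (0 : R)).
have h y : K y -> \forall y' \near y & t \near (0 : R), `|g (y' + t) - g y'| < eta.
  move=> Ky.
  have : (fun z : R * R => g (z.1 + z.2) - g z.1) z @[z --> (y, 0)] --> (0 : R).
    rewrite -[X in _ --> X](subrr (g (y + 0))) {2}addr0.
    apply: cvgB.
      apply: (@cvg_comp _ _ _ (fun z : R * R => z.1 + z.2) g _ (nbhs (y + 0))).
        apply: cvgD; [exact: cvg_fst|exact: cvg_snd].
      exact: cg.
    apply: (@cvg_comp _ _ _ (fun z : R * R => z.1) g _ (nbhs y)).
      exact: cvg_fst.
    exact: cg.
  move/cvgrPdist_lt => /(_ _ eta0); apply: filterS => z /=.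
  by rewrite sub0r normrN.
move=> /(_ h) /nbhs_ballP[d /= d0 dP]; exists d => // t td y Ky.
by apply: dP => //; rewrite /ball /= sub0r normrN.
Qed.

(* Approximate [f] in [L1] by a continuous function, which is uniformly continuous on a
   compact interval containing all the translated supports. *)
Lemma L1_translation (f : R -> R) (M eta : R) : measurable_fun setT f -> 0 < M ->
  (forall x, `|f x| <= M) -> (forall x, M < `|x| -> f x = 0) -> 0 < eta ->
  exists2 d : R, 0 < d & forall t, `|t| < d ->
    (\int[mu]_y (`|f (y + t) - f y|)%:E <= eta%:E)%E.
Proof.
move=> mf M0 fM fM0 eta0.
(* For [|t| < 1] a point of [E1] is moved inside [E], and outside [E1] both [f y] and [f (y + t)]
   vanish. *)
pose E : set R := `[- (M + 2), M + 2]%classic.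
pose E1 : set R := `[- (M + 1), M + 1]%classic.
have mE : measurable E by exact: measurable_itv.
have muE (a : R) : 0 <= a -> mu `[- a, a]%classic = (a + a)%:E.
  move=> a0; rewrite lebesgue_measure_itv/= lte_fin.
  case: ltP => h; first by rewrite -EFinD opprK.
  have a00 : a = 0 by lra.
  by rewrite a00 addr0.
have muEE : mu E = ((M + 2) + (M + 2))%:E by apply: muE; lra.
have Efin : (mu E < +oo)%E by rewrite muEE ltry.
have fE : mu.-integrable E (EFin \o f).
  apply: measurable_bounded_integrable => //.
  - exact: measurable_funS mf.
  - exists M; split; first exact: num_real.
    by move=> x Mx y _ /=; rewrite (le_trans (fM y))// ltW.
have [g [cg ig gf]] := approximation_continuous_integrable mE Efin fE.
have [n gn] : exists n, (\int[mu]_(z in E) `|(f z - g n z)%:E| < (eta / 4)%:E)%E.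
  have [_ /cvgrPdist_lt] := (fine_cvgP _ _).1 gf.
  have e4 : 0 < eta / 4 by lra.
  have [/cvg_is_fine Hf _] := (conj gf I).
  move=> /(_ _ e4) H2.
  have [n _ Hn] := filterI Hf H2.
  exists n; have [h1 h2] := Hn n (leqnn n).
  rewrite -(fineK h1) lte_fin; move: h2; rewrite /= sub0r normrN ger0_norm//.
  by apply: fine_ge0; exact: integral_ge0.
have cE1 : compact E1 by exact: segment_compact.
(* [E1] has length [2 (M + 1)], so the oscillation of [g n] contributes [eta / 2]; the approximation
   errors at [y] and [y + t] contribute [eta / 4] each. *)
have eta1 : 0 < eta / (4 * (M + 1)) by rewrite divr_gt0// mulr_gt0//; lra.
have [d d0 dP] := unif_continuous_shift (cg n) cE1 eta1.
exists (Num.min d 1); first by rewrite lt_min d0 ltr01.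
move=> t; rewrite lt_min => /andP[td t1].
pose h (y : R) : R := \1_E y * `|f y - g n y|.
have mg : measurable_fun setT (g n) by apply: continuous_measurable_fun; exact: cg.
have mh : measurable_fun setT h.
  apply: measurable_funM; first exact: measurable_indic.
  by apply: measurableT_comp => //; exact: measurable_funB.
have h0 y : 0 <= h y by rewrite mulr_ge0.
have ih : (\int[mu]_y (h y)%:E < (eta / 4)%:E)%E.
  rewrite (_ : (\int[mu]_y (h y)%:E)%E = (\int[mu]_(z in E) `|(f z - g n z)%:E|)%E)//.
  rewrite [RHS]integral_mkcond; apply: eq_integral => y _.
  rewrite patchE /h indicE; case: ifP => _ /=; first by rewrite mul1r.
  by rewrite mul0r.
have bound y : `|f (y + t) - f y| <= h (y + t) + h y + eta / (4 * (M + 1)) * \1_E1 y.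
  have : - 1 < t < 1 by rewrite -ltr_norml.
  move=> /andP[t1' t1''].
  rewrite [\1_E1 y]indicE mem_setE /=.
  have [yE1|yE1] := boolP (y \in `[- (M + 1), M + 1]).
    have := yE1; rewrite in_itv/= => /andP[y1 y2].
    have yE : y \in `[- (M + 2), M + 2] by rewrite in_itv/=; lra.
    have ytE : y + t \in `[- (M + 2), M + 2] by rewrite in_itv/=; lra.
    rewrite /h !indicE !mem_setE yE ytE /= !mul1r mulr1.
    have := dP t td y yE1.
    have -> : f (y + t) - f y = (f (y + t) - g n (y + t)) + (g n (y + t) - g n y)
        - (f y - g n y) by ring.
    move=> H.
    apply: le_trans (ler_normB _ _) _.
    have := ler_normD (f (y + t) - g n (y + t)) (g n (y + t) - g n y).
    have lin (a b c d' k : R) : c < d' -> a <= b + c -> a + k <= b + k + d' by lra.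
    exact: lin.
  have yM : M + 1 < `|y|.
    rewrite ltNge; apply: contra yE1 => H; rewrite in_itv/=.
    by rewrite -ler_norml.
  have ytM : M < `|y + t|.
    have : `|y| <= `|y + t| + `|t| by rewrite -{1}(addrK t y) ler_normB.
    lra.
  rewrite (fM0 y) ?(fM0 (y+t)) ?subrr ?normr0//; last lra.
  by rewrite mulr0 addr0 addr_ge0// mulr_ge0.
have mh' : measurable_fun setT (fun y : R => h (y + t)).
  by apply: measurableT_comp => //; exact: mshift.
have m1 : measurable_fun setT (fun y : R => (\1_E1 y : R)) by apply: measurable_indic; exact: measurable_itv.
apply: (@le_trans _ _ (\int[mu]_y ((h (y + t))%:E + (h y)%:E + (eta / (4 * (M + 1)))%:E * (\1_E1 y)%:E))%E).
  apply: ge0_le_integral => //.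
  - apply/measurable_EFinP; apply: measurableT_comp => //; apply: measurable_funB => //.
    by apply: measurableT_comp => //; exact: mshift.
  - apply: emeasurable_funD; first by apply: emeasurable_funD; exact/measurable_EFinP.
    by apply: emeasurable_funM => //; exact/measurable_EFinP.
  - by move=> y _; rewrite -EFinM -!EFinD lee_fin.
have e0 : 0 <= eta / (4 * (M + 1)) by exact: ltW.
rewrite ge0_integralD//; last 4 first.
- by move=> y _; rewrite adde_ge0// lee_fin.
- by apply: emeasurable_funD; exact/measurable_EFinP.
- by move=> y _; rewrite mule_ge0// lee_fin.
- by apply: emeasurable_funM => //; exact/measurable_EFinP.
rewrite ge0_integralD//; last 4 first.
- by move=> y _; rewrite lee_fin.
- exact/measurable_EFinP.
- by move=> y _; rewrite lee_fin.
- exact/measurable_EFinP.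
rewrite ge0_integralZl//; last exact/measurable_EFinP.
rewrite (@ge0_int_preserving R (fun y => y + t) (mshift t) (leb_shift t) (fun y => (h y)%:E))//; last exact/measurable_EFinP.
rewrite integral_indic//; last exact: measurable_itv.
rewrite (_ : _ (E1 `&` _) = (M + 1 + (M + 1))%:E); last first.
  by rewrite setIT; apply: muE; lra.
have -> : eta%:E = ((eta / 4)%:E + (eta / 4)%:E + (eta / (4 * (M + 1)))%:E * (M + 1 + (M + 1))%:E)%E.
  by rewrite -EFinM -!EFinD; congr EFin; field; apply: lt0r_neq0; lra.
by apply: leeD => //; apply: leeD; exact: ltW.
Qed.

End TranslationContinuity.

(** * Plancherel's identity for bounded functions with bounded support *)

Section Plancherel.
Variable R : realType.
Local Notation mu := (@lebesgue_measure R).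
Local Notation L1 f := (integrable mu setT (EFin \o f)).
Implicit Types f g h u : R -> cplx R.

(** Corresponds to conjugation of the transform. The form [0 - x] matches the invariance of the
    measure under [a - x]. *)
Definition crefl u (x : R) : cplx R := cconj (u (0 - x)).

Lemma nice_crefl u : nice u -> nice (crefl u).
Proof.
move=> [mu' [M [M0 uM uM0]]]; split.
  by apply: cmeas_conj; apply: cmeas_comp => //; exact: mreflect.
exists M; split => //.
- by move=> x; rewrite cabs_conj.
- by move=> x xM; rewrite /crefl uM0 ?sub0r ?normrN// /cconj/= oppr0.
Qed.

Lemma FI_crefl u xi : CL1 u -> FI (crefl u) xi = cconj (FI u xi).
Proof.
move=> ui; rewrite /FI.
have i1 : CL1 (fun x => cmul (u x) (cexpi (- (xi * x)))) by apply: CL1_expi => //; mfun.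
rewrite -Cint_conj//.
rewrite -(@Cint_preserving R (fun y => 0 - y) (mreflect 0) (leb_reflect 0)); last first.
  apply: cmeas_mul; last by apply: cmeas_expi; mfun.
  by apply: cmeas_conj; apply: cmeas_comp; [case: ui|exact: mreflect].
apply: eq_Cint => x; rewrite /crefl cmul_conj; congr cmul.
  by rewrite !sub0r opprK.
by rewrite -cexpiN; congr cexpi; ring.
Qed.

Definition autoc u := cconv u (crefl u).

Lemma autoc_re u x : nice u ->
  (autoc u x).1 = Rintegral mu setT (fun y => cdot (u (y + x)) (u y)).
Proof.
move=> nu; rewrite /autoc /cconv /Cint /=.
have mu1 : cmeas u by case: nu.
rewrite -(@Rint_preserving R (fun y => 0 - y) (mreflect 0) (leb_reflect 0)
  (fun y => cdot (u (y + x)) (u y))).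
  by apply: eq_Rintegral => y _; rewrite /crefl /= /cdot sub0r (addrC (- y) x); ring.
by apply: measurable_cdot => //; apply: cmeas_comp => //; exact: mshift.
Qed.

Lemma autoc0 u : nice u -> (autoc u 0).1 = n2 u.
Proof.
move=> nu; rewrite autoc_re//; apply: eq_Rintegral => y _.
by rewrite addr0 cdotzz.
Qed.

(** The increment is the pairing of [u (y + x) - u y] with [u y]; as [|u| <= M], it is at most [M]
    times the translation errors of the two components, whence [eta / (2 * M)] for each. *)
Lemma autoc_continuous0 u eta : nice u -> 0 < eta ->
  exists2 d : R, 0 < d & forall x, `|x| < d -> `|(autoc u x).1 - n2 u| <= eta.
Proof.
move=> nu eta0; have [mu1 [M [M0 uM uM0]]] := nu.
have [m1 m2] := mu1.
have e2 : 0 < eta / (2 * M) by rewrite divr_gt0// mulr_gt0.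
have [d1 d10 h1] := L1_translation m1 M0 (fun x => le_trans (cabs_re _) (uM x))
  (fun x xM => f_equal fst (uM0 x xM)) e2.
have [d2 d20 h2] := L1_translation m2 M0 (fun x => le_trans (cabs_im _) (uM x))
  (fun x xM => f_equal snd (uM0 x xM)) e2.
exists (Num.min d1 d2); first by rewrite lt_min d10 d20.
move=> x; rewrite lt_min => /andP[x1 x2].
have ui := nice_CL1 nu.
have mux : cmeas (fun y : R => u (y + x)) by apply: cmeas_comp => //; exact: mshift.
have L1dot (w : R -> cplx R) : cmeas w -> (forall y, cabs (w y) <= M) -> L1 (fun y => cdot (w y) (u y)).
  move=> mw wM; apply: (@le_L1 _ _ (fun y => M * cabs (u y))).
  - exact: measurable_cdot.
  - by move=> y; rewrite (le_trans (cdot_abs _ _))// ler_wpM2r ?cabs_ge0.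
  - by apply: L1_scale; exact: CL1_cabs.
rewrite autoc_re// /n2.
under [X in _ - X]eq_Rintegral do rewrite -cdotzz.
rewrite -RintegralB//; [|exact: L1dot..].
have iD : L1 (fun y => cdot (u (y + x)) (u y) - cdot (u y) (u y)) by apply: L1_sub; exact: L1dot.
apply: le_trans (le_normr_Rintegral measurableT iD) _.
rewrite -lee_fin ge0_Rint_EFin; last exact: integrable_norm iD.
have mn1 : measurable_fun setT (fun y : R => (`|(u (y + x)).1 - (u y).1|)%:E).
  apply/measurable_EFinP; apply: measurableT_comp => //; apply: measurable_funB => //.
  by case: mux.
have mn2 : measurable_fun setT (fun y : R => (`|(u (y + x)).2 - (u y).2|)%:E).
  apply/measurable_EFinP; apply: measurableT_comp => //; apply: measurable_funB => //.
  by case: mux.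
apply: (@le_trans _ _ (\int[mu]_y (M%:E * ((`|(u (y + x)).1 - (u y).1|)%:E +
   (`|(u (y + x)).2 - (u y).2|)%:E)))%E).
  apply: ge0_le_integral => //.
  - apply/measurable_EFinP; apply: measurableT_comp => //; apply: L1_measurable.
    exact: iD.
  - by apply: emeasurable_funM => //; apply: emeasurable_funD.
  - move=> y _; rewrite -EFinD -EFinM lee_fin /=.
    have -> : cdot (u (y + x)) (u y) - cdot (u y) (u y) =
      ((u (y + x)).1 - (u y).1) * (u y).1 + ((u (y + x)).2 - (u y).2) * (u y).2.
      by rewrite /cdot; ring.
    rewrite (le_trans (ler_normD _ _))// !normrM mulrDr (mulrC M) (mulrC M).
    rewrite lerD// ler_wpM2l//.
      by rewrite (le_trans (cabs_re _)).
    by rewrite (le_trans (cabs_im _)).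
rewrite ge0_integralZl//; last 3 first.
- by apply: emeasurable_funD.
- by move=> y _; rewrite adde_ge0// lee_fin.
- by rewrite lee_fin ltW.
rewrite ge0_integralD//.
apply: (@le_trans _ _ (M%:E * ((eta / (2 * M))%:E + (eta / (2 * M))%:E))%E).
  apply: lee_wpmul2l; first by rewrite lee_fin ltW.
  by apply: leeD; [exact: h1|exact: h2].
rewrite -EFinD -EFinM lee_fin le_eqVlt; apply/orP; left; apply/eqP; field.
exact: lt0r_neq0.
Qed.

Lemma pkernel_CL1 (e : R) : 0 < e -> CL1 (fun x => (pkernel e x, 0)).
Proof.
move=> e0; apply: (@le_CL1 _ _ (pkernel e)).
- by apply: cmeas_pair; [exact: measurable_pkernel|mfun].
- by move=> x; rewrite cabs_real// ltW// pkernel_gt0.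
- exact: pkernel_L1.
Qed.

Lemma poisson_L1 (e : R) : 0 < e -> L1 (fun x => 2 * e / (e ^+ 2 + x ^+ 2)).
Proof.
move=> e0; apply: L1_of_lty.
  have : cmeas (FI (fun x => (pkernel e x, 0))) by apply: cmeas_FI; case: (pkernel_CL1 e0).
  by move=> [+ _]; apply: eq_measurable_fun => x _; rewrite FI_pkernel.
under eq_integral => x _.
  rewrite ger0_norm; last by rewrite divr_ge0 ?addr_ge0 ?sqr_ge0// mulr_ge0// ltW.
  over.
by rewrite /= int_poisson// ltry.
Qed.

Lemma Rint_poisson (e : R) : 0 < e -> Rintegral mu setT (fun x => 2 * e / (e ^+ 2 + x ^+ 2)) = 2 * pi.
Proof. by move=> e0; rewrite /Rintegral int_poisson. Qed.

(* [|FI u|^2] is the transform of the autocorrelation of [u]; the transform of the other factor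
   is the Poisson kernel, an approximate identity of mass [2 pi]. *)
Lemma FI_energy_poisson u (e : R) : nice u -> 0 < e ->
  Rintegral mu setT (fun x => cnorm2 (FI u x) * pkernel e x) =
  Rintegral mu setT (fun x => (autoc u x).1 * (2 * e / (e ^+ 2 + x ^+ 2))).
Proof.
move=> nu e0; have nA := nice_conv nu (nice_crefl nu).
have := ip_FI (nice_CL1 nA) (pkernel_CL1 e0).
rewrite /ip => H.
transitivity (Rintegral mu setT (fun x => cdot (FI (cconv u (crefl u)) x) (pkernel e x, 0))).
  apply: eq_Rintegral => x _.
  rewrite FI_conv; [|exact: nice_CL1|exact: nice_bdd|by apply: nice_CL1; exact: nice_crefl].
  rewrite FI_crefl; last exact: nice_CL1.
  by rewrite /cdot /cmul /cnorm2 /=; ring.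
rewrite H; apply: eq_Rintegral => x _.
by rewrite FI_pkernel// sqrrN /cdot /= mulr0 addr0.
Qed.

(* Near [0] the autocorrelation is within [eta] of its value [n2 u]; away from [0] the Poisson
   kernel is at most [e] times an integrable function. *)
Lemma energy_poisson_bound u (eta : R) : nice u -> 0 < eta ->
  exists2 K : R, 0 <= K & forall e : R, 0 < e ->
   `|Rintegral mu setT (fun x => cnorm2 (FI u x) * pkernel e x) - 2 * pi * n2 u| <= 2 * pi * (eta + K * e).
Proof.
move=> nu eta0.
have [d d0 hd] := autoc_continuous0 nu eta0.
have nA := nice_conv nu (nice_crefl nu).
have [C AC] := nice_bdd nA.
have C0 : 0 <= C by apply: le_trans (AC 0); exact: cabs_ge0.
(* The autocorrelation varies by at most [2 C]. For [|x| >= d], [1 / (e^2 + x^2)] is at most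
   [(1 + 1 / d^2) / (1 + x^2)], which compares the kernel with [e] times the one of parameter 1,
   also of mass [2 pi]. *)
pose K := 2 * C * (1 + (d ^+ 2)^-1).
have d2 : 0 < d ^+ 2 by rewrite exprn_gt0.
have K0 : 0 <= K by rewrite !mulr_ge0// addr_ge0// invr_ge0 ltW.
exists K => // e e0.
rewrite FI_energy_poisson//.
set P := fun x => 2 * e / (e ^+ 2 + x ^+ 2).
have P0 x : 0 <= P x by rewrite divr_ge0 ?addr_ge0 ?sqr_ge0// mulr_ge0// ltW.
have iP := poisson_L1 e0.
have mA : measurable_fun setT (fun x => (autoc u x).1) by case: nA => -[].
have A1 x : `|(autoc u x).1| <= C by rewrite (le_trans (cabs_re _))//; exact: AC.
have iAP : L1 (fun x => (autoc u x).1 * P x).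
  apply: (@le_L1 _ _ (fun x => C * P x)).
  - by apply: measurable_funM => //; exact: L1_measurable iP.
  - by move=> x; rewrite normrM (ger0_norm (P0 x)) ler_wpM2r.
  - exact: L1_scale.
have -> : 2 * pi * n2 u = Rintegral mu setT (fun x => n2 u * P x).
  by rewrite RintegralZl// Rint_poisson// mulrC.
have inP : L1 (fun x => n2 u * P x) by exact: L1_scale.
rewrite -RintegralB//.
have iD : L1 (fun x => (autoc u x).1 * P x - n2 u * P x) by exact: L1_sub.
apply: le_trans (le_normr_Rintegral measurableT iD) _.
have iB : L1 (fun x => eta * P x + K * e * (2 * 1 / (1 ^+ 2 + x ^+ 2))).
  by apply: L1_add; apply: L1_scale => //; exact: poisson_L1.
have -> : 2 * pi * (eta + K * e) = Rintegral mu setT (fun x => eta * P x + K * e * (2 * 1 / (1 ^+ 2 + x ^+ 2))).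
  rewrite RintegralD//; [|exact: L1_scale|apply: L1_scale; exact: poisson_L1].
  have iP1 := poisson_L1 (@ltr01 R).
  rewrite (RintegralZl eta measurableT iP) (RintegralZl (K * e) measurableT iP1).
  by rewrite !Rint_poisson//; ring.
apply: le_Rintegral => //; first exact: integrable_norm iD.
move=> x _; rewrite -mulrBl normrM (ger0_norm (P0 x)).
have P10 : 0 <= K * e * (2 * 1 / (1 ^+ 2 + x ^+ 2)).
  by rewrite mulr_ge0 ?divr_ge0 ?addr_ge0 ?sqr_ge0// mulr_ge0// ltW.
have [xd|xd] := ltP `|x| d.
  apply: (@le_trans _ _ (eta * P x)); first by rewrite ler_wpM2r// hd.
  by rewrite lerDl.
apply: (@le_trans _ _ (2 * C * P x)).
  apply: ler_wpM2r => //; apply: le_trans (ler_normB _ _) _.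
  have -> : 2 * C = C + C by ring.
  by rewrite lerD//; have := A1 0; rewrite autoc0.
apply: (@le_trans _ _ (K * e * (2 * 1 / (1 ^+ 2 + x ^+ 2)))); last by rewrite lerDr mulr_ge0// ltW.
rewrite /K /P !mulr1 expr1n.
have x2 : d ^+ 2 <= x ^+ 2 by rewrite -(real_normK (num_real x)) lerXn2r ?nnegrE// ltW.
have ee : 0 <= e ^+ 2 by exact: sqr_ge0.
have -> : 2 * C * (2 * e / (e ^+ 2 + x ^+ 2)) = (2 * C * 2 * e) * (e ^+ 2 + x ^+ 2)^-1 by ring.
have -> : 2 * C * (1 + (d ^+ 2)^-1) * e * (2 / (1 + x ^+ 2)) =
  (2 * C * 2 * e) * ((1 + (d ^+ 2)^-1) / (1 + x ^+ 2)) by ring.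
apply: ler_wpM2l; first by rewrite !mulr_ge0// ltW.
apply: (@le_trans _ _ (x ^+ 2)^-1).
  rewrite lef_pV2 ?posrE; first by rewrite lerDr.
    by rewrite ltr_wpDl// (lt_le_trans d2).
  exact: lt_le_trans d2 x2.
have x20 : 0 < x ^+ 2 by exact: lt_le_trans d2 x2.
rewrite ler_pdivlMr; last by rewrite addr_gt0.
rewrite mulrDr mulr1 mulVf ?lt0r_neq0// addrC lerD2l.
by rewrite lef_pV2 ?posrE.
Qed.

(** The energy damped by [pkernel (e n)] has two limits as [e n] decreases to 0: [2 pi n2 u] by
    [energy_poisson_bound], and the full energy by monotone convergence. *)
Lemma plancherel_FI_nice u : nice u -> (\int[mu]_x (cnorm2 (FI u x))%:E = (2 * pi * n2 u)%:E)%E.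
Proof.
move=> nu.
pose e n : R := n.+1%:R^-1.
have e0 n : 0 < e n by rewrite invr_gt0.
pose B n := Rintegral mu setT (fun x => cnorm2 (FI u x) * pkernel (e n) x).
have mF : cmeas (FI u) by apply: cmeas_FI; case: nu.
have iB n : L1 (fun x => cnorm2 (FI u x) * pkernel (e n) x).
  have ui := nice_CL1 nu.
  pose I := Rintegral mu setT (fun x => cabs (u x)).
  apply: (@le_L1 _ _ (fun x => I ^+ 2 * pkernel (e n) x)).
  - by apply: measurable_funM; [exact: measurable_cnorm2|exact: measurable_pkernel].
  - move=> x; rewrite normrM (ger0_norm (cnorm2_ge0 _)) (gtr0_norm (pkernel_gt0 _ _)).
    rewrite ler_wpM2r// ?(ltW (pkernel_gt0 _ _))// -cabs_sqr.
    rewrite lerXn2r ?nnegrE ?cabs_ge0//; first by apply: Rintegral_ge0 => y _; exact: cabs_ge0.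
    rewrite -lee_fin (ge0_Rint_EFin (CL1_cabs ui)).
    apply: le_trans (cabs_Cint _) _; first by apply: cmeas_mul; [case: ui|apply: cmeas_expi; mfun].
    by under eq_integral do rewrite cabsM cabs_expi mulr1.
  - by apply: L1_scale; exact: pkernel_L1.
have Bcv : B n @[n --> \oo] --> 2 * pi * n2 u.
  have p0 : 0 < 2 * pi :> R by rewrite mulr_gt0// pi_gt0.
  apply/cvgrPdist_le => r r0.
  have r1 : 0 < r / (4 * pi) by rewrite divr_gt0// mulr_gt0// pi_gt0.
  have [K K0 hK] := energy_poisson_bound nu r1.
  have : (fun n => K * e n) n @[n --> \oo] --> (0 : R).
    rewrite -[X in _ --> X](mulr0 K); apply: cvgM; first exact: cvg_cst.
    exact: cvg_harmonic.
  move/cvgrPdist_le => /(_ _ r1); apply: filterS => n.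
  rewrite sub0r normrN ger0_norm ?mulr_ge0 ?(ltW (e0 _))// => Kn.
  rewrite distrC (le_trans (hK _ (e0 n)))//.
  apply: (@le_trans _ _ (2 * pi * (r / (4 * pi) + r / (4 * pi)))).
    by rewrite ler_wpM2l ?(ltW p0)// lerD2l.
  rewrite le_eqVlt; apply/orP; left; apply/eqP.
  have rr : r / (4 * pi) * (4 * pi) = r by rewrite divfK// lt0r_neq0// mulr_gt0// pi_gt0.
  by rewrite -[RHS]rr; ring.
have := @cvg_monotone_convergence _ _ _ mu setT measurableT
  (fun n x => (cnorm2 (FI u x) * pkernel (e n) x)%:E).
move=> H.
have {}H := H (fun n => measurable_int mu (iB n)).
have {}H : (\int[mu]_x (cnorm2 (FI u x) * pkernel (e n) x)%:E)%E @[n --> \oo] -->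
   (\int[mu]_x (cnorm2 (FI u x))%:E)%E.
  have -> : (\int[mu]_x (cnorm2 (FI u x))%:E)%E =
    (\int[mu]_x limn (fun n => (cnorm2 (FI u x) * pkernel (e n) x)%:E))%E.
    apply: eq_integral => x _; apply/esym/cvg_lim => //.
    apply: cvg_EFin; first exact: nearW.
    rewrite /comp /= -[X in _ --> X]mulr1; apply: cvgM; first exact: cvg_cst.
    rewrite -expR0 /pkernel.
    have ex0 : - (e n * `|x|) @[n --> \oo] --> (0 : R).
      rewrite -[X in _ --> X]oppr0; apply: cvgN; rewrite -(mul0r `|x|).
      by apply: cvgM; [exact: cvg_harmonic|exact: cvg_cst].
    apply: (@cvg_comp _ _ _ (fun n => - (e n * `|x|)) expR _ (nbhs (0 : R))) => //.
    exact: continuous_expR.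
  apply: H.
  - by move=> n x _; rewrite lee_fin mulr_ge0 ?cnorm2_ge0 ?(ltW (pkernel_gt0 _ _)).
  - move=> x _ m n mn; rewrite lee_fin ler_wpM2l ?cnorm2_ge0//.
    rewrite /pkernel ler_expR lerN2 ler_wpM2r//.
    by rewrite /e lef_pV2 ?posrE// ler_nat.
have HB : (\int[mu]_x (cnorm2 (FI u x) * pkernel (e n) x)%:E)%E @[n --> \oo] --> (2 * pi * n2 u)%:E.
  rewrite (_ : (fun n => _) = (fun n => (B n)%:E)).
    by apply: cvg_EFin; [exact: nearW|exact: Bcv].
  by apply/funext => n; rewrite -(ge0_Rint_EFin (iB n)).
exact: (cvg_unique (@ereal_hausdorff R) H HB).
Qed.

End Plancherel.

Section AlmostEverywhere.
Variable R : realType.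
Local Notation mu := (@lebesgue_measure R).

Lemma ae_mono (P Q : R -> Prop) : {ae mu, forall x, P x} -> (forall x, P x -> Q x) -> {ae mu, forall x, Q x}.
Proof. by move=> [A [mA A0 PA]] PQ; exists A; split => // x nQ; apply: PA => /PQ. Qed.

Lemma ae_and (P Q : R -> Prop) : {ae mu, forall x, P x} -> {ae mu, forall x, Q x} ->
  {ae mu, forall x, P x /\ Q x}.
Proof.
move=> [A [mA A0 PA]] [B [mB B0 QB]]; exists (A `|` B); split.
- exact: measurableU.
- by apply/eqP; rewrite -measure_le0 (le_trans (measureU2 _ mA mB))// [X in (X + _)%E]A0 [X in (_ + X)%E]B0 adde0.
- by move=> x /= /not_andP[/PA|/QB]; [left|right].
Qed.

End AlmostEverywhere.

(** * Plancherel's theorem and inversion for square integrable functions *)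

Section PlancherelL2.
Variable R : realType.
Local Notation mu := (@lebesgue_measure R).
Local Notation L1 f := (integrable mu setT (EFin \o f)).
Implicit Types f g h u w : R -> cplx R.

Lemma Rint_dominated (h_ : nat -> R -> R) (h g : R -> R) :
  (forall n, measurable_fun setT (h_ n)) -> (forall x, h_ n x @[n --> \oo] --> h x) ->
  (forall n x, `|h_ n x| <= g x) -> L1 g ->
  Rintegral mu setT (h_ n) @[n --> \oo] --> Rintegral mu setT h.
Proof.
move=> mh hh hg ig.
have mh0 : measurable_fun setT h by apply: (measurable_fun_cvg mh) => x _; exact: hh.
have := @dominated_convergence _ _ R mu setT measurableT (fun n x => (h_ n x)%:E)
  (fun x => (h x)%:E) (fun x => (g x)%:E).
case.
- by move=> n; apply/measurable_EFinP; exact: mh.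
- exact/measurable_EFinP.
- by apply: aeW => x _; apply: cvg_EFin; [exact: nearW|exact: hh].
- exact: ig.
- by apply: aeW => x n _; rewrite lee_fin.
- move=> ih _ H.
  have L1h n : L1 (h_ n) by apply: (le_L1 (mh n) (hg n)).
  have H' : (Rintegral mu setT (h_ n))%:E @[n --> \oo] --> (Rintegral mu setT h)%:E.
    rewrite ge0_Rint_EFin// (_ : (fun n => _) = (fun n => \int[mu]_x (h_ n x)%:E)%E)//.
    by apply/funext => n; rewrite ge0_Rint_EFin.
  exact: (fine_cvg H').
Qed.

Section Cutting.
Variable D : nat -> set R.
Hypothesis mD : forall n, measurable (D n).
Hypothesis Dx : forall x, \forall n \near \oo, D n x.

Lemma cut_near f x : \forall n \near \oo, cutf (D n) f x = f x.
Proof. by apply: filterS (Dx x) => n Dnx; rewrite /cutf mem_set. Qed.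

Lemma n2_cut_cvg f : L2 f -> n2 (cutf (D n) f) @[n --> \oo] --> n2 f.
Proof.
move=> f2; apply: (@Rint_dominated _ _ (fun x => cnorm2 (f x))).
- by move=> n; apply: measurable_cnorm2; apply: cmeas_cut => //; exact: L2_cmeas.
- move=> x; apply: cvg_near_cst; apply: filterS (cut_near f x) => n -> //.
- by move=> n x; rewrite ger0_norm ?cnorm2_ge0// cnorm2_cut_le.
- exact: L2_n2.
Qed.

Lemma cabs_cut_le (E : set R) f x : cabs (cutf E f x) <= cabs (f x).
Proof. by rewrite cabs_cut indicE; case: (_ \in _); rewrite ?mul1r ?mul0r ?cabs_ge0. Qed.

Lemma CL1_cut_of (E : set R) f : measurable E -> CL1 f -> CL1 (cutf E f).
Proof.
move=> mE fi; apply: (le_CL1 _ (cabs_cut_le E f) (CL1_cabs fi)).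
by apply: cmeas_cut => //; case: fi.
Qed.

Lemma FI_cut_cvg f x : CL1 f ->
  cnorm2 (FI (cutf (D n) f) x) @[n --> \oo] --> cnorm2 (FI f x).
Proof.
move=> fi; have mf := proj1 fi.
have mk n : cmeas (fun y => cmul (cutf (D n) f y) (cexpi (- (x * y)))).
  by apply: cmeas_mul; [exact: cmeas_cut|apply: cmeas_expi; mfun].
have k n y : cabs (cmul (cutf (D n) f y) (cexpi (- (x * y)))) <= cabs (f y).
  by rewrite cabsM cabs_expi mulr1 cabs_cut_le.
have nr y : \forall n \near \oo, cmul (cutf (D n) f y) (cexpi (- (x * y))) = cmul (f y) (cexpi (- (x * y))).
  by apply: filterS (cut_near f y) => n ->.
rewrite /cnorm2; apply: cvgD.
- rewrite !expr2; under eq_fun do rewrite expr2.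
  suff H : (FI (cutf (D n) f) x).1 @[n --> \oo] --> (FI f x).1 by apply: cvgM.
  apply: (@Rint_dominated (fun n y => (cmul (cutf (D n) f y) (cexpi (- (x * y)))).1) _ (fun y => cabs (f y))).
  + by move=> n; case: (mk n).
  + by move=> y; apply: cvg_near_cst; apply: filterS (nr y) => n ->.
  + by move=> n y; rewrite (le_trans (cabs_re _)).
  + exact: CL1_cabs.
- rewrite !expr2; under eq_fun do rewrite expr2.
  suff H : (FI (cutf (D n) f) x).2 @[n --> \oo] --> (FI f x).2 by apply: cvgM.
  apply: (@Rint_dominated (fun n y => (cmul (cutf (D n) f y) (cexpi (- (x * y)))).2) _ (fun y => cabs (f y))).
  + by move=> n; case: (mk n).
  + by move=> y; apply: cvg_near_cst; apply: filterS (nr y) => n ->.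
  + by move=> n y; rewrite (le_trans (cabs_im _)).
  + exact: CL1_cabs.
Qed.

End Cutting.

(** With both argument and value bounded, truncations of any measurable function are [nice]; the
    sets increase with [n] and exhaust the line. *)
Definition truncD f (n : nat) : set R := [set x | (`|x| <= n%:R) && (cabs (f x) <= n%:R)].
Definition truncf f n := cutf (truncD f n) f.

Lemma measurable_truncD f n : cmeas f -> measurable (truncD f n).
Proof.
move=> mf; rewrite /truncD.
have m1 : measurable_fun setT (fun x : R => `|x|) by apply: measurableT_comp => //.
have m2 := measurable_cabs mf.
have -> : [set x | (`|x| <= n%:R) && (cabs (f x) <= n%:R)] =
   ((fun x : R => `|x|) @^-1` [set` `]-oo, n%:R]]) `&` ((fun x => cabs (f x)) @^-1` [set` `]-oo, n%:R]]).
  by apply/seteqP; split => x /=; rewrite !in_itv/= => /andP.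
apply: measurableI; rewrite -[X in measurable X]setTI.
- by apply: m1 => //; exact: measurable_itv.
- by apply: m2 => //; exact: measurable_itv.
Qed.

Lemma truncD_near f x : \forall n \near \oo, truncD f n x.
Proof.
near=> n; apply/andP; split; near: n; exact: nbhs_infty_ger.
Unshelve. all: by end_near. Qed.

Lemma nice_trunc f n : cmeas f -> nice (truncf f n).
Proof.
move=> mf; split; first by apply: cmeas_cut => //; exact: measurable_truncD.
exists n.+1%:R; split => //.
- move=> x; rewrite /truncf /cutf; case: ifPn => [|_]; last by rewrite cabs0.
  by rewrite inE => /andP[_ /le_trans]; apply; rewrite ler_nat.
- move=> x xn; rewrite /truncf /cutf; case: ifPn => // /set_mem /andP[].
  by rewrite leNgt (lt_trans _ xn)// ltr_nat.
Qed.

Lemma Cint_sub f g : CL1 f -> CL1 g ->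
  Cint (fun x => csub (f x) (g x)) = csub (Cint f) (Cint g).
Proof.
move=> fi gi; rewrite /Cint /csub /=; congr pair; rewrite RintegralB//.
all: first [exact: CL1_re|exact: CL1_im].
Qed.

Lemma FI_sub f g x : CL1 f -> CL1 g -> FI (fun y => csub (f y) (g y)) x = csub (FI f x) (FI g x).
Proof.
move=> fi gi; rewrite /FI -Cint_sub; [|by apply: CL1_expi => //; mfun..].
by apply: eq_Cint => y; rewrite /csub /cmul/=; congr pair; ring.
Qed.

Lemma FI_add f g x : CL1 f -> CL1 g -> FI (fun y => caddc (f y) (g y)) x = caddc (FI f x) (FI g x).
Proof.
move=> fi gi; rewrite /FI -Cint_add; [|by apply: CL1_expi => //; mfun..].
by apply: eq_Cint => y; rewrite /caddc /cmul/=; congr pair; ring.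
Qed.

Lemma CL1_sub f g : CL1 f -> CL1 g -> CL1 (fun x => csub (f x) (g x)).
Proof.
move=> fi gi; have := CL1_add fi (CL1_cmul (-1, 0) gi).
congr CL1; apply/funext => x; rewrite /csub /caddc /cmul/=; congr pair; ring.
Qed.

Lemma two_pi_gt0 : 0 < 2 * pi :> R. Proof. by rewrite mulr_gt0// pi_gt0. Qed.

(** Fatou along the truncations, which yields only this direction. *)
Lemma bessel_FI u : CL1 u -> L2 u -> (\int[mu]_x (cnorm2 (FI u x))%:E <= (2 * pi * n2 u)%:E)%E.
Proof.
move=> u1 u2; have mu1 := proj1 u1.
have mT n : measurable (truncD u n) by exact: measurable_truncD.
have mFT n : cmeas (FI (truncf u n)) by apply: cmeas_FI; apply: cmeas_cut.
have := @fatou _ _ R mu setT measurableT (fun n x => (cnorm2 (FI (truncf u n) x))%:E)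
  (fun n => emeasurable_cnorm2 (mFT n)) (fun n x _ => cnorm2_ge0 _ : (0 <= (cnorm2 _)%:E)%E).
have -> : (\int[mu]_x limn_einf (fun n => (cnorm2 (FI (truncf u n) x))%:E) =
   \int[mu]_x (cnorm2 (FI u x))%:E)%E.
  apply: eq_integral => x _.
  have H : (cnorm2 (FI (truncf u n) x))%:E @[n --> \oo] --> (cnorm2 (FI u x))%:E.
    by apply: cvg_EFin; [exact: nearW|apply: FI_cut_cvg => //; exact: truncD_near].
  by rewrite (cvg_limn_einf_sup H).1.
move=> h; apply: le_trans h _.
have -> : (fun n => \int[mu]_x (cnorm2 (FI (truncf u n) x))%:E)%E = (fun n => (2 * pi * n2 (truncf u n))%:E).
  by apply/funext => n; rewrite plancherel_FI_nice//; exact: nice_trunc.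
have H : (2 * pi * n2 (truncf u n))%:E @[n --> \oo] --> (2 * pi * n2 u)%:E.
  apply: cvg_EFin; first exact: nearW.
  by apply: cvgM; [exact: cvg_cst|apply: n2_cut_cvg => //; exact: truncD_near].
by rewrite (cvg_limn_einf_sup H).1.
Qed.

(** The lower bound comes from the parallelogram law. Split [u = a + r] with [a] the truncation and
    put [b = a - r]; the supports being disjoint, [b] has the norm of [u]. The transforms of [u] and
    [b] together have at least twice the energy of that of [a], the share of [b] is at most
    [2 pi n2 u] by [bessel_FI], and [a] tends to [u]. *)
Lemma plancherel_FI u : CL1 u -> L2 u -> (\int[mu]_x (cnorm2 (FI u x))%:E = (2 * pi * n2 u)%:E)%E.
Proof.
move=> u1 u2; have mu1 := proj1 u1.
apply/eqP; rewrite eq_le bessel_FI//=.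
have H : (2 * (2 * pi * n2 (truncf u n)) - 2 * pi * n2 u)%:E @[n --> \oo] --> (2 * (2 * pi * n2 u) - 2 * pi * n2 u)%:E.
  apply: cvg_EFin; first exact: nearW.
  apply: cvgB; last exact: cvg_cst.
  apply: cvgM; first exact: cvg_cst.
  apply: cvgM; first exact: cvg_cst.
  apply: n2_cut_cvg => //; [by move=> n; exact: measurable_truncD|exact: truncD_near].
have -> : 2 * pi * n2 u = 2 * (2 * pi * n2 u) - 2 * pi * n2 u by ring.
apply: (cvge_to_le H); apply: nearW => n.
pose D := truncD u n.
have mD : measurable D by exact: measurable_truncD.
have mDc : measurable (~` D) by exact: measurableC.
pose r := cutf (~` D) u; pose a := truncf u n; pose b x := csub (a x) (r x).
have a1 : CL1 a by exact: CL1_cut_of.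
have r1 : CL1 r by exact: CL1_cut_of.
have a2 : L2 a by exact: L2_cut.
have r2 : L2 r by exact: L2_cut.
have b1 : CL1 b by exact: CL1_sub.
have b2 : L2 b by exact: L2_sub.
have ua : u = (fun x => caddc (a x) (r x)).
  apply/funext => x; rewrite /a /r /truncf /cutf -/D in_setC; case: (x \in D) => /=; case: (u x) => p q; rewrite /caddc /= ?addr0 ?add0r//.
have bu : n2 b = n2 u.
  apply: eq_Rintegral => x _; rewrite /b /a /r /truncf /cutf -/D in_setC; case: (x \in D) => /=; rewrite /cnorm2 /csub /= ?subr0// !sub0r !sqrrN//.
have par x : cnorm2 (FI u x) + cnorm2 (FI b x) = 2 * cnorm2 (FI a x) + 2 * cnorm2 (FI r x).
  rewrite {1}ua FI_add// FI_sub// /cnorm2 /caddc /csub /=; ring.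
have e1 : (\int[mu]_x (cnorm2 (FI u x))%:E + \int[mu]_x (cnorm2 (FI b x))%:E >=
  (2 * (2 * pi * n2 a))%:E)%E.
  rewrite -ge0_integralD//; last 4 first.
  - by move=> x _; rewrite lee_fin cnorm2_ge0.
  - by apply: emeasurable_cnorm2; apply: cmeas_FI.
  - by move=> x _; rewrite lee_fin cnorm2_ge0.
  - by apply: emeasurable_cnorm2; apply: cmeas_FI; case: b1.
  rewrite EFinM -plancherel_FI_nice; last exact: nice_trunc.
  have ma : measurable_fun setT (fun x => (cnorm2 (FI a x))%:E).
    by apply: emeasurable_cnorm2; apply: cmeas_FI; case: a1.
  have a0 x : setT x -> (0 <= (cnorm2 (FI a x))%:E)%E by rewrite lee_fin cnorm2_ge0.
  rewrite -(ge0_integralZl mu measurableT ma a0); last by rewrite lee_fin.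
  apply: ge0_le_integral => //.
  - by move=> x _; rewrite -EFinM lee_fin mulr_ge0// cnorm2_ge0.
  - by apply: emeasurable_funM => //; apply: emeasurable_cnorm2; apply: cmeas_FI; case: a1.
  - by apply: emeasurable_funD; apply: emeasurable_cnorm2; apply: cmeas_FI => //; case: b1.
  - by move=> x _; rewrite -EFinD -EFinM lee_fin par lerDl mulr_ge0// cnorm2_ge0.
have e2 := bessel_FI b1 b2.
rewrite bu in e2.
rewrite EFinB leeBlDr//.
by apply: le_trans e1 _; rewrite leeD2l.
Qed.

Lemma L2_FT u : CL1 u -> L2 u -> L2 (FT u).
Proof.
move=> u1 u2; apply: L2_scale; apply/L2P; split; first by apply: cmeas_FI; case: u1.
by rewrite plancherel_FI// ltry.
Qed.

Lemma n2_FT u : CL1 u -> L2 u -> n2 (FT u) = n2 u.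
Proof.
move=> u1 u2; rewrite n2_scale; last first.
  apply/L2P; split; first by apply: cmeas_FI; case: u1.
  by rewrite plancherel_FI// ltry.
rewrite /n2 /Rintegral plancherel_FI// k0_sqr /= -/(n2 u) mulrA mulVf ?mul1r//.
exact: lt0r_neq0 two_pi_gt0.
Qed.

(** The inverse transform on integrable functions. *)
Definition FTi g (x : R) := FT g (- x).

Lemma L2_refl f : L2 f -> L2 (fun x => f (- x)).
Proof.
have -> : (fun x => f (- x)) = (fun x => f (0 - x)) by apply/funext => x; rewrite sub0r.
move=> /L2P[mf fi]; apply/L2P; split; first by apply: cmeas_comp => //; exact: mreflect.
rewrite (@ge0_int_preserving R (fun x => 0 - x) (mreflect 0) (leb_reflect 0) (fun x => (cnorm2 (f x))%:E))//.
  exact: emeasurable_cnorm2.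
by move=> x; rewrite lee_fin cnorm2_ge0.
Qed.

Lemma n2_refl f : L2 f -> n2 (fun x => f (- x)) = n2 f.
Proof.
move=> f2; rewrite /n2.
rewrite -[RHS](@Rint_preserving R (fun x => 0 - x) (mreflect 0) (leb_reflect 0)).
  by apply: eq_Rintegral => x _; rewrite sub0r.
by apply: measurable_cnorm2; exact: L2_cmeas.
Qed.

Lemma L2_FTi g : CL1 g -> L2 g -> L2 (FTi g).
Proof. by move=> g1 g2; apply: (@L2_refl (FT g)); exact: L2_FT. Qed.

Lemma n2_FTi g : CL1 g -> L2 g -> n2 (FTi g) = n2 g.
Proof. by move=> g1 g2; rewrite (@n2_refl (FT g)) ?n2_FT//; exact: L2_FT. Qed.

Lemma ip_scalel (a : R) f g : L2 f -> L2 g -> ip (fun x => cscalec a (f x)) g = a * ip f g.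
Proof. by move=> f2 g2; rewrite ipC ip_scale// ipC. Qed.

Lemma L2_FI u : CL1 u -> L2 u -> L2 (FI u).
Proof.
move=> u1 u2; apply/L2P; split; first by apply: cmeas_FI; case: u1.
by rewrite plancherel_FI// ltry.
Qed.

Lemma ip_FT f g : CL1 f -> L2 f -> CL1 g -> L2 g -> ip (FT f) g = ip f (FTi g).
Proof.
move=> f1 f2 g1 g2; rewrite ip_scalel//; last exact: L2_FI.
rewrite ip_FI// -ip_scale//.
by apply: (@L2_refl (FI g)); exact: L2_FI.
Qed.

Lemma FT_sub f g x : CL1 f -> CL1 g -> FT (fun y => csub (f y) (g y)) x = csub (FT f x) (FT g x).
Proof. by move=> f1 g1; rewrite /FT FI_sub// /cscalec /csub/=; congr pair; ring. Qed.

Lemma ip_cut (D : set R) f : ip (cutf D f) f = n2 (cutf D f).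
Proof.
apply: eq_Rintegral => x _; rewrite /cutf; case: ifP => _; first by rewrite cdotzz.
by rewrite /cdot /cnorm2 /= !mul0r expr0n.
Qed.

Lemma n2_sub_cut (D : set R) f : measurable D -> L2 f ->
  n2 (fun x => csub (f x) (cutf D f x)) = n2 f - n2 (cutf D f).
Proof.
move=> mD f2; rewrite n2_sub//; last exact: L2_cut.
by rewrite ipC ip_cut; ring.
Qed.

Lemma ip_cvg h (a_ : nat -> R -> cplx R) a : L2 h -> (forall n, L2 (a_ n)) -> L2 a ->
  n2 (fun x => csub (a x) (a_ n x)) @[n --> \oo] --> 0 ->
  ip h (a_ n) @[n --> \oo] --> ip h a.
Proof.
move=> h2 an2 a2 H.
apply/cvgrPdist_le => e e0.
have K0 : 0 < e ^+ 2 / (n2 h + 1) by rewrite divr_gt0 ?exprn_gt0// ltr_wpDl ?n2_ge0.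
move/cvgrPdist_le : H => /(_ _ K0); apply: filterS => n.
rewrite sub0r normrN ger0_norm ?n2_ge0// => Hn.
rewrite -ip_sub// -ler_sqr ?nnegrE ?(ltW e0)// real_normK ?num_real//.
apply: le_trans (ip_CS h2 (L2_sub a2 (an2 n))) _.
apply: (@le_trans _ _ (n2 h * (e ^+ 2 / (n2 h + 1)))); first by rewrite ler_wpM2l// n2_ge0.
have h0 := n2_ge0 h.
rewrite mulrCA ler_piMr ?sqr_ge0// ler_pdivrMr; last by rewrite ltr_wpDl.
by rewrite mul1r lerDl.
Qed.

Definition box (N : nat) : set R := `[- N%:R, N%:R]%classic.

Lemma box_near x : \forall N \near \oo, box N x.
Proof.
near=> n; rewrite /box /= in_itv/= -ler_norml; near: n; exact: nbhs_infty_ger.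
Unshelve. all: by end_near. Qed.

Lemma measurable_box N : measurable (box N).
Proof. exact: measurable_itv. Qed.

Section IsFT.
Variables u w : R -> cplx R.
Hypothesis uw : is_FT u w.
Let u2 : L2 u. Proof. by case: uw. Qed.
Let w2 : L2 w. Proof. by case: uw => _ []. Qed.
Let c1 N : CL1 (cutf (box N) u). Proof. exact: CL1_cut_itv. Qed.
Let c2 N : L2 (cutf (box N) u). Proof. by apply: L2_cut => //; exact: measurable_box. Qed.
Let F2 N : L2 (FT (cutf (box N) u)). Proof. exact: (L2_FT (c1 N) (c2 N)). Qed.

Lemma is_FT_n2_cvg : n2 (fun x => csub (w x) (FT (cutf (box N) u) x)) @[N --> \oo] --> 0.
Proof.
case: uw => _ [_ H].
have H' : (n2 (fun x => csub (w x) (FT (cutf (box N) u) x)))%:E @[N --> \oo] --> 0%:E.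
  rewrite (_ : (fun n => _) = (fun N : nat => (\int[@leb R]_xi (cnorm2 (csub (w xi) (FT_trunc u N xi)))%:E)%E))//.
  apply/funext => N; rewrite n2_EFin; last exact: (L2_sub w2 (F2 N)).
  by apply: eq_integral => x _; rewrite FT_truncE.
exact: (fine_cvg H').
Qed.

Lemma is_FT_ip_cvg h : L2 h -> ip h (FT (cutf (box N) u)) @[N --> \oo] --> ip h w.
Proof.
move=> h2; apply: ip_cvg => //; exact: is_FT_n2_cvg.
Qed.

(** Expand the squared norm of [w - FT (cutf (box N) u)], which tends to 0: in the limit
    [0 = n2 w - 2 n2 w + n2 u]. *)
Lemma is_FT_n2 : n2 u = n2 w.
Proof.
have H1 := is_FT_n2_cvg.
have H2 : n2 w - 2 * ip w (FT (cutf (box N) u)) + n2 (cutf (box N) u) @[N --> \oo] --> n2 w - 2 * ip w w + n2 u.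
  apply: cvgD; last by apply: n2_cut_cvg => //; [exact: measurable_box|exact: box_near].
  apply: cvgB; first exact: cvg_cst.
  by apply: cvgM; [exact: cvg_cst|exact: is_FT_ip_cvg].
have E : (fun N => n2 (fun x => csub (w x) (FT (cutf (box N) u) x))) =
  (fun N => n2 w - 2 * ip w (FT (cutf (box N) u)) + n2 (cutf (box N) u)).
  by apply/funext => N; rewrite (n2_sub w2 (F2 N)) (n2_FT (c1 N) (c2 N)).
rewrite E in H1.
have HH : 0 = n2 w - 2 * ip w w + n2 u by exact: (cvg_unique (@Rhausdorff R) H1 H2).
rewrite ip_ff in HH; have lin (a b : R) : 0 = a - 2 * a + b -> b = a by lra.
exact: lin.
Qed.

Lemma is_FT_parseval g : CL1 g -> L2 g -> ip (FTi g) u = ip g w.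
Proof.
move=> g1 g2.
have H1 : ip (FTi g) (cutf (box N) u) @[N --> \oo] --> ip (FTi g) u.
  apply: ip_cvg => //; first exact: L2_FTi.
  have -> : (fun N => n2 (fun x => csub (u x) (cutf (box N) u x))) = (fun N => n2 u - n2 (cutf (box N) u)).
    by apply/funext => N; rewrite n2_sub_cut//; exact: measurable_box.
  rewrite -(subrr (n2 u)); apply: cvgB; first exact: cvg_cst.
  by apply: n2_cut_cvg => //; [exact: measurable_box|exact: box_near].
have H2 := is_FT_ip_cvg g2.
have E : (fun N => ip (FTi g) (cutf (box N) u)) = (fun N => ip g (FT (cutf (box N) u))).
  by apply/funext => N; rewrite (ipC g) (ip_FT (c1 N) (c2 N) g1 g2) ipC.
rewrite E in H1.
exact: (cvg_unique (@Rhausdorff R) H1 H2).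
Qed.

(** Inversion in [L^2]. By Parseval the cross term of the expanded square is [n2 (truncf w n)], so
    the squared distance is exactly [n2 w - n2 (truncf w n)]. *)
Lemma FTi_trunc_cvg : n2 (fun x => csub (FTi (truncf w n) x) (u x)) @[n --> \oo] --> 0.
Proof.
have nt n : nice (truncf w n) by apply: nice_trunc; exact: L2_cmeas.
have -> : (fun n => n2 (fun x => csub (FTi (truncf w n) x) (u x))) = (fun n => n2 w - n2 (truncf w n)).
  apply/funext => n; have n1 := nice_CL1 (nt n); have n2' := nice_L2 (nt n).
  rewrite n2_sub//; last exact: L2_FTi.
  by rewrite n2_FTi// is_FT_parseval// ip_cut -/(truncf w n) is_FT_n2; ring.
rewrite -(subrr (n2 w)); apply: cvgB; first exact: cvg_cst.
apply: n2_cut_cvg => //; last exact: truncD_near.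
by move=> n; apply: measurable_truncD; exact: L2_cmeas.
Qed.

End IsFT.

Lemma is_FTI u w : L2 u -> L2 w ->
  n2 (fun x => csub (w x) (FT (cutf (box N) u) x)) @[N --> \oo] --> 0 -> is_FT u w.
Proof.
move=> u2 w2 H; split => //; split => //.
rewrite (_ : (fun N : nat => (\int[@leb R]_xi (cnorm2 (csub (w xi) (FT_trunc u N xi)))%:E)%E) =
  fun N => (n2 (fun x => csub (w x) (FT (cutf (box N) u) x)))%:E).
  by apply: cvg_EFin; [exact: nearW|exact: H].
apply/funext => N; rewrite n2_EFin; first by apply: eq_integral => x _; rewrite FT_truncE.
apply: L2_sub => //; apply: L2_FT; first exact: CL1_cut_itv.
by apply: L2_cut => //; exact: measurable_box.
Qed.

(** Supplies the competitors in the minimisation. Again the squared distance collapses, here to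
    [n2 (FTi g) - n2 (cutf (box N) (FTi g))]. *)
Lemma is_FT_FTi g : nice g -> is_FT (FTi g) g.
Proof.
move=> ng; have g1 := nice_CL1 ng; have g2 := nice_L2 ng.
have u2 := L2_FTi g1 g2.
apply: is_FTI => //.
have c1 N : CL1 (cutf (box N) (FTi g)) by exact: CL1_cut_itv.
have c2 N : L2 (cutf (box N) (FTi g)) by apply: L2_cut => //; exact: measurable_box.
have -> : (fun N => n2 (fun x => csub (g x) (FT (cutf (box N) (FTi g)) x))) = (fun N => n2 (FTi g) - n2 (cutf (box N) (FTi g))).
  apply/funext => N; rewrite (n2_sub g2 (L2_FT (c1 N) (c2 N))).
  rewrite (n2_FT (c1 N) (c2 N)) ipC (ip_FT (c1 N) (c2 N) g1 g2).
  by rewrite ip_cut (n2_FTi g1 g2); ring.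
rewrite -(subrr (n2 (FTi g))); apply: cvgB; first exact: cvg_cst.
by apply: n2_cut_cvg => //; [exact: measurable_box|exact: box_near].
Qed.

Lemma is_FT_unique u w w' : is_FT u w -> is_FT u w' -> {ae mu, forall x, w x = w' x}.
Proof.
move=> h h'; have w2 : L2 w by case: h => _ []. have w2' : L2 w' by case: h' => _ [].
have d2 := L2_sub w2 w2'.
have e : ip (fun x => csub (w x) (w' x)) w = ip (fun x => csub (w x) (w' x)) w'.
  exact: (cvg_unique (@Rhausdorff R) (is_FT_ip_cvg h d2) (is_FT_ip_cvg h' d2)).
have : n2 (fun x => csub (w x) (w' x)) = 0 by rewrite -ip_ff ip_sub// e subrr.
move/(n2_eq0 d2) => H; apply: (ae_mono H) => x.
rewrite /csub => -[/eqP + /eqP]; rewrite !subr_eq0 => /eqP + /eqP.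
by case: (w x) => ? ?; case: (w' x) => ? ? /= -> ->.
Qed.

Lemma n2_sub_le f g : L2 f -> L2 g -> n2 (fun x => csub (f x) (g x)) <= 2 * n2 f + 2 * n2 g.
Proof.
move=> f2 g2; have f1 := L2_n2 f2; have g1 := L2_n2 g2.
rewrite -!RintegralZl// -RintegralD//; [|exact: L1_scale..].
apply: le_Rintegral => //; first by apply: L2_n2; exact: L2_sub.
  by apply: L1_add; exact: L1_scale.
move=> x _; rewrite /cnorm2 /csub /=; set a := (f x).1; set b := (f x).2.
set c := (g x).1; set d := (g x).2.
suff : 0 <= (a + c) ^+ 2 + (b + d)^+2 by lra.
by rewrite addr_ge0 ?sqr_ge0.
Qed.

(** On a box the norm of [u - u'] is that of the difference of the truncated transforms, both of
    which approach [w]. *)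
Lemma is_FT_inj u u' w : is_FT u w -> is_FT u' w -> {ae mu, forall x, u x = u' x}.
Proof.
move=> h h'; have w2 : L2 w by case: h => _ [].
have u2 : L2 u by case: h. have u2' : L2 u' by case: h'.
have c1 v N : L2 v -> CL1 (cutf (box N) v) by move=> v2; exact: CL1_cut_itv.
have c2 v N : L2 v -> L2 (cutf (box N) v) by move=> v2; apply: L2_cut => //; exact: measurable_box.
have d2 := L2_sub u2 u2'.
have H1 : n2 (cutf (box N) (fun x => csub (u x) (u' x))) @[N --> \oo] --> n2 (fun x => csub (u x) (u' x)).
  by apply: n2_cut_cvg => //; [exact: measurable_box|exact: box_near].
have H2 : 2 * n2 (fun x => csub (w x) (FT (cutf (box N) u') x)) + 2 * n2 (fun x => csub (w x) (FT (cutf (box N) u) x)) @[N --> \oo] --> (0 : R).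
  rewrite -(addr0 0); apply: cvgD; rewrite -(mulr0 2); (apply: cvgM; first exact: cvg_cst).
    exact: (is_FT_n2_cvg h').
  exact: (is_FT_n2_cvg h).
have : n2 (fun x => csub (u x) (u' x)) <= 0.
  apply: (@ler_cvg_to _ _ _ _ _ _ _ _ H1 H2); apply: nearW => N.
  rewrite -n2_FT; [|exact: c1|exact: c2].
  apply: le_trans (n2_sub_le _ _); last 2 first.
  - by apply: L2_sub => //; apply: L2_FT; [exact: c1|exact: c2].
  - by apply: L2_sub => //; apply: L2_FT; [exact: c1|exact: c2].
  rewrite le_eqVlt; apply/orP; left; apply/eqP; apply: eq_Rintegral => x _.
  have -> : cutf (box N) (fun y => csub (u y) (u' y)) = (fun y => csub (cutf (box N) u y) (cutf (box N) u' y)).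
    apply/funext => y; rewrite /cutf; case: ifP => // _; by rewrite /csub /= subrr.
  rewrite FT_sub; [|exact: c1..].
  by rewrite /cnorm2 /csub /=; ring.
move=> d0; have : n2 (fun x => csub (u x) (u' x)) = 0 by apply/eqP; rewrite eq_le d0 n2_ge0.
move/(n2_eq0 d2) => H; apply: (ae_mono H) => x.
rewrite /csub => -[/eqP + /eqP]; rewrite !subr_eq0 => /eqP + /eqP.
by case: (u x) => ? ?; case: (u' x) => ? ? /= -> ->.
Qed.

End PlancherelL2.

(** * Convolution powers *)

Section ConvolutionPowers.
Variable R : realType.
Local Notation mu := (@lebesgue_measure R).
Local Notation L1 f := (integrable mu setT (EFin \o f)).
Implicit Types f g h u w : R -> cplx R.

(* [cpw f j] and [epw G j] have [j+1] factors. *)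
Definition cpw f (j : nat) : R -> cplx R := iter j (cconv f) f.
Definition epw (G : R -> \bar R) (j : nat) : R -> \bar R := iter j (econv G) G.
Definition eabs f (x : R) : \bar R := (cabs (f x))%:E.

Lemma eabs_ge0 f x : (0 <= eabs f x)%E.
Proof. by rewrite lee_fin cabs_ge0. Qed.

Lemma nice_cpw f j : nice f -> nice (cpw f j).
Proof. by move=> nf; elim: j => //= j IH; exact: nice_conv. Qed.

Lemma cnorm2_FT_cpw f j x : nice f ->
  cnorm2 (FT (cpw f j) x) = (2 * pi) ^+ j * cnorm2 (FT f x) ^+ j.+1.
Proof.
move=> nf; elim: j => [|j IH]; first by rewrite /= expr0 mul1r expr1.
rewrite /= FT_conv; [|exact: nice_CL1|exact: nice_bdd|by apply: nice_CL1; exact: (nice_cpw j)].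
rewrite cnorm2_scale cnorm2M -/(cpw f j) IH exprVn k0_sqr invrK (exprS (2 * pi)) (exprS _ j.+1).
by ring.
Qed.

(** Here the exponent has to be an integer: up to [(2 pi)^j] the power of [|FTi f|^2] is the squared
    modulus of the inverse transform of a convolution power, and Plancherel applies. Each
    convolution contributes a factor [k0^-1], whose square is [2 pi]. *)
Lemma power_FTi f j : nice f ->
  (\int[mu]_x (cnorm2 (FTi f x) ^+ j.+1)%:E = ((2 * pi) ^- j * n2 (cpw f j))%:E)%E.
Proof.
move=> nf; have nc := nice_cpw j nf.
have c1 := nice_CL1 nc; have c2 := nice_L2 nc.
have p0 : 0 < (2 * pi : R) ^+ j by rewrite exprn_gt0// two_pi_gt0.
rewrite -(n2_FTi c1 c2) EFinM n2_EFin; last exact: L2_FTi.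
rewrite -ge0_integralZl//; last 3 first.
- by apply: emeasurable_cnorm2; exact: L2_cmeas (L2_FTi c1 c2).
- by move=> x _; rewrite lee_fin cnorm2_ge0.
- by rewrite lee_fin invr_ge0 ltW.
apply: eq_integral => x _; rewrite -EFinM; congr EFin.
by rewrite /FTi cnorm2_FT_cpw// mulrA mulVf ?mul1r// lt0r_neq0.
Qed.

Section Iter.
Variable G : R -> \bar R.
Hypothesis mG : measurable_fun setT G.
Hypothesis G0 : forall x, (0 <= G x)%E.

Lemma iter_econv_ge0 j H : (forall x, (0 <= H x)%E) -> forall x, (0 <= iter j (econv G) H x)%E.
Proof. by move=> H0; elim: j => //= j IH x; exact: econv_ge0. Qed.

Lemma measurable_iter_econv j H : measurable_fun setT H -> (forall x, (0 <= H x)%E) ->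
  measurable_fun setT (iter j (econv G) H).
Proof.
move=> mH H0; elim: j => //= j IH; apply: measurable_econv => //.
exact: iter_econv_ge0.
Qed.

Lemma le_iter_econv j G' H H' : measurable_fun setT G' ->
  measurable_fun setT H -> measurable_fun setT H' ->
  (forall x, (0 <= H x)%E) -> (forall x, (G x <= G' x)%E) -> (forall x, (H x <= H' x)%E) ->
  forall x, (iter j (econv G) H x <= iter j (econv G') H' x)%E.
Proof.
move=> mG' mH mH' H0 GG HH.
have G0' x : (0 <= G' x)%E by exact: le_trans (G0 x) (GG x).
have H0' x : (0 <= H' x)%E by exact: le_trans (H0 x) (HH x).
have mj j' : measurable_fun setT (iter j' (econv G') H').
  elim: j' => //= j' IH; apply: measurable_econv => //.
  by elim: j' {IH} => //= j' IH x; exact: econv_ge0.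
elim: j => //= j IH x; apply: le_econv => //.
- exact: measurable_iter_econv.
- exact: iter_econv_ge0.
Qed.

Lemma econvDr H H' x : measurable_fun setT H -> measurable_fun setT H' ->
  (forall x, (0 <= H x)%E) -> (forall x, (0 <= H' x)%E) ->
  econv G (fun x => (H x + H' x)%E) x = (econv G H x + econv G H' x)%E.
Proof.
move=> mH mH' H0 H0'; rewrite /econv -ge0_integralD//.
- by apply: eq_integral => y _; rewrite ge0_muleDr.
- by move=> y _; rewrite mule_ge0.
- by apply: emeasurable_funM => //; apply: (measurableT_comp mG); exact: mreflect.
- by move=> y _; rewrite mule_ge0.
- by apply: emeasurable_funM => //; apply: (measurableT_comp mG); exact: mreflect.
Qed.

Lemma econvZr (c : R) H x : measurable_fun setT H -> (forall x, (0 <= H x)%E) -> 0 <= c ->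
  econv G (fun x => (c%:E * H x)%E) x = (c%:E * econv G H x)%E.
Proof.
move=> mH H0 c0; rewrite /econv -ge0_integralZl//.
- by apply: eq_integral => y _; rewrite muleCA.
- by apply: emeasurable_funM => //; apply: (measurableT_comp mG); exact: mreflect.
- by move=> y _; rewrite mule_ge0.
Qed.

Lemma iter_econvD j H H' x : measurable_fun setT H -> measurable_fun setT H' ->
  (forall x, (0 <= H x)%E) -> (forall x, (0 <= H' x)%E) ->
  iter j (econv G) (fun x => (H x + H' x)%E) x = (iter j (econv G) H x + iter j (econv G) H' x)%E.
Proof.
move=> mH mH' H0 H0'; elim: j x => //= j IH x.
rewrite -econvDr; [|exact: measurable_iter_econv|exact: measurable_iter_econv|exact: iter_econv_ge0|exact: iter_econv_ge0].
by congr econv; apply/funext.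
Qed.

Lemma iter_econvZ j (c : R) H x : measurable_fun setT H -> (forall x, (0 <= H x)%E) -> 0 <= c ->
  iter j (econv G) (fun x => (c%:E * H x)%E) x = (c%:E * iter j (econv G) H x)%E.
Proof.
move=> mH H0 c0; elim: j x => //= j IH x.
rewrite -econvZr//; [|exact: measurable_iter_econv|exact: iter_econv_ge0].
by congr econv; apply/funext.
Qed.

End Iter.

Lemma epwSr G j : epw G j.+1 = iter j (econv G) (econv G G).
Proof. by rewrite /epw iterSr. Qed.

Lemma measurable_eabs f : cmeas f -> measurable_fun setT (eabs f).
Proof. exact: emeasurable_cabs. Qed.

Lemma iter_cconv_abs f h j : nice f -> nice h ->
  forall x, (eabs (iter j (cconv f) h) x <= iter j (econv (eabs f)) (eabs h) x)%E.
Proof.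
move=> nf nh; elim: j => //= j IH x.
have nj : nice (iter j (cconv f) h) by elim: j {IH} => //= j IH; exact: nice_conv.
apply: le_trans (cconv_abs _ _ _) _; [by case: nf|by case: nj|].
have mf : measurable_fun setT (eabs f) by apply: measurable_eabs; case: nf.
apply: le_econv => //.
- by apply: measurable_eabs; case: nj.
- apply: (measurable_iter_econv mf (@eabs_ge0 f) j _ (@eabs_ge0 h)).
  by apply: measurable_eabs; case: nh.
- exact: eabs_ge0.
- exact: eabs_ge0.
Qed.

(** Bridge between the two notions of convolution power: competitors are tested through [cpw], while
    limits are taken with [epw]. *)
Lemma cpw_real f j : nice f -> (forall x, (f x).2 = 0 /\ 0 <= (f x).1) ->
  forall x, [/\ (cpw f j x).2 = 0, 0 <= (cpw f j x).1 & ((cpw f j x).1)%:E = epw (eabs f) j x].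
Proof.
move=> nf fr; have eabsE x : eabs f x = ((f x).1)%:E.
  have [f2 f1] := fr x; rewrite /eabs; congr EFin.
  by rewrite -[RHS]cabs_real//; case: (f x) f2 => a b /= ->.
elim: j => [|j IH] x /=; first by have [-> ->] := fr x; split => //; rewrite eabsE.
have nj := nice_cpw j nf.
have k y : cmul (f (x - y)) (cpw f j y) = ((f (x - y)).1 * (cpw f j y).1, 0).
  have [f2 _] := fr (x - y); have [c2 _ _] := IH y.
  by rewrite /cmul f2 c2 !mul0r mulr0 subr0 addr0.
have fi : CL1 (fun y => cmul (f (x - y)) (cpw f j y)).
  by apply: CL1_convk; [case: nf|exact: nice_bdd|exact: nice_CL1].
have k0' y : 0 <= (f (x - y)).1 * (cpw f j y).1.
  by rewrite mulr_ge0//; [case: (fr (x - y))|case: (IH y)].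
split.
- rewrite /cconv /Cint /= -/(cpw f j); under eq_Rintegral do rewrite -/(cmul _ _).2.
  rewrite (@eq_Rintegral _ _ _ mu setT (fun=> 0)); first by rewrite Rintegral_cst// mul0r.
  move=> y _; have := f_equal snd (k y); rewrite /cmul /= => //.
- rewrite /cconv /Cint /= -/(cpw f j); apply: Rintegral_ge0 => y _.
  by have := f_equal fst (k y); rewrite /cmul /= => ->.
- rewrite /cconv /Cint [X in X%:E]/= -/(cpw f j) ge0_Rint_EFin; last exact: (CL1_re fi).
  apply: eq_integral => y _.
  have := f_equal fst (k y); rewrite /cmul /= => ->.
  by rewrite EFinM eabsE; have [_ _ ->] := IH y.
Qed.

Definition esq (x : \bar R) : \bar R := (x * x)%E.

Lemma n2_cpw_real f j : nice f -> (forall x, (f x).2 = 0 /\ 0 <= (f x).1) ->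
  ((n2 (cpw f j))%:E = \int[mu]_x esq (epw (eabs f) j x))%E.
Proof.
move=> nf fr; rewrite n2_EFin; last by apply: nice_L2; exact: nice_cpw.
apply: eq_integral => x _; have [c2 c1 <-] := cpw_real j nf fr x.
by rewrite /esq -EFinM /cnorm2 c2 expr0n addr0 expr2.
Qed.

End ConvolutionPowers.

(** * A Sobolev embedding on the Fourier side *)

Section Sobolev.
Variable R : realType.
Local Notation mu := (@lebesgue_measure R).

Lemma mpowR (B : R -> R) (a : R) : measurable_fun setT B -> measurable_fun setT (fun y => B y `^ a).
Proof.
by move=> mB; apply: (@measurableT_comp _ _ _ _ _ _ (fun x : R => x `^ a) _ B) => //.
Qed.

(** Integrate [X <= t B / 2 + X^2 / (2 t B)] and choose [t]. In this form infinite integrals can be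
    treated case by case, with no quadratic form to expand. *)
Lemma weighted_CS (X : R -> \bar R) (B : R -> R) (c : R) :
  measurable_fun setT X -> (forall y, (0 <= X y)%E) ->
  measurable_fun setT B -> (forall y, 0 < B y) -> 0 < c ->
  (\int[mu]_y (B y)%:E <= c%:E)%E ->
  (esq (\int[mu]_y X y) <= c%:E * \int[mu]_y (esq (X y) * ((B y)^-1)%:E))%E.
Proof.
move=> mX X0 mB B0 c0 Bc.
set I := (\int[mu]_y (esq (X y) * ((B y)^-1)%:E))%E.
have mBi : measurable_fun setT (fun y => (B y)^-1).
  have -> : (fun y => (B y)^-1) = (fun y => (B y) `^ (-1)).
    by apply/funext => y; rewrite powR_inv1// ltW.
  exact: mpowR.
have mQ : measurable_fun setT (fun y => esq (X y) * ((B y)^-1)%:E)%E.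
  apply: emeasurable_funM; first exact: emeasurable_funM.
  exact/measurable_EFinP.
have Q0 y : (0 <= esq (X y) * ((B y)^-1)%:E)%E.
  by rewrite !mule_ge0// lee_fin invr_ge0 ltW.
have I0 : (0 <= I)%E by exact: integral_ge0.
have key (t : R) : 0 < t -> (\int[mu]_y X y <= (t / 2 * c)%:E + ((2 * t)^-1)%:E * I)%E.
  move=> t0.
  apply: (@le_trans _ _ (\int[mu]_y ((t / 2)%:E * (B y)%:E + ((2 * t)^-1)%:E * (esq (X y) * ((B y)^-1)%:E)))%E).
    apply: ge0_le_integral => //.
    - apply: emeasurable_funD; apply: emeasurable_funM => //; exact/measurable_EFinP.
    - move=> y _; have By := B0 y; have := X0 y.
      case: (X y) => [r| |] //.
        move=> _; rewrite /esq -!EFinM -EFinD lee_fin.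
        rewrite -subr_ge0.
        have -> : t / 2 * B y + (2 * t)^-1 * (r * r * (B y)^-1) - r =
          (t * B y - r) ^+ 2 / (2 * t * B y) by field; rewrite !lt0r_neq0.
        by rewrite divr_ge0 ?sqr_ge0// !mulr_ge0// ltW.
      move=> _; rewrite /esq mulyy gt0_mulye ?lte_fin ?invr_gt0// gt0_muley ?lte_fin ?invr_gt0 ?mulr_gt0//.
  rewrite ge0_integralD//; last 4 first.
  - by move=> y _; rewrite -EFinM lee_fin mulr_ge0 ?divr_ge0 ?ltW.
  - by apply: emeasurable_funM => //; exact/measurable_EFinP.
  - by move=> y _; rewrite mule_ge0// lee_fin invr_ge0 mulr_ge0// ltW.
  - by apply: emeasurable_funM => //; exact/measurable_EFinP.
  rewrite ge0_integralZl//; last 3 first.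
  - exact/measurable_EFinP.
  - by move=> y _; rewrite lee_fin ltW.
  - by rewrite lee_fin divr_ge0// ltW.
  rewrite ge0_integralZl//; last by rewrite lee_fin invr_ge0 mulr_ge0// ltW.
  rewrite [X in (_ <= X + _)%E]EFinM; apply: leeD => //; apply: lee_wpmul2l => //.
  by rewrite lee_fin divr_ge0// ltW.
have S0 : (0 <= \int[mu]_y X y)%E by exact: integral_ge0.
case: I I0 key => [i| |] // i0 key; last first.
  by rewrite gt0_muley ?lte_fin// leey.
case: (\int[mu]_y X y)%E S0 key => [s| |] // s0 key; last first.
  by have := key 1 ltr01; rewrite -EFinM -EFinD.
rewrite /esq -!EFinM lee_fin; rewrite lee_fin in s0.
have [->|sn] := eqVneq s 0; first by rewrite mul0r mulr_ge0// ltW.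
have sp : 0 < s by rewrite lt_neqAle eq_sym sn.
(* This [t] turns the first term into [s / 2] and gives [s * s <= c * i] without square roots. *)
have := key (s / c) (divr_gt0 sp c0).
rewrite -EFinM -EFinD lee_fin.
have -> : s / c / 2 * c + (2 * (s / c))^-1 * i = s / 2 + c * i / (2 * s).
  by field; rewrite sn lt0r_neq0.
rewrite -lerBlDl => h.
have : s / 2 <= c * i / (2 * s) by lra.
rewrite ler_pdivlMr; last by rewrite mulr_gt0.
by have -> : s / 2 * (2 * s) = s * s by field.
Qed.

(** Comparable to [sqrt (1 + x^2)], but subadditive in the sense of [jap_sub], and the integrals of
    its powers are explicit. *)
Definition jap (x : R) : R := 1 + `|x|.

Lemma jap_ge1 x : 1 <= jap x. Proof. by rewrite lerDl. Qed.
Lemma jap_gt0 x : 0 < jap x. Proof. exact: lt_le_trans ltr01 (jap_ge1 x). Qed.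
Lemma measurable_jap : measurable_fun setT jap.
Proof.
have -> : jap = (fun x => 1 + `|x|) by [].
by apply: continuous_measurable_fun => x; apply: cvgD; [exact: cvg_cst|exact: norm_continuous].
Qed.
Lemma measurable_jap_pow a : measurable_fun setT (fun x => jap x `^ a).
Proof. by apply: mpowR; exact: measurable_jap. Qed.

Lemma jap_sub z y : jap z <= jap (z - y) + jap y.
Proof.
rewrite /jap; have : `|z| <= `|z - y| + `|y| by rewrite -{1}(subrK y z) ler_normD.
have lin (a b c : R) : a <= b + c -> 1 + a <= 1 + b + (1 + c) by lra.
exact: lin.
Qed.

(** The larger of [p] and [q] is at least [r / 2], so it absorbs the power of [r] at the cost of a
    factor 2. What is left of it then has a nonpositive exponent and may be replaced by the same
    power of the smaller one. *)
Lemma powR_split (r p q a a' : R) : 1 <= p -> 1 <= q -> 1 <= r -> r <= p + q ->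
  0 <= a' -> a' <= a -> a <= 1 ->
  r `^ a' * (p^-1 * q `^ (- a)) <= 2 * (p `^ (- (1 + (a - a'))) + q `^ (- (1 + (a - a')))).
Proof.
move=> p1 q1 r1 rpq a0' aa a1.
have a1' : a' <= 1 by exact: le_trans aa a1.
have p0 : 0 < p by exact: lt_le_trans ltr01 p1.
have q0 : 0 < q by exact: lt_le_trans ltr01 q1.
have r0 : 0 < r by exact: lt_le_trans ltr01 r1.
have two (M : R) : 1 <= M -> r <= 2 * M -> r `^ a' <= 2 * M `^ a'.
  move=> M1 rM; have M0 : 0 < M by exact: lt_le_trans ltr01 M1.
  apply: (@le_trans _ _ ((2 * M) `^ a')).
    by apply: ge0_ler_powR => //; rewrite nnegrE ?mulr_ge0// ltW.
  have -> : (2 * M) `^ a' = 2 `^ a' * M `^ a' by rewrite powRM// ltW.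
  rewrite ler_wpM2r ?powR_ge0//.
  by apply: ler1_powR => //; lra.
have pw (x y : R) : 0 < x -> x `^ (- (1 + (a - a'))) = x `^ (a' - a) * x^-1.
  move=> x0; have -> : - (1 + (a - a')) = (a' - a) + (- 1) by ring.
  by rewrite powRD ?lt0r_neq0 ?implybT// powR_inv1// ltW.
have dec (x y e : R) : 1 <= x -> x <= y -> e <= 0 -> y `^ e <= x `^ e.
  move=> x1 xy e0.
  have x0 : 0 < x by exact: lt_le_trans ltr01 x1.
  have y0 : 0 < y by exact: lt_le_trans x0 xy.
  have -> : e = - (- e) by rewrite opprK.
  rewrite !(powRN _ (- e)) lef_pV2 ?posrE ?powR_gt0//.
  by apply: ge0_ler_powR; rewrite ?nnegrE ?oppr_ge0// ltW.
have [pq|qp] := leP p q.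
- have h := two q q1 (le_trans rpq _).
  have {}h : r `^ a' <= 2 * q `^ a' by apply: h; lra.
  apply: (@le_trans _ _ (2 * q `^ a' * (p^-1 * q `^ (- a)))).
    by rewrite ler_wpM2r// mulr_ge0 ?powR_ge0// invr_ge0 ltW.
  have -> : 2 * q `^ a' * (p^-1 * q `^ (- a)) = 2 * (q `^ (a' - a) * p^-1).
    by rewrite powRD ?lt0r_neq0 ?implybT//; ring.
  rewrite ler_wpM2l// (pw p p)//.
  apply: (@le_trans _ _ (p `^ (a' - a) * p^-1)); last by rewrite lerDl powR_ge0.
  rewrite ler_wpM2r ?invr_ge0 ?(ltW p0)//; apply: dec => //; lra.
- have {}qp : q <= p by exact: ltW.
  have h := two p p1 (le_trans rpq _).
  have {}h : r `^ a' <= 2 * p `^ a' by apply: h; lra.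
  apply: (@le_trans _ _ (2 * p `^ a' * (p^-1 * q `^ (- a)))).
    by rewrite ler_wpM2r// mulr_ge0 ?powR_ge0// invr_ge0 ltW.
  have -> : 2 * p `^ a' * (p^-1 * q `^ (- a)) = 2 * (p `^ (a' - 1) * q `^ (- a)).
    by rewrite powRD ?lt0r_neq0 ?implybT// powR_inv1 ?ltW//; ring.
  rewrite ler_wpM2l//.
  apply: (@le_trans _ _ (q `^ (- (1 + (a - a'))))); last by rewrite lerDr powR_ge0.
  have -> : - (1 + (a - a')) = (a' - 1) + (- a) by ring.
  have -> : q `^ (a' - 1 + - a) = q `^ (a' - 1) * q `^ (- a) by rewrite powRD// lt0r_neq0 ?implybT.
  by rewrite ler_wpM2r ?powR_ge0//; apply: dec => //; lra.
Qed.

Lemma int_jap_pow (d : R) : 0 < d -> (\int[mu]_x (jap x `^ (- (1 + d)))%:E = (2 / d)%:E)%E.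
Proof.
move=> d0; have dn := lt0r_neq0 d0.
pose F (x : R) := - (d^-1 * (1 + x) `^ (- d)).
have dF (x : R) : 0 <= x -> is_derive x (1 : R) F ((1 + x) `^ (- (1 + d))).
  move=> x0; have x1 : 0 < 1 + x by rewrite ltr_pwDl.
  have D : is_derive x (1 : R) (fun y : R => (1 + y) `^ (- d)) ((- d) * (1 + x) `^ (- d - 1)).
    have D1 : is_derive x (1 : R) (fun y : R => 1 + y) 1 by apply: is_derive_eq; rewrite add0r mulr1.
    have := is_derive1_comp (is_derive1_powR (- d) x1) D1.
    by rewrite mulr1.
  rewrite /F; apply: is_derive_eq.
  have -> : - (1 + d) = - d - 1 by ring.
  by rewrite /GRing.scale /=; field.
rewrite (@integral_even_FTC R _ (fun x => (1 + x) `^ (- (1 + d))) F 0 _ _ _ dF)//.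
- by rewrite /F addr0 powR1; congr EFin; field.
- by move=> x; exact: powR_ge0.
- move=> x; have e y : jap y `^ (- (1 + d)) = expR (- (1 + d) * ln (jap y)).
    by rewrite /powR gt_eqF// jap_gt0.
  rewrite (_ : (fun y => jap y `^ (- (1 + d))) = (fun y => expR (- (1 + d) * ln (jap y)))); last first.
    by apply/funext.
  apply: continuous_comp; last exact: continuous_expR.
  apply: continuousM; first exact: cst_continuous.
  apply: continuous_comp; last by apply: continuous_ln; exact: jap_gt0.
  by apply: continuousD; [exact: cst_continuous|exact: norm_continuous].
- by move=> x; rewrite /jap normrN.
- by move=> x x0; rewrite /jap gtr0_norm.
- rewrite /F -oppr0; apply: cvgN; rewrite -(mulr0 d^-1); apply: cvgM; first exact: cvg_cst.
  have cv0 : expR (- (d * x)) @[x --> +oo] --> (0 : R) by exact: cvgy_expRN.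
  have ln1 : ln (1 + x) @[x --> (+oo : set_system R)] --> (+oo : set_system R).
    apply/cvgryPge => A; near=> x.
    rewrite -(expRK A) ler_ln ?posrE ?expR_gt0//.
      by apply: (@le_trans _ _ x); [near: x; exact: nbhs_pinfty_ge (num_real _)|rewrite lerDr].
    by rewrite ltr_pwDl//; near: x; exact: nbhs_pinfty_ge (num_real _).
  have := cvg_comp _ _ ln1 cv0; apply: cvg_trans; apply: near_eq_cvg.
  near=> x; rewrite /= /powR gt_eqF ?mulNr//.
  by rewrite ltr_pwDl//; near: x; exact: nbhs_pinfty_ge (num_real _).
Unshelve. all: by end_near. Qed.

(* Cauchy-Schwarz with weight [1 / (jap (x - y) * jap y `^ a)], whose integral in [y] is
   [O(jap x `^ (- a'))] by [powR_split]. *)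
Lemma sobolev_step (G H : R -> \bar R) (a a' : R) :
  measurable_fun setT G -> (forall x, (0 <= G x)%E) ->
  measurable_fun setT H -> (forall x, (0 <= H x)%E) ->
  0 <= a' -> a' < a -> a <= 1 ->
  (\int[mu]_x (esq (G x) * (jap x)%:E) < +oo)%E ->
  (\int[mu]_x (esq (H x) * (jap x `^ a)%:E) < +oo)%E ->
  (\int[mu]_x (esq (econv G H x) * (jap x `^ a')%:E) < +oo)%E.
Proof.
move=> mG G0 mH H0 a0' aa a1 Gf Hf.
have d0 : 0 < a - a' by rewrite subr_gt0.
(* The factor 2 of [powR_split] times the sum of two integrals from [int_jap_pow], each equal to
   [2 / (a - a')]. *)
pose c : R := 2 * (2 / (a - a') + 2 / (a - a')).
have c0 : 0 < c by rewrite mulr_gt0// addr_gt0// divr_gt0.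
pose G2 x := (esq (G x) * (jap x)%:E)%E.
pose H2 x := (esq (H x) * (jap x `^ a)%:E)%E.
have mG2 : measurable_fun setT G2.
  apply: emeasurable_funM; first exact: emeasurable_funM.
  by apply/measurable_EFinP; exact: measurable_jap.
have mH2 : measurable_fun setT H2.
  apply: emeasurable_funM; first exact: emeasurable_funM.
  by apply/measurable_EFinP; exact: measurable_jap_pow.
have G20 x : (0 <= G2 x)%E by rewrite !mule_ge0// lee_fin ltW// jap_gt0.
have H20 x : (0 <= H2 x)%E by rewrite !mule_ge0// lee_fin powR_ge0.
have pt z : (esq (econv G H z) * (jap z `^ a')%:E <= c%:E * econv G2 H2 z)%E.
  pose B y := (jap (z - y))^-1 * jap y `^ (- a).
  pose w := jap z `^ a'.
  have w0 : 0 < w by rewrite powR_gt0// jap_gt0.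
  have B0 y : 0 < B y by rewrite mulr_gt0 ?invr_gt0 ?powR_gt0 ?jap_gt0.
  have mB : measurable_fun setT B.
    apply: measurable_funM; last exact: measurable_jap_pow.
    have -> : (fun y => (jap (z - y))^-1) = (fun y => (jap (z - y)) `^ (-1)).
      by apply/funext => y; rewrite powR_inv1// ltW// jap_gt0.
    exact: (measurableT_comp (measurable_jap_pow (-1)) (mreflect z)).
  have Bc : (\int[mu]_y (B y)%:E <= (c / w)%:E)%E.
    rewrite mulrC EFinM lee_pdivlMl//.
    have mBE : measurable_fun setT (fun y => (B y)%:E) by exact/measurable_EFinP.
    rewrite -ge0_integralZl//; last 2 first.
    - by move=> y _; rewrite lee_fin ltW.
    - by rewrite lee_fin ltW.
    apply: (@le_trans _ _ (\int[mu]_y (2%:E * ((jap (z - y) `^ (- (1 + (a - a'))))%:E + (jap y `^ (- (1 + (a - a'))))%:E)))%E).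
      apply: ge0_le_integral => //.
      - by move=> y _; rewrite -EFinM lee_fin mulr_ge0// ltW.
      - by apply: emeasurable_funM.
      - apply: emeasurable_funM => //; apply: emeasurable_funD; apply/measurable_EFinP.
          exact: (measurableT_comp (measurable_jap_pow _) (mreflect z)).
        exact: measurable_jap_pow.
      - move=> y _; rewrite -EFinD -!EFinM lee_fin.
        by apply: powR_split; rewrite ?jap_ge1 ?jap_sub// ltW.
    have m1 : measurable_fun setT (fun y : R => (jap (z - y) `^ (- (1 + (a - a'))))%:E).
      by apply/measurable_EFinP; exact: (measurableT_comp (measurable_jap_pow _) (mreflect z)).
    have m2 : measurable_fun setT (fun y : R => (jap y `^ (- (1 + (a - a'))))%:E).
      by apply/measurable_EFinP; exact: measurable_jap_pow.
    rewrite ge0_integralZl//; last 2 first.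
    - exact: emeasurable_funD.
    - by move=> y _; rewrite adde_ge0// lee_fin powR_ge0.
    rewrite ge0_integralD//; last 2 first.
    - by move=> y _; rewrite lee_fin powR_ge0.
    - by move=> y _; rewrite lee_fin powR_ge0.
    rewrite (@ge0_int_preserving R (fun y => z - y) (mreflect z) (leb_reflect z) (fun y => (jap y `^ (- (1 + (a - a'))))%:E))//; last first.
      by move=> y; rewrite lee_fin powR_ge0.
    by rewrite int_jap_pow.
  have mX : measurable_fun setT (fun y : R => G (z - y)%R * H y)%E.
    by apply: emeasurable_funM => //; exact: (measurableT_comp mG (mreflect z)).
  have X0 y : (0 <= G (z - y)%R * H y)%E by rewrite mule_ge0.
  have := weighted_CS mX X0 mB B0 (divr_gt0 c0 w0) Bc.
  (* Dividing by [B] restores the weights of [G] at [z - y] and of [H] at [y], so a convolution of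
     integrable functions reappears. *)
  have -> : (\int[mu]_y (esq (G (z - y)%R * H y) * ((B y)^-1)%:E) = econv G2 H2 z)%E.
    apply: eq_integral => y _; rewrite /G2 /H2 /B invfM invrK powRN invrK EFinM /esq.
    rewrite -!muleA; congr (_ * _)%E; rewrite muleCA; congr (_ * _)%E.
    rewrite [RHS]muleCA; congr (_ * _)%E; rewrite muleCA; congr (_ * _)%E.
  have wc : w * (c / w) = c by rewrite mulrC divfK// lt0r_neq0.
  move=> h; rewrite muleC -[X in (_ <= X%:E * _)%E]wc EFinM -muleA.
  by apply: lee_wpmul2l => //; rewrite lee_fin ltW.
apply: (@le_lt_trans _ _ (\int[mu]_z (c%:E * econv G2 H2 z))%E).
  apply: ge0_le_integral => //.
  - by move=> z _; rewrite !mule_ge0 ?econv_ge0// lee_fin powR_ge0.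
  - apply: emeasurable_funM; last by apply/measurable_EFinP; exact: measurable_jap_pow.
    by apply: emeasurable_funM; exact: measurable_econv.
  - by apply: emeasurable_funM => //; exact: measurable_econv.
rewrite ge0_integralZl//; last 3 first.
- exact: measurable_econv.
- by move=> z _; exact: econv_ge0.
- by rewrite lee_fin ltW.
rewrite integral_econv//.
have fG : (\int[mu]_x G2 x)%E \is a fin_num by rewrite ge0_fin_numE// integral_ge0.
have fH : (\int[mu]_x H2 x)%E \is a fin_num by rewrite ge0_fin_numE// integral_ge0.
by rewrite -(fineK fG) -(fineK fH) -!EFinM ltry.
Qed.

(* Starting from the weight [jap], each of the [j] convolutions costs a power [1 / (j+1)] of it. *)
Lemma sobolev (G : R -> \bar R) (j : nat) :
  measurable_fun setT G -> (forall x, (0 <= G x)%E) ->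
  (\int[mu]_x (esq (G x) * (jap x)%:E) < +oo)%E ->
  (\int[mu]_x esq (epw G j x) < +oo)%E.
Proof.
move=> mG G0 Gf.
pose d : R := (j.+1%:R)^-1.
have d0 : 0 < d by rewrite invr_gt0.
have jd : j.+1%:R * d = 1 by rewrite mulfV.
have step i : (i <= j)%N -> (\int[mu]_x (esq (epw G i x) * (jap x `^ (1 - i%:R * d))%:E) < +oo)%E.
  elim: i => [_|i IH ij].
    rewrite mul0r subr0; under eq_integral do rewrite powRr1 ?(ltW (jap_gt0 _))//.
    exact: Gf.
  have id : 0 <= 1 - i.+1%:R * d.
    by rewrite subr_ge0 -[leRHS]jd ler_wpM2r ?(ltW d0)// ler_nat ltnW.
  apply: (@sobolev_step G (epw G i) (1 - i%:R * d)) => //.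
  - exact: measurable_iter_econv.
  - exact: iter_econv_ge0.
  - by rewrite ltrD2l ltrN2 ltr_pM2r// ltr_nat.
  - by rewrite gerBl mulr_ge0// ltW.
  - by apply: IH; exact: ltnW.
have mE : measurable_fun setT (epw G j) by exact: measurable_iter_econv.
have E0 x : (0 <= epw G j x)%E by exact: iter_econv_ge0.
apply: le_lt_trans (step j (leqnn j)); apply: ge0_le_integral => //.
- by move=> x _; rewrite mule_ge0.
- exact: emeasurable_funM.
- apply: emeasurable_funM; first exact: emeasurable_funM.
  by apply/measurable_EFinP; exact: measurable_jap_pow.
- move=> x _; rewrite lee_pemulr ?mule_ge0// lee_fin.
  rewrite -[leLHS](powRr0 (jap x)); apply: ler_powR; first exact: jap_ge1.
  by rewrite subr_ge0 -[leRHS]jd ler_wpM2r ?(ltW d0)// ler_nat.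
Qed.

End Sobolev.

(** * Lower semicontinuity and limits along truncations *)

Section LowerSemicontinuity.
Variable R : realType.
Local Notation mu := (@lebesgue_measure R).
Local Notation L1 f := (integrable mu setT (EFin \o f)).
Implicit Types f g h u w q : R -> cplx R.

Lemma truncf_near f x : \forall n \near \oo, truncf f n x = f x.
Proof. by apply: filterS (truncD_near f x) => n Dnx; rewrite /truncf /cutf mem_set. Qed.

Lemma bernoulli_expr (a b : R) (k : nat) : 0 <= a -> 0 <= b ->
  b ^+ k.+1 + k.+1%:R * b ^+ k * (a - b) <= a ^+ k.+1.
Proof.
move=> a0 b0; elim: k => [|k IH]; first by rewrite !expr1 expr0; lra.
have h : 0 <= b ^+ k * (a - b) ^+ 2 by rewrite mulr_ge0 ?sqr_ge0 ?exprn_ge0.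
have := ler_wpM2l a0 IH; rewrite -exprS => {}IH.
apply: le_trans _ IH; rewrite -subr_ge0.
rewrite (_ : _ - _ = k.+1%:R * (b ^+ k * (a - b) ^+ 2)); first by rewrite mulr_ge0.
by rewrite (exprS b k.+1) (exprS b k) -[k.+2]addn1 natrD; ring.
Qed.

Lemma cnorm2_pow_convex (u q : cplx R) (k : nat) :
  cnorm2 q ^+ k.+1 + k.+1%:R * cnorm2 q ^+ k * (2 * cdot q (csub u q)) <= cnorm2 u ^+ k.+1.
Proof.
apply: le_trans (bernoulli_expr k (cnorm2_ge0 u) (cnorm2_ge0 q)).
rewrite lerD2l ler_wpM2l ?mulr_ge0 ?exprn_ge0 ?cnorm2_ge0//.
rewrite -subr_ge0 (_ : _ - _ = (u.1 - q.1) ^+ 2 + (u.2 - q.2) ^+ 2) ?addr_ge0 ?sqr_ge0//.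
by rewrite /cnorm2 /cdot /csub /=; ring.
Qed.

Lemma nice_pow_L1 q k : nice q -> L1 (fun x => cnorm2 (q x) ^+ k.+1).
Proof.
move=> nq; have [mq [M [M0 qM _]]] := nq.
apply: (@le_L1 _ _ (fun x => (M ^+ 2) ^+ k * cnorm2 (q x))).
- by apply: measurable_funX; exact: measurable_cnorm2.
- move=> x; rewrite ger0_norm ?exprn_ge0 ?cnorm2_ge0// exprSr ler_wpM2r ?cnorm2_ge0//.
  apply: lerXn2r; rewrite ?nnegrE ?cnorm2_ge0 ?exprn_ge0 ?(ltW M0)//.
  by rewrite -cabs_sqr; apply: lerXn2r; rewrite ?nnegrE ?cabs_ge0 ?(ltW M0).
- by apply: L1_scale; apply: L2_n2; exact: nice_L2.
Qed.

(* Weak lower semicontinuity by convexity: [|z|^(2k+2)] lies above its tangent at the truncation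
   of [q], and the tangent is tested against [u_ n - q] in [L2]. *)
Lemma power_lsc q (u_ : nat -> R -> cplx R) (B : nat -> R) (k M : nat) :
  L2 q -> (forall n, L2 (u_ n)) -> n2 (fun x => csub (u_ n x) (q x)) @[n --> \oo] --> 0 ->
  (forall n, (\int[mu]_x (cnorm2 (u_ n x) ^+ k.+1)%:E <= (B n)%:E)%E) ->
  exists2 r : nat -> R, r n @[n --> \oo] --> 0 &
    forall n, Rintegral mu setT (fun x => cnorm2 (truncf q M x) ^+ k.+1) <= B n + r n.
Proof.
move=> q2 u2 uq uB; have mq := L2_cmeas q2.
pose q' := truncf q M; have nq' : nice q' by exact: nice_trunc.
(* The gradient of [|z|^(2 k + 2)] at [q' x]; it lies in [L^2] because [q'] is bounded and square
   integrable. *)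
pose h x := cscalec (2 * (k.+1%:R * cnorm2 (q' x) ^+ k)) (q' x).
have h2 : L2 h.
  have [mq' [C [C0 qC _]]] := nq'.
  apply: (@le_L2 _ _ (fun x => (2 * (k.+1%:R * (C ^+ 2) ^+ k)) ^+ 2 * cnorm2 (q' x))).
  - apply: cmeas_scale => //; apply: measurable_funM => //; apply: measurable_funM => //.
    by apply: measurable_funX; exact: measurable_cnorm2.
  - move=> x; rewrite cnorm2_scale ler_wpM2r ?cnorm2_ge0//.
    have c0 : 0 <= cnorm2 (q' x) ^+ k by rewrite exprn_ge0// cnorm2_ge0.
    have c1 : 0 <= (C ^+ 2) ^+ k by rewrite !exprn_ge0// ltW.
    apply: lerXn2r; rewrite ?nnegrE ?mulr_ge0//.
    rewrite !ler_wpM2l//; apply: lerXn2r; rewrite ?nnegrE ?cnorm2_ge0 ?exprn_ge0 ?(ltW C0)//.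
    by rewrite -cabs_sqr; apply: lerXn2r; rewrite ?nnegrE ?cabs_ge0 ?(ltW C0).
  - by apply: L1_scale; apply: L2_n2; exact: nice_L2.
exists (fun n => ip h q - ip h (u_ n)).
  rewrite -(subrr (ip h q)); apply: cvgB; first exact: cvg_cst.
  apply: ip_cvg => //.
  rewrite (_ : (fun n => n2 (fun x => csub (q x) (u_ n x))) = (fun n => n2 (fun x => csub (u_ n x) (q x))))//.
  by apply/funext => n; apply: eq_Rintegral => x _; rewrite /cnorm2 /csub /=; ring.
move=> n; rewrite -lerBlDr opprB -ip_sub//.
have L2d := L2_sub (u2 n) q2.
have i1 := nice_pow_L1 k nq'.
have i2 := L2_dot h2 L2d.
rewrite /ip -RintegralD//.
have i12 : L1 (fun x => cnorm2 (q' x) ^+ k.+1 + cdot (h x) (csub (u_ n x) (q x))) by exact: L1_add.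
rewrite -lee_fin (ge0_Rint_EFin i12); apply: le_trans (uB n).
have mu2 : measurable_fun setT (fun x => cnorm2 (u_ n x) ^+ k.+1).
  by apply: measurable_funX; apply: measurable_cnorm2; exact: L2_cmeas.
apply: le_integral => //.
- apply: L1_of_lty => //; apply: le_lt_trans (ltry (B n)); apply: le_trans (uB n).
  by under eq_integral do rewrite ger0_norm ?exprn_ge0 ?cnorm2_ge0//.
- move=> x _; rewrite lee_fin.
  apply: le_trans (cnorm2_pow_convex (u_ n x) (q' x) k); rewrite lerD2l.
  (* The tangent is taken at [q'] but tested against [u_ n - q]: the two points agree where nothing
     is cut, and elsewhere [h] vanishes. *)
  rewrite /h /q' /truncf /cutf; case: ifP => _.
    rewrite le_eqVlt; apply/orP; left; apply/eqP; rewrite /cdot /=; ring.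
  by rewrite /cdot /= !mulr0 !mul0r addr0 !mulr0.
Qed.

Lemma pow_trunc_cvg q k : cmeas q ->
  (\int[mu]_x (cnorm2 (truncf q M x) ^+ k.+1)%:E)%E @[M --> \oo] -->
  (\int[mu]_x (cnorm2 (q x) ^+ k.+1)%:E)%E.
Proof.
move=> mq.
have -> : (\int[mu]_x (cnorm2 (q x) ^+ k.+1)%:E)%E =
    (\int[mu]_x limn (fun M => (cnorm2 (truncf q M x) ^+ k.+1)%:E))%E.
  apply: eq_integral => x _; apply/esym/cvg_lim => //; apply: cvg_near_cst.
  by apply: filterS (truncf_near q x) => M ->.
apply: cvg_monotone_convergence => //.
- move=> M; apply/measurable_EFinP; apply: measurable_funX; apply: measurable_cnorm2.
  by apply: cmeas_cut => //; exact: measurable_truncD.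
- by move=> M x _; rewrite lee_fin exprn_ge0// cnorm2_ge0.
- move=> x _ m n mn; rewrite lee_fin; apply: lerXn2r; rewrite ?nnegrE ?cnorm2_ge0//.
  rewrite /truncf /cutf; case: ifPn => [|_]; last by rewrite {1}/cnorm2 /= expr0n addr0 cnorm2_ge0.
  move=> /set_mem/andP[h1 h2]; rewrite mem_set//; apply/andP; split.
  - by rewrite (le_trans h1)// ler_nat.
  - by rewrite (le_trans h2)// ler_nat.
Qed.

Lemma eabs_trunc_le f n x : (eabs (truncf f n) x <= eabs f x)%E.
Proof. by rewrite lee_fin cabs_cut_le. Qed.

Lemma eabs_trunc_nd f m n x : (m <= n)%N -> (eabs (truncf f m) x <= eabs (truncf f n) x)%E.
Proof.
move=> mn; rewrite lee_fin /truncf /cutf; case: ifPn => [|_]; last by rewrite cabs0 cabs_ge0.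
move=> /set_mem/andP[h1 h2]; rewrite mem_set//; apply/andP; split.
- by rewrite (le_trans h1)// ler_nat.
- by rewrite (le_trans h2)// ler_nat.
Qed.

Lemma measurable_eabs_trunc f n : cmeas f -> measurable_fun setT (eabs (truncf f n)).
Proof. by move=> mf; apply: measurable_eabs; apply: cmeas_cut => //; exact: measurable_truncD. Qed.

Lemma measurable_epw (G : R -> \bar R) j : measurable_fun setT G -> (forall x, (0 <= G x)%E) ->
  measurable_fun setT (epw G j).
Proof. by move=> mG G0; exact: measurable_iter_econv. Qed.

Lemma epw_ge0 (G : R -> \bar R) j x : (forall x, (0 <= G x)%E) -> (0 <= epw G j x)%E.
Proof. by move=> G0; exact: iter_econv_ge0. Qed.

Lemma le_epw (G G' : R -> \bar R) j x : measurable_fun setT G -> measurable_fun setT G' ->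
  (forall x, (0 <= G x)%E) -> (forall x, (G x <= G' x)%E) -> (epw G j x <= epw G' j x)%E.
Proof. by move=> mG mG' G0 GG; exact: le_iter_econv. Qed.

Lemma epw_trunc_cvg f j x : cmeas f ->
  epw (eabs (truncf f n)) j x @[n --> \oo] --> epw (eabs f) j x.
Proof.
move=> mf; elim: j x => [|j IH] x.
  by apply: cvg_near_cst; apply: filterS (truncf_near f x) => n H; rewrite /epw /= /eabs H.
rewrite /epw /= -/(epw (eabs f) j).
have mt n := measurable_eabs_trunc n mf.
have -> : econv (eabs f) (epw (eabs f) j) x =
    (\int[mu]_y limn (fun n => eabs (truncf f n) (x - y)%R * epw (eabs (truncf f n)) j y))%E.
  apply: eq_integral => y _; apply/esym/cvg_lim => //.
  (* The first factor is eventually equal to a finite constant, so no product of 0 with [+oo]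
     disturbs the limit. *)
  have H : (eabs f (x - y)%R * epw (eabs (truncf f n)) j y)%E @[n --> \oo] --> (eabs f (x - y)%R * epw (eabs f) j y)%E.
    by apply: cvgeZl.
  apply: cvg_trans H; apply: near_eq_cvg.
  by apply: filterS (truncf_near f (x - y)) => n Hn; rewrite {3}/eabs Hn.
apply: (@cvg_monotone_convergence _ _ R mu setT measurableT (fun n y => eabs (truncf f n) (x - y)%R * epw (eabs (truncf f n)) j y)%E).
- move=> n; apply: emeasurable_funM; first exact: (measurableT_comp (mt n) (mreflect x)).
  by apply: measurable_epw => //; exact: eabs_ge0.
- by move=> n y _; rewrite mule_ge0 ?eabs_ge0// epw_ge0//; exact: eabs_ge0.
- move=> y _ m n mn; apply: lee_pmul.
  + exact: eabs_ge0.
  + by apply: epw_ge0; exact: eabs_ge0.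
  + exact: eabs_trunc_nd.
  + by apply: le_epw => //; [exact: eabs_ge0|move=> z; exact: eabs_trunc_nd].
Qed.

Lemma le_esq (a b : \bar R) : (0 <= a)%E -> (a <= b)%E -> (esq a <= esq b)%E.
Proof. by move=> a0 ab; exact: lee_pmul. Qed.

Lemma energy_trunc_cvg f j : cmeas f ->
  (\int[mu]_x esq (epw (eabs (truncf f n)) j x))%E @[n --> \oo] --> (\int[mu]_x esq (epw (eabs f) j x))%E.
Proof.
move=> mf; have mt n := measurable_eabs_trunc n mf.
have me n := measurable_epw j (mt n) (@eabs_ge0 _ (truncf f n)).
have E : (\int[mu]_x esq (epw (eabs f) j x) = \int[mu]_x limn (fun n => esq (epw (eabs (truncf f n)) j x)))%E.
  apply: eq_integral => x _; apply/esym/cvg_lim => //.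
  have H := @epw_trunc_cvg f j x mf.
  apply: (cvgeM _ H H).
  by case: (epw _ _ _) => [r| |] //=; rewrite /mule_def /= ?eqxx //; case: (r == 0).
suff key L : L = (\int[mu]_x limn (fun n => esq (epw (eabs (truncf f n)) j x)))%E ->
    (\int[mu]_x esq (epw (eabs (truncf f n)) j x))%E @[n --> \oo] --> L by exact: key E.
move=> ->.
apply: cvg_monotone_convergence => //.
- by move=> n; exact: (emeasurable_funM (me n) (me n)).
- by move=> n x _; rewrite mule_ge0 ?epw_ge0//; exact: eabs_ge0.
- move=> x _ m n mn; apply: le_esq; first by apply: epw_ge0; exact: eabs_ge0.
  by apply: le_epw => //; [exact: eabs_ge0|move=> z; exact: eabs_trunc_nd].
Qed.

(** For nonnegative functions the integral of a convolution is the product of the integrals; as [G]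
    has positive integral, vanishing can be traced back through every convolution. *)
Lemma int_iter_econv (G H : R -> \bar R) j : measurable_fun setT G -> (forall x, (0 <= G x)%E) ->
  measurable_fun setT H -> (forall x, (0 <= H x)%E) ->
  (0 < \int[mu]_x G x)%E -> (\int[mu]_x esq (iter j (econv G) H x) = 0)%E ->
  (\int[mu]_x H x = 0)%E.
Proof.
move=> mG G0 mH H0 Gp.
have mi : measurable_fun setT (iter j (econv G) H) by exact: measurable_iter_econv.
have i0 x : (0 <= iter j (econv G) H x)%E by exact: iter_econv_ge0.
move=> e.
have : (\int[mu]_x `|esq (iter j (econv G) H x)| = 0)%E.
  by rewrite -e; apply: eq_integral => x _; rewrite gee0_abs// mule_ge0.
move/(ae_eq_integral_abs mu measurableT (emeasurable_funM mi mi)) => ae0.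
have {e ae0} : (\int[mu]_x iter j (econv G) H x = 0)%E.
  have -> : (0 = \int[mu]_(x in setT) (cst 0%E x))%E by rewrite integral_cst// mul0e.
  apply: ae_eq_integral => //; apply: filterS ae0 => x /(_ I) h _ /=.
  by apply/eqP; move/eqP : h; rewrite /= /esq mule_eq0 orbb.
elim: j {mi i0} => [//|j IH].
rewrite [in X in X -> _]/= integral_econv//; last 2 first.
- exact: measurable_iter_econv.
- exact: iter_econv_ge0.
move/eqP; rewrite mule_eq0 => /orP[/eqP h|/eqP//]; last first.
by rewrite h ltxx in Gp.
Qed.

End LowerSemicontinuity.

(** * Equality in the convolution inequality *)

Section Extremal.
Variable R : realType.
Local Notation mu := (@lebesgue_measure R).
Local Notation L1 f := (integrable mu setT (EFin \o f)).
Implicit Types f g h u q : R -> cplx R.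

Lemma ae_ge0_int0 (F : R -> \bar R) : measurable_fun setT F -> (forall x, (0 <= F x)%E) ->
  (\int[mu]_x F x = 0)%E -> {ae mu, forall x, F x = 0%E}.
Proof.
move=> mF F0 e.
have : (\int[mu]_x `|F x| = 0)%E by rewrite -e; apply: eq_integral => x _; rewrite gee0_abs.
by move/(ae_eq_integral_abs mu measurableT mF) => h; apply: (ae_mono h) => x; apply.
Qed.

Lemma int0_ae_ge0 (F : R -> \bar R) : measurable_fun setT F ->
  {ae mu, forall x, F x = 0%E} -> (\int[mu]_x F x = 0)%E.
Proof.
move=> mF e.
have -> : (0 = \int[mu]_(x in setT) (cst 0%E x))%E by rewrite integral_cst// mul0e.
by apply: ae_eq_integral => //; apply: (ae_mono e) => x h _.
Qed.

Lemma le_int_ge0 (F G : R -> \bar R) : measurable_fun setT F -> measurable_fun setT G ->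
  (forall x, (0 <= F x)%E) -> (forall x, (F x <= G x)%E) -> (\int[mu]_x F x <= \int[mu]_x G x)%E.
Proof.
by move=> mF mG F0 FG; apply: ge0_le_integral => // x _.
Qed.

Lemma measurable_esq (F : R -> \bar R) : measurable_fun setT F -> measurable_fun setT (fun x => esq (F x)).
Proof. by move=> mF; exact: emeasurable_funM. Qed.

Lemma esq_ge0 (x : \bar R) : (0 <= x)%E -> (0 <= esq x)%E.
Proof. by move=> x0; exact: mule_ge0. Qed.

Lemma le_int_esq (F G : R -> \bar R) : measurable_fun setT F -> measurable_fun setT G ->
  (forall x, (0 <= F x)%E) -> (forall x, (F x <= G x)%E) ->
  (\int[mu]_x esq (F x) <= \int[mu]_x esq (G x))%E.
Proof.
move=> mF mG F0 FG; apply: le_int_ge0.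
- exact: measurable_esq.
- exact: measurable_esq.
- by move=> x; exact: esq_ge0.
- by move=> x; exact: le_esq.
Qed.

Lemma cnorm2_esq f x : (cnorm2 (f x))%:E = esq (eabs f x).
Proof. by rewrite /esq /eabs -EFinM -expr2 cabs_sqr. Qed.

(* The exponent of the paper is [sigma.+1]. [J] is the minimal quotient and [NK] the power
   integral of the minimiser, both rescaled by powers of [2 pi] so that they can be read off
   convolution powers of [w]; as [w * ... * w] need not converge absolutely a priori, [NK] is
   only related to the truncations of [w]. *)
Variables (m : R -> R) (w : R -> cplx R) (sigma : nat) (J NK : R).
Hypothesis mm : measurable_fun setT m.
Hypothesis m0 : forall x, 0 < m x.
Hypothesis w2 : L2 w.
Hypothesis mw1 : L1 (fun x => m x * cnorm2 (w x)).
Hypothesis jw1 : L1 (fun x => jap x * cnorm2 (w x)).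
Hypothesis wn0 : ~ {ae mu, forall x, w x = (0, 0)}.
Hypothesis J0 : 0 < J.
Let a : R := Rintegral mu setT (fun x => m x * cnorm2 (w x)).
Hypothesis test : forall f, nice f -> (forall x, (f x).2 = 0 /\ 0 <= (f x).1) ->
  L1 (fun x => m x * cnorm2 (f x)) ->
  J * n2 (cpw f sigma.+1) <= (Rintegral mu setT (fun x => m x * cnorm2 (f x))) ^+ sigma.+2.
Hypothesis JNK : J * NK = a ^+ sigma.+2.
Hypothesis lsc : forall eta : R, 0 < eta ->
  \forall n \near \oo, NK - eta <= n2 (cpw (truncf w n) sigma.+1).

Let mw : cmeas w. Proof. exact: L2_cmeas. Qed.
Let g := eabs w.
Let mg : measurable_fun setT g. Proof. exact: measurable_eabs. Qed.
Let g0 x : (0 <= g x)%E. Proof. exact: eabs_ge0. Qed.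
Let gn n := eabs (truncf w n).
Let mgn n : measurable_fun setT (gn n). Proof. exact: measurable_eabs_trunc. Qed.
Let gn0 n x : (0 <= gn n x)%E. Proof. exact: eabs_ge0. Qed.
Let nt n : nice (truncf w n). Proof. exact: nice_trunc. Qed.

(** [test] only concerns [nice] functions. The truncations of [r] are [nice] and increase to it, so
    the left-hand sides converge monotonically under a fixed upper bound. *)
Lemma energy_ineq (r : R -> R) : measurable_fun setT r -> (forall x, 0 <= r x) ->
  L1 (fun x => m x * r x ^+ 2) ->
  (J%:E * \int[mu]_x esq (epw (fun x => (r x)%:E) sigma.+1 x) <=
   ((Rintegral mu setT (fun x => m x * r x ^+ 2)) ^+ sigma.+2)%:E)%E.
Proof.
move=> mr r0 ir.
pose f x : cplx R := (r x, 0).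
have mf : cmeas f by apply: cmeas_pair.
have fE : eabs f = (fun x => (r x)%:E) by apply/funext => x; rewrite /eabs cabs_real.
have cfE x : cnorm2 (f x) = r x ^+ 2 by rewrite /cnorm2 /= expr0n addr0.
have ntf n : nice (truncf f n) by exact: nice_trunc.
have tr n x : (truncf f n x).2 = 0 /\ 0 <= (truncf f n x).1.
  by rewrite /truncf /cutf; case: ifP => _ /=.
have it n : L1 (fun x => m x * cnorm2 (truncf f n x)).
  apply: (@le_L1 _ _ (fun x => m x * r x ^+ 2)) => //.
  - by apply: measurable_funM => //; apply: measurable_cnorm2; case: (ntf n).
  - move=> x; rewrite ger0_norm ?mulr_ge0 ?cnorm2_ge0 ?(ltW (m0 x))//.
    by rewrite ler_wpM2l ?(ltW (m0 x))// -cfE cnorm2_cut_le.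
have b n : (J%:E * \int[mu]_x esq (epw (eabs (truncf f n)) sigma.+1 x) <=
   ((Rintegral mu setT (fun x => m x * r x ^+ 2)) ^+ sigma.+2)%:E)%E.
  rewrite -(n2_cpw_real sigma.+1 (ntf n) (tr n)) -EFinM lee_fin.
  apply: le_trans (test (ntf n) (tr n) (it n)) _.
  have p1 : 0 <= Rintegral mu setT (fun x => m x * cnorm2 (truncf f n x)).
    by apply: Rintegral_ge0 => x _; rewrite mulr_ge0 ?cnorm2_ge0 ?(ltW (m0 x)).
  have p2 : Rintegral mu setT (fun x => m x * cnorm2 (truncf f n x)) <= Rintegral mu setT (fun x => m x * r x ^+ 2).
    apply: le_Rintegral => // x _.
    by rewrite ler_wpM2l ?(ltW (m0 x))// -cfE cnorm2_cut_le.
  by apply: lerXn2r => //; rewrite nnegrE// (le_trans p1).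
have H := @energy_trunc_cvg R f sigma.+1 mf.
rewrite fE in H.
have H' : (J%:E * \int[mu]_x esq (epw (eabs (truncf f n)) sigma.+1 x))%E @[n --> \oo] -->
   (J%:E * \int[mu]_x esq (epw (fun x => (r x)%:E) sigma.+1 x))%E by apply: cvgeZl.
by apply: (cvge_to_le H'); exact: nearW.
Qed.

Let K := (\int[mu]_x esq (epw g sigma.+1 x))%E.

Lemma energy_le : (K <= NK%:E)%E.
Proof.
have := @energy_ineq (fun x => cabs (w x)) (measurable_cabs mw) (fun x => cabs_ge0 _).
have e : (fun x => m x * cabs (w x) ^+ 2) = (fun x => m x * cnorm2 (w x)).
  by apply/funext => x; rewrite cabs_sqr.
rewrite e => /(_ mw1); rewrite -/a -JNK EFinM -/g -/K.
by rewrite lee_pmul2l.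
Qed.

Lemma cpw_energy_le n : ((n2 (cpw (truncf w n) sigma.+1))%:E <= \int[mu]_x esq (epw (gn n) sigma.+1 x))%E.
Proof.
rewrite n2_EFin; last by apply: nice_L2; exact: nice_cpw.
under eq_integral do rewrite cnorm2_esq.
apply: le_int_esq.
- by apply: measurable_eabs; case: (nice_cpw sigma.+1 (nt n)).
- exact: measurable_epw.
- exact: eabs_ge0.
- exact: (iter_cconv_abs sigma.+1 (nt n) (nt n)).
Qed.

Lemma gn_le_energy n : (\int[mu]_x esq (epw (gn n) sigma.+1 x) <= K)%E.
Proof.
apply: le_int_esq.
- exact: measurable_epw.
- exact: measurable_epw.
- by move=> x; exact: epw_ge0.
- by move=> x; apply: le_epw => // y; exact: eabs_trunc_le.
Qed.

(** From above by testing minimality with [|w|]. From below because [NK - e], the power of a late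
    truncation, that of its modulus and [K] increase in this order. *)
Lemma energy_eq : K = NK%:E.
Proof.
apply/eqP; rewrite eq_le energy_le/=.
apply/lee_addgt0Pr => e e0.
have [n _ /(_ n (leqnn n)) h] := lsc e0.
rewrite -leeBlDr// -EFinB.
apply: le_trans (gn_le_energy n); apply: le_trans (cpw_energy_le n).
by rewrite lee_fin.
Qed.

Lemma gn_int_gt0 : \forall n \near \oo, (0 < \int[mu]_x gn n x)%E.
Proof.
have : n2 (truncf w n) @[n --> \oo] --> n2 w.
  apply: n2_cut_cvg => //; last exact: truncD_near.
  by move=> n; exact: measurable_truncD.
have w20 : 0 < n2 w.
  rewrite lt_neqAle n2_ge0 andbT; apply/eqP => /esym h; apply: wn0; exact: n2_eq0.
move/cvgrPdist_lt => /(_ _ w20); apply: filterS => n hn.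
rewrite lt0e integral_ge0// andbT; apply/negP => /eqP h.
have ae0 := ae_ge0_int0 (mgn n) (gn0 n) h.
have z : n2 (truncf w n) = 0.
  rewrite /n2 /Rintegral int0_ae_ge0//.
    by apply: emeasurable_cnorm2; case: (nt n).
  apply: (ae_mono ae0) => x [/eqP]; rewrite cabs_eq0 => /eqP ->.
  by rewrite /cnorm2 /= expr0n addr0.
by move: hn; rewrite z subr0 ger0_norm ?ltxx// ltW.
Qed.

(* The gap between |f*f| and |f|*|f| propagates through the remaining convolutions, so it
   must vanish in the limit when the two energies agree. *)
Let D n := eabs (cconv (truncf w n) (truncf w n)).
Let E n x := (econv (gn n) (gn n) x - D n x)%E.

Let mD n : measurable_fun setT (D n).
Proof. by apply: measurable_eabs; case: (nice_conv (nt n) (nt n)). Qed.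

Let D_le n x : (D n x <= econv (gn n) (gn n) x)%E.
Proof. by apply: cconv_abs; case: (nt n). Qed.

Let E0 n x : (0 <= E n x)%E.
Proof. by rewrite /E sube_ge0//; exact: D_le. Qed.

Let mE n : measurable_fun setT (E n).
Proof. by apply: emeasurable_funB => //; exact: measurable_econv. Qed.

Let DE n : econv (gn n) (gn n) = (fun x => D n x + E n x)%E.
Proof. by apply/funext => x; rewrite /E [RHS]addeC; apply/esym; exact: subeK. Qed.

(** Convolving [D n + E n] with the remaining factors gives [A + B] with nonnegative terms, and
    [(A + B)^2 >= A^2 + B^2] separates the gap from a term that dominates the power of the
    truncation. *)
Lemma gap_le n : (\int[mu]_x esq (iter sigma (econv (gn n)) (E n) x) +
   (n2 (cpw (truncf w n) sigma.+1))%:E <= K)%E.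
Proof.
apply: le_trans (gn_le_energy n).
have D0 x : (0 <= D n x)%E by exact: eabs_ge0.
have mIE := measurable_iter_econv (mgn n) (gn0 n) sigma (mE n) (E0 n).
have mID := measurable_iter_econv (mgn n) (gn0 n) sigma (mD n) D0.
have IE0 := iter_econv_ge0 (gn0 n) sigma (E0 n).
have ID0 := iter_econv_ge0 (gn0 n) sigma D0.
rewrite n2_EFin; last by apply: nice_L2; exact: nice_cpw.
under [X in (_ + X)%E]eq_integral do rewrite cnorm2_esq.
have mC : measurable_fun setT (eabs (cpw (truncf w n) sigma.+1)).
  by apply: measurable_eabs; case: (nice_cpw sigma.+1 (nt n)).
rewrite -(@ge0_integralD _ _ R mu setT measurableT); last 4 first.
- by move=> x _; apply: esq_ge0; exact: IE0.
- exact: measurable_esq.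
- by move=> x _; apply: esq_ge0; exact: eabs_ge0.
- exact: measurable_esq.
have me := measurable_epw sigma.+1 (mgn n) (gn0 n).
apply: le_int_ge0.
- by apply: emeasurable_funD; exact: measurable_esq.
- exact: measurable_esq.
- by move=> x; apply: adde_ge0; apply: esq_ge0; [exact: IE0|exact: eabs_ge0].
- move=> x; rewrite epwSr DE iter_econvD//.
  set A := iter _ _ (D n) x; set B := iter _ _ (E n) x.
  have A0 : (0 <= A)%E by exact: ID0.
  have B0 : (0 <= B)%E by exact: IE0.
  apply: (@le_trans _ _ (esq B + esq A)%E).
    apply: leeD => //; apply: le_esq; first exact: eabs_ge0.
    rewrite /cpw iterSr; apply: iter_cconv_abs => //; exact: nice_conv.
  rewrite /esq ge0_muleDl// ge0_muleDr// ge0_muleDr//.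
  rewrite addeC; apply: leeD; first by rewrite leeDl// mule_ge0.
  by rewrite leeDr// mule_ge0.
Qed.

Lemma gap_small (eta : R) : 0 < eta ->
  \forall n \near \oo, (\int[mu]_x esq (iter sigma (econv (gn n)) (E n) x) <= eta%:E)%E.
Proof.
move=> eta0; apply: filterS (lsc eta0) => n h.
have := gap_le n; rewrite energy_eq -leeBrDr// -EFinB => /le_trans; apply.
rewrite lee_fin; have lin (p q e : R) : p - e <= q -> p - q <= e by lra.
exact: lin.
Qed.

(** [E n] need not be monotone in [n]. The tail infimum is one function below all later gaps, so it
    can be convolved with the fixed [gn N] and compared with gap energies that tend to 0. *)
Let h_ N x := einfs (E ^~ x) N.

Let mh N : measurable_fun setT (h_ N).
Proof. exact: measurable_fun_einfs. Qed.

Let h0 N x : (0 <= h_ N x)%E.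
Proof. by apply: le_ereal_inf_tmp => _ [n _ <-]; exact: E0. Qed.

Let h_le N n x : (N <= n)%N -> (h_ N x <= E n x)%E.
Proof. by move=> Nn; apply: ereal_inf_lbound; exists n. Qed.

Lemma inf_gap0 : \forall N \near \oo, {ae mu, forall x, h_ N x = 0%E}.
Proof.
apply: filterS gn_int_gt0 => N gN.
apply: ae_ge0_int0 => //; apply: (int_iter_econv (G := gn N) (j := sigma)) => //.
apply/eqP; rewrite eq_le; apply/andP; split; last first.
  by apply: integral_ge0 => x _; rewrite mule_ge0// iter_econv_ge0.
apply/lee_addgt0Pr => e e0; rewrite add0e.
have [n0 _ hn] := gap_small e0.
have := hn (maxn n0 N) (leq_maxl _ _); apply: le_trans.
have mIh := measurable_iter_econv (mgn N) (gn0 N) sigma (mh N) (h0 N).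
set n := maxn n0 N.
have mIE := measurable_iter_econv (mgn n) (gn0 n) sigma (mE n) (E0 n).
apply: le_int_esq => //; first exact: iter_econv_ge0.
- move=> x; apply: le_iter_econv => //.
  + by move=> y; apply: eabs_trunc_nd; exact: leq_maxr.
  + by move=> y; apply: h_le; exact: leq_maxr.
Qed.

Lemma jw_fin : (\int[mu]_x (esq (g x) * (jap x)%:E) < +oo)%E.
Proof.
have := L1_lty jw1; apply: le_lt_trans; rewrite le_eqVlt; apply/orP; left; apply/eqP.
apply: eq_integral => x _; rewrite ger0_norm ?mulr_ge0 ?cnorm2_ge0 ?(ltW (jap_gt0 x))//.
by rewrite /esq /g /eabs -!EFinM -cabs_sqr; congr EFin; ring.
Qed.

(** The case of two factors in [sobolev]: the square of [econv g g] is integrable. *)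
Lemma conv_fin_ae : {ae mu, forall x, (econv g g x < +oo)%E}.
Proof.
have h := sobolev 1 mg g0 jw_fin.
have mc : measurable_fun setT (econv g g) by exact: measurable_econv.
have ii : mu.-integrable setT (fun x => esq (econv g g x)).
  apply/integrableP; split; first exact: emeasurable_funM.
  by under eq_integral do rewrite gee0_abs ?mule_ge0 ?econv_ge0//.
have := integrable_ae measurableT ii => H; apply: (ae_mono H) => x /(_ I).
have := econv_ge0 (F := g) (G := g) x g0 g0.
by case: (econv g g x) => [r| |] //= _; rewrite ?ltry// /esq mulyy.
Qed.

Lemma conv_CL1 x : (econv g g x < +oo)%E -> CL1 (fun y : R => cmul (w (x - y)) (w y)).
Proof.
move=> h; split.
  by apply: cmeas_mul => //; apply: cmeas_comp => //; exact: mreflect.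
by under eq_integral do rewrite cabsM EFinM.
Qed.

Lemma D_cvg x : (econv g g x < +oo)%E -> D n x @[n --> \oo] --> eabs (cconv w w) x.
Proof.
move=> /conv_CL1 c1; have i1 := CL1_cabs c1.
have mk n : cmeas (fun y : R => cmul (truncf w n (x - y)) (truncf w n y)).
  apply: cmeas_mul; last by case: (nt n).
  by apply: cmeas_comp (mreflect x); case: (nt n).
have bd n y : cabs (cmul (truncf w n (x - y)) (truncf w n y)) <= cabs (cmul (w (x - y)) (w y)).
  by rewrite !cabsM; apply: ler_pM; rewrite ?cabs_ge0// cabs_cut_le.
have nr y : \forall n \near \oo, cmul (truncf w n (x - y)) (truncf w n y) = cmul (w (x - y)) (w y).
  by apply: filterS2 (truncf_near w (x - y)) (truncf_near w y) => n -> ->.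
have c1' : (cconv (truncf w n) (truncf w n) x).1 @[n --> \oo] --> (cconv w w x).1.
  apply: (@Rint_dominated R (fun n (y : R) => (cmul (truncf w n (x - y)) (truncf w n y)).1) _ (fun y : R => cabs (cmul (w (x - y)) (w y)))) => //.
  - by move=> n; case: (mk n).
  - by move=> y; apply: cvg_near_cst; apply: filterS (nr y) => n ->.
  - by move=> n y; apply: le_trans (cabs_re _) (bd n y).
have c2' : (cconv (truncf w n) (truncf w n) x).2 @[n --> \oo] --> (cconv w w x).2.
  apply: (@Rint_dominated R (fun n (y : R) => (cmul (truncf w n (x - y)) (truncf w n y)).2) _ (fun y : R => cabs (cmul (w (x - y)) (w y)))) => //.
  - by move=> n; case: (mk n).
  - by move=> y; apply: cvg_near_cst; apply: filterS (nr y) => n ->.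
  - by move=> n y; apply: le_trans (cabs_im _) (bd n y).
apply: cvg_EFin; first exact: nearW.
rewrite /D /eabs /comp /= /cabs.
apply: (@cvg_comp _ _ _ (fun n => cnorm2 (cconv (truncf w n) (truncf w n) x)) Num.sqrt _ (nbhs (cnorm2 (cconv w w x)))).
  rewrite /cnorm2; apply: cvgD; rewrite expr2; under eq_fun do rewrite expr2; exact: cvgM.
exact: sqrt_continuous.
Qed.

Lemma conv_aligned : {ae mu, forall x, (eabs (cconv w w) x = econv g g x) /\ (econv g g x < +oo)%E}.
Proof.
have [N0 _ hN] := inf_gap0.
have H : {ae mu, forall x, forall k, h_ (N0 + k)%N x = 0%E}.
  by apply/ae_foralln => k; apply: hN => /=; exact: leq_addr.
apply: (ae_mono (ae_and H conv_fin_ae)) => x [hk fin]; split => //.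
have Dc := D_cvg fin.
have Ac : econv (gn n) (gn n) x @[n --> \oo] --> econv g g x by exact: (@epw_trunc_cvg R w 1 x mw).
have gef : econv g g x \is a fin_num by rewrite ge0_fin_numE// econv_ge0.
have Ec : E n x @[n --> \oo] --> (econv g g x - eabs (cconv w w) x)%E.
  by apply: cvgeB => //; rewrite fin_num_adde_defr.
have := cconv_abs x mw mw; rewrite -/g => le1.
(* A positive limit [d] of the gaps would keep them above [d / 2] from some index on, and with them
   a tail infimum known to be 0. *)
apply/eqP; rewrite eq_le le1/= leNgt; apply/negP => lt1.
set d := (econv g g x - eabs (cconv w w) x)%E in Ec.
have d0 : (0 < d)%E by rewrite sube_gt0.
have dfin : d \is a fin_num by rewrite fin_numB gef.
pose r := fine d / 2.
have r0 : 0 < r by rewrite divr_gt0// fine_gt0// d0/= -ge0_fin_numE// ltW.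
have : \forall n \near \oo, (r%:E <= E n x)%E.
  have [/= Ef Er] : (\forall n \near \oo, E n x \is a fin_num) /\ (fine \o (fun n => E n x)) n @[n --> \oo] --> fine d.
    by apply/fine_cvgP; rewrite fineK.
  move/cvgrPdist_lt : Er => /(_ _ r0) Er.
  apply: filterS2 Ef Er => n f1 /=; rewrite ltr_distlC => /andP[h _].
  rewrite -(fineK f1) lee_fin; apply: ltW.
  by have -> : r = fine d - r by rewrite /r; field.
move=> [n1 _ hn1].
have := hk n1; apply/eqP; rewrite gt_eqF//.
apply: (@lt_le_trans _ _ r%:E) => //.
apply: le_ereal_inf_tmp => _ [n /= nn <-]; apply: hn1 => /=.
by rewrite (leq_trans _ nn)// leq_addl.
Qed.

End Extremal.

(** * The minimiser has full Fourier support *)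

Section FullSupport.
Variable R : realType.
Local Notation mu := (@lebesgue_measure R).
Local Notation L1 f := (integrable mu setT (EFin \o f)).
Implicit Types f g h u q : R -> cplx R.

Lemma ae_exists_itv (P : R -> Prop) (x y : R) : {ae mu, forall t, P t} -> x < y ->
  exists2 t, x < t < y & P t.
Proof.
move=> [A [mA A0 PA]] xy; apply: contrapT => nex.
have : (mu `]x, y[ <= mu A)%E.
  apply: le_measure; rewrite ?inE//.
  move=> t /=; rewrite in_itv/= => txy; apply: PA => Pt; apply: nex; exists t => //.
by rewrite A0 lebesgue_measure_itv/= lte_fin xy -EFinD lee_fin leNgt subr_gt0 xy.
Qed.

Lemma esqD_ge (X Y : \bar R) (t : R) : (0 <= X)%E -> (0 <= Y)%E -> 0 <= t ->
  (esq X + t%:E * (X * Y) <= esq (X + t%:E * Y))%E.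
Proof.
move=> X0 Y0 t0; have tY0 : (0 <= t%:E * Y)%E by rewrite mule_ge0.
rewrite /esq (ge0_muleDl _ X0 tY0) (ge0_muleDr X X0 tY0).
by rewrite -addeA leeD2l// muleCA leeDl// mule_ge0// adde_ge0.
Qed.

(** Used with [t ^+ 2] for [t], so that the energy side of the minimality inequality grows by
    [O(t^2)] only. The constant must not depend on [t], hence the restriction to [t <= 1]. *)
Lemma pow_line_bound (a b : R) (k : nat) : 0 <= a -> 0 <= b ->
  exists2 C, 0 <= C & forall t, 0 <= t -> t <= 1 -> (a + t * b) ^+ k <= a ^+ k + t * C.
Proof.
move=> a0 b0; elim: k => [|k [C C0 IH]].
  by exists 0 => // t _ _; rewrite !expr0 mulr0 addr0.
exists (a * C + b * a ^+ k + b * C).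
  by rewrite !addr_ge0// mulr_ge0// exprn_ge0.
move=> t t0 t1; rewrite exprS.
have tb : 0 <= t * b by rewrite mulr_ge0.
apply: (le_trans (ler_wpM2l (addr_ge0 a0 tb) (IH t t0 t1))).
rewrite -subr_ge0 (_ : _ - _ = t * (1 - t) * (b * C)); last by rewrite exprS; ring.
by rewrite !mulr_ge0// subr_ge0.
Qed.

Lemma ge0_intZl (c : \bar R) (F : R -> \bar R) : measurable_fun setT F -> (forall x, (0 <= F x)%E) ->
  (0 <= c)%E -> (\int[mu]_x (c * F x) = c * \int[mu]_x F x)%E.
Proof. by move=> mF F0 c0; apply: ge0_integralZl. Qed.

Section Adjoint.
Variables G A H : R -> \bar R.
Hypotheses (mG : measurable_fun setT G) (mA : measurable_fun setT A) (mH : measurable_fun setT H).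
Hypotheses (G0 : forall x, (0 <= G x)%E) (A0 : forall x, (0 <= A x)%E) (H0 : forall x, (0 <= H x)%E).

(** Correlation with [G], the adjoint of convolution with [G], see [integral_econv_adjoint]. *)
Definition ecorr (y : R) := (\int[mu]_x (G (x - y)%R * A x))%E.

Lemma ecorr_ge0 y : (0 <= ecorr y)%E.
Proof. by apply: integral_ge0 => x _; rewrite mule_ge0. Qed.

Lemma measurable_ecorr : measurable_fun setT ecorr.
Proof.
have mk : measurable_fun setT (fun p : R * R => (G (p.1 - p.2)%R * A p.1)%E).
  have m1 : measurable_fun setT (fun p : R * R => G (p.1 - p.2)%R).
    exact: (measurableT_comp mG (@measurable_sub2 R)).
  have m2 : measurable_fun setT (fun p : R * R => A p.1).
    exact: (measurableT_comp mA measurable_fst).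
  exact: (emeasurable_funM m1 m2).
have k0 (p : R * R) : (0 <= G (p.1 - p.2)%R * A p.1)%E by rewrite mule_ge0.
exact: (measurable_fun_fubini_tonelli_G (m1 := mu) _ mk k0).
Qed.

Lemma integral_econv_adjoint : (\int[mu]_x (A x * econv G H x) = \int[mu]_y (H y * ecorr y))%E.
Proof.
have mk : measurable_fun setT (fun p : R * R => A p.1 * (G (p.1 - p.2)%R * H p.2))%E.
  apply: emeasurable_funM; last exact: emeasurable_conv_kernel.
  exact: (measurableT_comp mA measurable_fst).
have k0 (p : R * R) : (0 <= A p.1 * (G (p.1 - p.2)%R * H p.2))%E by rewrite !mule_ge0.
have /= F := @fubini_tonelli _ _ _ _ R mu mu _ mk k0.
transitivity (\int[mu]_x \int[mu]_y (A x * (G (x - y)%R * H y)))%E.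
  apply: eq_integral => x _.
  have mGx : measurable_fun setT (fun y : R => G (x - y)%R * H y)%E.
    exact: (emeasurable_funM (measurableT_comp mG (mreflect x)) mH).
  have GH0 (y : R) : (0 <= G (x - y)%R * H y)%E by rewrite mule_ge0.
  exact: (esym (ge0_intZl mGx GH0 (A0 x))).
rewrite F; apply: eq_integral => y _.
transitivity (\int[mu]_x (H y * (G (x - y)%R * A x)))%E.
  by apply: eq_integral => x _; rewrite muleA muleC; congr (_ * _)%E; exact: muleC.
have mGx : measurable_fun setT (fun x : R => G (x - y)%R * A x)%E.
  exact: (emeasurable_funM (measurableT_comp mG (mshift (- y))) mA).
have GA0 (x : R) : (0 <= G (x - y)%R * A x)%E by rewrite mule_ge0.
exact: (ge0_intZl mGx GA0 (H0 y)).
Qed.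

End Adjoint.

(** A second use of the adjoint brings out the autocorrelation of [G], whose positivity near the
    diagonal is [corr_pos]. *)
Lemma ecorr_econv (G : R -> \bar R) y : measurable_fun setT G -> (forall x, (0 <= G x)%E) ->
  ecorr G (econv G G) y = (\int[mu]_z (G z * \int[mu]_x (G (x - y)%R * G (x - z)%R)))%E.
Proof.
move=> mG G0.
have mGy (t : R) : measurable_fun setT (fun x : R => G (x - t)%R).
  exact: (measurableT_comp mG (mshift (- t))).
have := @integral_econv_adjoint G (fun x => G (x - y)%R) G mG (mGy y) mG G0 (fun x => G0 _) G0.
rewrite /ecorr => ->; apply: eq_integral => z _; congr (_ * _)%E.
by apply: eq_integral => x _; rewrite muleC.
Qed.

Lemma perturbation_ineq (J t b C : R) (K L : \bar R) : 0 < J -> 0 < t -> (0 <= K)%E -> (0 <= L)%E ->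
  (J%:E * K = b%:E)%E -> (J%:E * (K + t%:E * L) <= (b + t ^+ 2 * C)%:E)%E ->
  (J%:E * L <= (t * C)%:E)%E.
Proof.
move=> J0 t0 K0 L0 JK; rewrite ge0_muleDr//; last by rewrite mule_ge0// lee_fin ltW.
rewrite JK EFinD leeD2lE// muleCA expr2 -mulrA [X in (_ <= X)%E -> _]EFinM lee_pmul2l//.
Qed.

Variables (m : R -> R) (w : R -> cplx R) (sigma : nat) (J : R).
Hypothesis mm : measurable_fun setT m.
Hypothesis m0 : forall x, 0 < m x.
Hypothesis w2 : L2 w.
Hypothesis mw1 : L1 (fun x => m x * cnorm2 (w x)).
Hypothesis wn0 : ~ {ae mu, forall x, w x = (0, 0)}.
Hypothesis J0 : 0 < J.
Let a : R := Rintegral mu setT (fun x => m x * cnorm2 (w x)).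
Let mw : cmeas w. Proof. exact: L2_cmeas. Qed.
Let g := eabs w.
Let mg : measurable_fun setT g. Proof. exact: measurable_eabs. Qed.
Let g0 x : (0 <= g x)%E. Proof. exact: eabs_ge0. Qed.
Let k := (\int[mu]_x esq (epw g sigma.+1 x))%E.
Hypothesis energy_ineq : forall r : R -> R, measurable_fun setT r -> (forall x, 0 <= r x) ->
  L1 (fun x => m x * r x ^+ 2) ->
  (J%:E * \int[mu]_x esq (epw (fun x => (r x)%:E) sigma.+1 x) <=
   ((Rintegral mu setT (fun x => m x * r x ^+ 2)) ^+ sigma.+2)%:E)%E.
Hypothesis energy_eq : (J%:E * k = (a ^+ sigma.+2)%:E)%E.

(** The zero set of [w], cut down so that its indicator has finite quadratic energy. The condition
    [cnorm2 (w x) <= 0] amounts to [w x = 0] and presents the set as an intersection of preimages of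
    half-lines. *)
Definition zbox (n : nat) : set R :=
  [set x | [&& cnorm2 (w x) <= 0, `|x| <= n%:R & m x <= n%:R]].

Lemma measurable_zbox n : measurable (zbox n).
Proof.
have m1 : measurable_fun setT (fun x : R => `|x|) by apply: measurableT_comp => //.
have m2 := measurable_cnorm2 mw.
have -> : zbox n = (setT `&` ((fun x => cnorm2 (w x)) @^-1` `]-oo, 0])) `&`
   ((setT `&` ((fun x : R => `|x|) @^-1` `]-oo, n%:R])) `&` (setT `&` (m @^-1` `]-oo, n%:R]))).
  apply/seteqP; split => x /=.
    by move=> /and3P[? ? ?]; rewrite !in_itv/=.
  by rewrite !in_itv/= => -[[_ h1] [[_ h2] [_ h3]]]; apply/and3P; split.
by apply: measurableI; [exact: m2|apply: measurableI; [exact: m1|exact: mm]].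
Qed.

Let h n x : R := \1_(zbox n) x.
Let mh n : measurable_fun setT (h n).
Proof. exact: measurable_indic (measurable_zbox n). Qed.
Let h0 n x : 0 <= h n x. Proof. by rewrite /h indicE. Qed.
Let he n x := (h n x)%:E.
Let mhe n : measurable_fun setT (he n). Proof. exact/measurable_EFinP. Qed.
Let he0 n x : (0 <= he n x)%E. Proof. by rewrite lee_fin. Qed.

Let wh n x : cabs (w x) * h n x = 0.
Proof.
rewrite /h indicE; case: (boolP (x \in zbox n)); rewrite ?mulr0// => /set_mem/and3P[c0 _ _].
have /eqP : cnorm2 (w x) = 0 by apply/eqP; rewrite eq_le c0 cnorm2_ge0.
by rewrite cnorm2_eq0 => /eqP ->; rewrite cabs0 mul0r.
Qed.

Let mh1 n : L1 (fun x => m x * h n x).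
Proof.
apply: (@le_L1 _ _ (fun x => n%:R * \1_(`[- n%:R, n%:R]) x)).
- exact: measurable_funM.
- move=> x; rewrite ger0_norm ?mulr_ge0 ?(ltW (m0 x))// in_box /h indicE.
  case: (boolP (x \in zbox n)) => [/set_mem/and3P[_ -> mx]|_]; first by rewrite !mulr1.
  by rewrite mulr0 mulr_ge0.
- by apply: L1_scale; exact: L1_box.
Qed.

Let lin_energy n := (\int[mu]_x (epw g sigma.+1 x * iter sigma.+1 (econv g) (he n) x))%E.

Let I0 n x : (0 <= iter sigma.+1 (econv g) (he n) x)%E.
Proof. exact: iter_econv_ge0. Qed.
Let mI n : measurable_fun setT (iter sigma.+1 (econv g) (he n)).
Proof. exact: measurable_iter_econv. Qed.

(* [w] vanishes on [zbox n], so adding [t] times its indicator to [|w|] changes the quadratic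
   form at order [t^2] only, but the convolution energy at order [t]. *)
Lemma first_variation n (t : R) : 0 <= t ->
  (J%:E * (k + t%:E * lin_energy n) <=
   ((a + t ^+ 2 * Rintegral mu setT (fun x => (m x * h n x)%R)) ^+ sigma.+2)%:E)%E.
Proof.
move=> t0.
pose r x := cabs (w x) + t * h n x.
have mr : measurable_fun setT r.
  by apply: measurable_funD; [exact: measurable_cabs|apply: measurable_funM].
have r0 x : 0 <= r x by rewrite addr_ge0 ?cabs_ge0// mulr_ge0.
have re x : m x * r x ^+ 2 = m x * cnorm2 (w x) + t ^+ 2 * (m x * h n x).
  have hh : h n x * h n x = h n x by rewrite /h indicE -natrM mulnb andbb.
  have e : r x ^+ 2 = cabs (w x) ^+ 2 + 2 * t * (cabs (w x) * h n x) + t ^+ 2 * (h n x * h n x).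
    by rewrite /r; ring.
  by rewrite e wh hh cabs_sqr; ring.
have i1 : L1 (fun x => t ^+ 2 * (m x * h n x)) by apply: L1_scale; exact: mh1.
have ir : L1 (fun x => m x * r x ^+ 2).
  by under eq_fun do rewrite re; exact: L1_add.
have re' : Rintegral mu setT (fun x => m x * r x ^+ 2) =
    a + t ^+ 2 * Rintegral mu setT (fun x => m x * h n x).
  rewrite /a -RintegralZl// -RintegralD//.
  by apply: eq_Rintegral => x _; rewrite re.
have := energy_ineq mr r0 ir; rewrite re'; apply: le_trans.
apply: lee_wpmul2l; first by rewrite lee_fin ltW.
have me := measurable_epw sigma.+1 mg g0.
have e0 x := epw_ge0 sigma.+1 x g0.
have mP : measurable_fun setT (fun x => epw g sigma.+1 x * iter sigma.+1 (econv g) (he n) x)%E.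
  exact: emeasurable_funM.
have P0 x : (0 <= epw g sigma.+1 x * iter sigma.+1 (econv g) (he n) x)%E by rewrite mule_ge0.
rewrite /lin_energy -(@ge0_integralZl _ _ R mu setT measurableT)//.
rewrite /k -(@ge0_integralD _ _ R mu setT measurableT)//; last 4 first.
- by move=> x _; exact: esq_ge0.
- exact: measurable_esq.
- by move=> x _; rewrite mule_ge0.
- exact: measurable_funeM.
have mre : measurable_fun setT (fun x => (r x)%:E) by exact/measurable_EFinP.
apply: le_int_ge0.
- apply: emeasurable_funD; [exact: measurable_esq|exact: measurable_funeM].
- by apply: measurable_esq; apply: measurable_epw => // x; rewrite lee_fin.
- by move=> x; rewrite adde_ge0 ?esq_ge0// mule_ge0.
move=> x.
have mth : measurable_fun setT (fun x => (t%:E * he n x)%E) by exact: measurable_funeM.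
have th0 y : (0 <= t%:E * he n y)%E by rewrite mule_ge0.
have le1 : (iter sigma.+1 (econv g) (fun x => g x + t%:E * he n x)%E x <= epw (fun x => (r x)%:E) sigma.+1 x)%E.
  apply: le_iter_econv => //.
  by move=> y; rewrite lee_fin lerDl mulr_ge0.
rewrite (iter_econvD mg g0)// (iter_econvZ mg g0)// -/(epw g sigma.+1) in le1.
rewrite -/(epw g sigma.+1) in le1.
set X := epw g sigma.+1 x in le1 *; set Y := iter _ _ (he n) x in le1 *.
have X0 : (0 <= X)%E by exact: e0.
have Y0 : (0 <= Y)%E by exact: I0.
have tY0 : (0 <= t%:E * Y)%E by rewrite mule_ge0.
apply: le_trans (le_esq _ le1); last by rewrite adde_ge0.
exact: esqD_ge.
Qed.

(** At [t = 0] the inequality of [first_variation] is an equality. Subtracting it and dividing by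
    [t] bounds [J] times [lin_energy n] by [t * C] for every [t] in []0, 1]]. *)
Lemma lin_energy0 n : lin_energy n = 0%E.
Proof.
pose b := Rintegral mu setT (fun x => m x * h n x).
have b0 : 0 <= b by apply: Rintegral_ge0 => x _; rewrite mulr_ge0// ltW.
have a0 : 0 <= a by apply: Rintegral_ge0 => x _; rewrite mulr_ge0 ?cnorm2_ge0// ltW.
have [C C0 hC] := pow_line_bound sigma.+2 a0 b0.
have L0 : (0 <= lin_energy n)%E.
  by apply: integral_ge0 => x _; rewrite mule_ge0// epw_ge0.
have k0 : (0 <= k)%E by apply: integral_ge0 => x _; rewrite esq_ge0// epw_ge0.
have H (t : R) : 0 < t -> t <= 1 -> (J%:E * lin_energy n <= (t * C)%:E)%E.
  move=> t0 t1.
  have t2 : t ^+ 2 <= 1 by rewrite exprn_ile1// ltW.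
  have := first_variation n (ltW t0).
  move=> /le_trans /(_ (_ : (_ <= (a ^+ sigma.+2 + t ^+ 2 * C)%:E)%E)).
  move=> /(_ _)/wrap[|]; first by rewrite lee_fin; apply: hC; rewrite ?sqr_ge0.
  exact: (perturbation_ineq J0 t0 k0 L0 energy_eq).
apply/eqP; rewrite eq_le L0 andbT.
rewrite -(@lee_pmul2l _ J%:E)// ?lte_fin// mule0.
apply/lee_addgt0Pr => e e0; rewrite add0e.
pose t := Num.min 1 (e / (C + 1)).
have C1 : 0 < C + 1 by rewrite ltr_wpDl.
have t0 : 0 < t by rewrite lt_min ltr01 divr_gt0.
apply: le_trans (H t t0 _) _; first by rewrite ge_min lexx.
rewrite lee_fin; apply: (@le_trans _ _ (e / (C + 1) * (C + 1))); last by rewrite divfK ?gt_eqF.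
by apply: ler_pM; rewrite ?(ltW t0)// ?ge_min ?lexx ?orbT// lerDl.
Qed.

Let A := econv g g.
Let A0 x : (0 <= A x)%E. Proof. exact: econv_ge0. Qed.
Let mA : measurable_fun setT A. Proof. exact: measurable_econv. Qed.
Let B n := econv g (he n).
Let B0 n x : (0 <= B n x)%E. Proof. exact: econv_ge0. Qed.
Let mB n : measurable_fun setT (B n). Proof. exact: measurable_econv. Qed.

(** The integrand of [lin_energy n] is the product of iterated convolutions of [A] and [B n], each
    of which dominates that of their minimum; by [int_iter_econv] the minimum has integral 0. *)
Lemma conv_disjoint n : {ae mu, forall x, (A x * B n x = 0)%E}.
Proof.
pose M x := mine (A x) (B n x).
have M0 x : (0 <= M x)%E by rewrite le_min A0 B0.
have mM : measurable_fun setT M by exact: measurable_mine.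
have gp : (0 < \int[mu]_x g x)%E.
  rewrite lt0e integral_ge0// andbT; apply/negP => /eqP gI; apply: wn0.
  by apply: (ae_mono (ae_ge0_int0 mg g0 gI)) => x [/eqP]; rewrite cabs_eq0 => /eqP.
have iM0 := iter_econv_ge0 g0 sigma M0.
have e0 : (\int[mu]_x esq (iter sigma (econv g) M x) = 0)%E.
  apply/eqP; rewrite eq_le integral_ge0 ?andbT; last by move=> x _; exact: esq_ge0.
  rewrite -(lin_energy0 n); apply: le_int_ge0.
  - by apply: measurable_esq; exact: measurable_iter_econv.
  - by apply: emeasurable_funM; [exact: measurable_epw|exact: mI].
  - by move=> x; exact: esq_ge0.
  - move=> x; rewrite epwSr iterSr; apply: lee_pmul => //.
    + by apply: le_iter_econv => // y; rewrite ge_min lexx.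
    + apply: le_iter_econv => //; first exact: mB.
      by move=> y; rewrite ge_min lexx orbT.
have := ae_ge0_int0 mM M0 (int_iter_econv mg g0 mM M0 gp e0).
move=> hM; apply: (ae_mono hM) => x; rewrite /M minEle; case: ifP => _ ->; by rewrite ?mule0 ?mul0e.
Qed.


Lemma tonelli_disjoint n : {ae mu, forall y, (he n y * ecorr g A y = 0)%E}.
Proof.
apply: ae_ge0_int0.
- by apply: emeasurable_funM; [exact: mhe|exact: measurable_ecorr].
- by move=> y; apply: mule_ge0; [exact: he0|exact: ecorr_ge0].
rewrite -integral_econv_adjoint; [|exact: mg|exact: mA|exact: mhe|exact: g0|exact: A0|exact: he0].
by apply: int0_ae_ge0; [apply: emeasurable_funM; [exact: mA|exact: mB]|exact: conv_disjoint].
Qed.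

(** The integral depends on [y - z] only and is at least the autocorrelation of a truncation of
    [|w|], which is continuous at 0 with a positive value there. Hence one [d] serves all points. *)
Lemma corr_pos : exists2 d : R, 0 < d &
  forall y z, `|y - z| < d -> (0 < \int[mu]_x (g (x - y)%R * g (x - z)%R))%E.
Proof.
pose f x : cplx R := (cabs (w x), 0).
have mf : cmeas f by apply: cmeas_pair; [exact: measurable_cabs|].
have f2 : L2 f.
  apply: (le_L2 (f := f) (g := fun x => cnorm2 (w x))) => //; last exact: L2_n2.
  by move=> x; rewrite /f /cnorm2 /= cabs_sqr expr0n addr0.
have n2f : 0 < n2 f.
  rewrite lt_neqAle n2_ge0 andbT; apply/eqP => /esym/(n2_eq0 f2) hf; apply: wn0.
  by apply: (ae_mono hf) => x [/eqP]; rewrite cabs_eq0 => /eqP.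
have cv : n2 (truncf f n) @[n --> \oo] --> n2 f.
  apply: n2_cut_cvg => //; last exact: truncD_near.
  by move=> n; exact: measurable_truncD.
have [n _ /(_ n (leqnn n)) hn] : \forall n \near \oo, 0 < n2 (truncf f n) by exact: cvgr_gt cv _ n2f.
set u := truncf f n in hn.
have nu : nice u by exact: nice_trunc.
have [d d0 hd] := autoc_continuous0 nu (divr_gt0 hn (ltr0n _ 2)).
exists d => // y z yz.
have {}hd : 0 < (autoc u (z - y)).1.
  have := hd (z - y); rewrite distrC => /(_ yz); rewrite ler_distlC => /andP[_ +].
  have lin (p q : R) : 0 < p -> p <= q + p / 2 -> 0 < q by lra.
  exact: lin.
have u1 x : (u x).2 = 0 /\ 0 <= (u x).1 <= cabs (w x).
  by rewrite /u /truncf /cutf; case: (boolP (x \in _)) => _ /=; rewrite ?cabs_ge0 ?lexx.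
rewrite autoc_re// in hd.
have nus : nice (fun x => u (x + (z - y))).
  have [mu1 [M [M0 uM uM0]]] := nu; split; first exact: cmeas_comp (mshift _).
  exists (M + `|z - y|); split.
  - by rewrite ltr_pwDl.
  - by move=> x; rewrite (le_trans (uM _))// lerDl.
  - move=> x; rewrite -ltrBrDr => hx; apply: uM0; apply: (lt_le_trans hx).
    by have := ler_normB (x + (z - y)) (z - y); rewrite addrK lerBlDr.
have iu : L1 (fun x => cdot (u (x + (z - y))) (u x)).
  by apply: L2_dot; exact: nice_L2.
have e : (\int[mu]_x (g (x - y)%R * g (x - z)%R) = \int[mu]_x (g (x + (z - y))%R * g x))%E.
  rewrite -[RHS](@ge0_int_preserving R (fun x => x - z)%R (mshift (- z)) (leb_shift (- z)) (fun x => g (x + (z - y))%R * g x)%E).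
  - by apply: eq_integral => x _; rewrite (_ : x - z + (z - y) = x - y)//; ring.
  - by apply: emeasurable_funM => //; apply: (measurableT_comp mg); exact: (mshift (z - y)).
  - by move=> x; rewrite mule_ge0.
rewrite e; apply: (@lt_le_trans _ _ (Rintegral mu setT (fun x => cdot (u (x + (z - y))) (u x)))%:E).
  by rewrite lte_fin.
rewrite ge0_Rint_EFin//; apply: le_int_ge0.
- by apply/measurable_EFinP; exact: (L1_measurable iu).
- by apply: emeasurable_funM => //; apply: (measurableT_comp mg); exact: (mshift (z - y)).
- move=> x; rewrite lee_fin /cdot.
  have [-> /andP[h1 _]] := u1 (x + (z - y)); have [-> /andP[h2 _]] := u1 x.
  by rewrite mulr0 addr0 mulr_ge0.
- move=> x; rewrite -EFinM lee_fin /cdot.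
  have [-> /andP[h1 h1']] := u1 (x + (z - y)); have [-> /andP[h2 h2']] := u1 x.
  by rewrite mulr0 addr0 ler_pM.
Qed.

(* [lin_energy n = 0] forces [g * g] and [g * 1_zbox] to have disjoint supports; undoing the
   convolutions, [g(z) * int g(x - y) g(x - z) dx = 0] for almost every [y] in [zbox n], where the
   integral is positive for [z] close to [y]. *)
Lemma zero_locality : exists2 d : R, 0 < d &
  {ae mu, forall y, w y = (0, 0) -> {ae mu, forall z, `|y - z| < d -> w z = (0, 0)}}.
Proof.
have [d d0 hd] := corr_pos; exists d => //.
have /ae_foralln H := tonelli_disjoint.
apply: (ae_mono H) => y hy wy.
have [n yn] : exists n, zbox n y.
  exists (maxn (Num.truncn `|y|).+1 (Num.truncn (m y)).+1).
  rewrite /zbox /= wy; apply/and3P; split.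
  - by rewrite /cnorm2 /= expr0n addr0.
  - by rewrite (le_trans (ltW (truncnS_gt _)))// ler_nat leq_maxl.
  - by rewrite (le_trans (ltW (truncnS_gt _)))// ler_nat leq_maxr.
have := hy n; rewrite /he /h indicE mem_set// mul1e ecorr_econv//.
move/ae_ge0_int0 => H'; apply: (ae_mono (H' _ _)).
- apply: emeasurable_funM => //.
  have mGG : measurable_fun setT (fun x : R => g (x - y)%R) by exact: (measurableT_comp mg (mshift (- y))).
  have -> : (fun z => \int[mu]_x (g (x - y)%R * g (x - z)%R))%E = ecorr g (fun x => g (x - y)%R).
    by apply/funext => z; apply: eq_integral => x _; exact: muleC.
  exact: (measurable_ecorr mg mGG).
- by move=> z; rewrite mule_ge0// integral_ge0// => x _; rewrite mule_ge0.
move=> z /eqP; rewrite mule_eq0 => /orP[/eqP gz _|/eqP gz yz].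
  by move: gz => [/eqP]; rewrite cabs_eq0 => /eqP.
by have := hd y z yz; rewrite gz ltxx.
Qed.

(** If the zero set is not null, it contains a point around which [w] vanishes almost everywhere; as
    [d] does not depend on the point, the vanishing spreads over the whole line, against [wn0]. *)
Theorem full_support : {ae mu, forall x, w x <> (0, 0)}.
Proof.
have [d d0 H] := zero_locality.
have [//|nex] := pselect {ae mu, forall x, w x <> (0, 0)}.
pose good y := {ae mu, forall z, `|y - z| < d -> w z = (0, 0)}.
have [y0 wy0 gy0] : exists2 y, w y = (0, 0) & good y.
  apply: contrapT => hn; apply: nex; apply: (ae_mono H) => y hy wy.
  by apply: hn; exists y => //; exact: hy.
exfalso; apply: wn0.
have hd2 : 0 < d / 2 by rewrite divr_gt0.
have prop i : {ae mu, forall z, `|y0 - z| < d + i%:R * (d / 2) -> w z = (0, 0)}.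
  elim: i => [|i IH]; first by apply: (ae_mono gy0) => z; rewrite mul0r addr0.
  set r := d + i%:R * (d / 2) in IH.
  have r0 : d <= r by rewrite lerDl mulr_ge0// ltW.
  have HI := ae_and H IH.
  (* Zeros of [w] to which [zero_locality] applies, within [d / 2] of each end of the current
     interval; their [d]-neighbourhoods increase the radius by [d / 2]. *)
  have [y1 /andP[y11 y12] [/= gy1 wy1]] := @ae_exists_itv _ (y0 + r - d / 2) (y0 + r) HI ltac:(by rewrite ltrBlDr ltrDl).
  have [y2 /andP[y21 y22] [/= gy2 wy2]] := @ae_exists_itv _ (y0 - r) (y0 - r + d / 2) HI ltac:(by rewrite ltrDl).
  have w1 : w y1 = (0, 0) by apply: wy1; rewrite ltr_norml; apply/andP; split; lra.
  have w2' : w y2 = (0, 0) by apply: wy2; rewrite ltr_norml; apply/andP; split; lra.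
  apply: (ae_mono (ae_and IH (ae_and (gy1 w1) (gy2 w2')))) => z [h1 [h2 h3]].
  rewrite -natr1 mulrDl mul1r addrA -/r ltr_norml => /andP[z1 z2].
  have [zr|zr] := ltP `|y0 - z| r; first exact: h1.
  have [z0|z0] := leP y0 z.
    by apply: h2; move: zr; rewrite ler0_norm ?subr_le0// ltr_norml => zr; apply/andP; split; lra.
  by apply: h3; move: zr; rewrite ger0_norm ?subr_ge0 ?(ltW z0)// ltr_norml => zr; apply/andP; split; lra.
have /ae_foralln P := prop.
apply: (ae_mono P) => z hz.
apply: (hz (Num.truncn (`|y0 - z| / (d / 2))).+1).
apply: (@lt_le_trans _ _ ((Num.truncn (`|y0 - z| / (d / 2))).+1%:R * (d / 2))).
  by rewrite -ltr_pdivrMr// truncnS_gt.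
by rewrite lerDr ltW.
Qed.

End FullSupport.

(** * Measurable characters of the line *)

Section ContinuousCharacter.
Variable R : realType.
Local Notation mu := (@lebesgue_measure R).
Implicit Types f : R -> R.

Lemma continuous_integrable_itv f (a b : R) : continuous f ->
  mu.-integrable `[a, b] (EFin \o f).
Proof.
by move=> cf; apply: continuous_compact_integrable; [exact: segment_compact|exact: continuous_subspaceT].
Qed.

Lemma Rint_itv_shift f (b y : R) : continuous f ->
  Rintegral mu `]0, b] (fun x => f (x + y)) = Rintegral mu `]y, (b + y)] f.
Proof.
move=> cf; rewrite Rintegral_mkcond [RHS]Rintegral_mkcond.
have mf : measurable_fun setT (f \_ `]y, (b + y)]).
  apply/measurable_restrict => //; apply: measurable_funTS; exact: continuous_measurable_fun.
rewrite -[RHS](@Rint_preserving R (fun x => x + y) (mshift y) (leb_shift y))//.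
apply: eq_Rintegral => x _; rewrite /patch !mem_setE !in_itv/=.
by rewrite ltrDr lerD2r.
Qed.

Lemma is_derive_moving_itv f (b : R) : continuous f -> 0 < b ->
  is_derive (0 : R) 1 (fun y => Rintegral mu `]0, b] (fun x => f (x + y))) (f b - f 0).
Proof.
move=> cf b0.
(* The base point -1 lies strictly to the left of both 0 and [b], where [F] has to be
   differentiated. *)
pose F (y : R) := Rintegral mu `]-1, y] f.
have dF (y : R) : -1 < y -> is_derive y (1 : R) F (f y).
  move=> y1; have [] := @continuous_FTC1 R f (BRight (-1)) y (y + 1) _ _ _ (cf y).
  - by rewrite ltrDl.
  - by apply: integrableS (continuous_integrable_itv (-1) (y + 1) cf) => //; apply: subset_itvr; rewrite bnd_simp.
  - exact: y1.
  move=> d e; rewrite derive1E in e; exact: (DeriveDef d e).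
have db : is_derive (0 : R) 1 (fun y => F (b + y)) (f b).
  have h : is_derive (b + 0 : R) 1 F (f b) by rewrite addr0; apply: dF; rewrite (lt_trans _ b0).
  have hg : is_derive (0 : R) 1 (fun y => b + y) 1.
    by rewrite -[X in is_derive _ _ _ X](add0r 1); apply: (@is_deriveD _ _ _ (cst b) id).
  by rewrite -[f b]mulr1; apply: (@is_derive1_comp R F (fun y => b + y) 0 (f b) 1 h hg).
have d0 : is_derive (0 : R) 1 (fun y => F (b + y) - F y) (f b - f 0).
  by apply: is_deriveB => //; apply: dF.
apply: near_eq_is_derive d0.
near=> y; rewrite Rint_itv_shift// /F.
have y1 : -1 < y by near: y; apply: lt_nbhsr; rewrite ltrN10.
apply: Rintegral_itvB.
- by apply: integrableS (continuous_integrable_itv (-1) (b + y) cf) => //; apply: subset_itvr; rewrite bnd_simp.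
- by rewrite bnd_simp ltW.
- by rewrite bnd_simp lerDr ltW.
Unshelve. all: by end_near. Qed.

Variables X Y : R -> R.
Hypotheses (cX : continuous X) (cY : continuous Y).
Hypothesis XY1 : forall x, X x ^+ 2 + Y x ^+ 2 = 1.
Hypothesis XD : forall x y, X (x + y) = X x * X y - Y x * Y y.
Hypothesis YD : forall x y, Y (x + y) = X x * Y y + Y x * X y.

Lemma character0 : X 0 = 1 /\ Y 0 = 0.
Proof.
have e1 := XD 0 0; have e2 := YD 0 0; have e3 := XY1 0; rewrite addr0 in e1 e2.
have y0 : Y 0 = 0.
  have h : Y 0 * (2 * X 0 - 1) = 0.
    have -> : Y 0 * (2 * X 0 - 1) = (X 0 * Y 0 + Y 0 * X 0) - Y 0 by ring.
    by rewrite -e2 subrr.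
  move/eqP: h; rewrite mulf_eq0 => /orP[/eqP//|/eqP h].
  have x0 : X 0 = 1 / 2 by lra.
  have : Y 0 ^+ 2 = - (1 / 4) by rewrite expr2; rewrite x0 in e1; lra.
  by move=> h2; have := sqr_ge0 (Y 0); rewrite h2; lra.
split => //; rewrite y0 mulr0 subr0 in e1; rewrite y0 in e3.
have : X 0 * X 0 = 1 by rewrite -expr2 -e3 expr0n addr0.
by rewrite -e1.
Qed.

(* Integrating the functional equation over [[0, b]] expresses [X] and [Y] through moving-endpoint
   integrals of themselves. *)
Lemma character_derive0 : exists p q : R, is_derive (0 : R) 1 X p /\ is_derive (0 : R) 1 Y q.
Proof.
have [X0 Y0] := character0.
(* On a short interval [X] stays above [1 / 2], which makes [I] positive; then the linear system of
   determinant [I^2 + K^2] that expresses [U] and [V] by [X] and [Y] can be inverted. *)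
have [d /= d0 hd] : \forall x \near (0 : R), 1 / 2 < X x.
  have cX0 : X x @[x --> (0 : R)] --> X 0 by exact: cX.
  by apply: (cvgr_gt _ cX0); rewrite X0; lra.
pose b := d / 2; have b0 : 0 < b by rewrite divr_gt0.
have iX : mu.-integrable `]0, b] (EFin \o X).
  by apply: integrableS (continuous_integrable_itv 0 b cX) => //; apply: subset_itvr; rewrite bnd_simp.
have iY : mu.-integrable `]0, b] (EFin \o Y).
  by apply: integrableS (continuous_integrable_itv 0 b cY) => //; apply: subset_itvr; rewrite bnd_simp.
pose I := Rintegral mu `]0, b] X; pose K := Rintegral mu `]0, b] Y.
have I0 : 0 < I.
  apply: (@lt_le_trans _ _ (Rintegral mu `]0, b] (cst (1 / 2)))).
    rewrite Rintegral_cst//= lebesgue_measure_itv/= lte_fin b0 -EFinD/= subr0.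
    by rewrite mulr_gt0// divr_gt0.
  apply: le_Rintegral => //.
  - by apply: integrableS (continuous_integrable_itv 0 b (fun x : R => @cst_continuous R R (1 / 2) x)) => //; apply: subset_itvr; rewrite bnd_simp.
  - move=> x; rewrite /= in_itv/= => /andP[x0 xb]; apply: ltW; apply: hd.
    by rewrite /= sub0r normrN gtr0_norm// (le_lt_trans xb)// ltr_pdivrMr// ltr_pMr// ltr1n.
pose U (y : R) := Rintegral mu `]0, b] (fun x => X (x + y)).
pose V (y : R) := Rintegral mu `]0, b] (fun x => Y (x + y)).
have iM (Z : R -> R) c : continuous Z -> mu.-integrable `]0, b] (EFin \o (fun x => Z x * c)).
  move=> cZ; apply: integrableS (continuous_integrable_itv 0 b (_ : continuous (fun x => Z x * c))) => //.
  - by apply: subset_itvr; rewrite bnd_simp.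
  - by move=> x; apply: continuousM; [exact: cZ|exact: cst_continuous].
have UE y : U y = I * X y - K * Y y.
  rewrite /U /I /K; under eq_Rintegral do rewrite XD.
  rewrite (@RintegralB _ _ _ mu _ _ _ (measurable_itv _) (iM X _ cX) (iM Y _ cY)).
  by rewrite !RintegralZr.
have VE y : V y = I * Y y + K * X y.
  rewrite /V /I /K; under eq_Rintegral do rewrite YD.
  rewrite (@RintegralD _ _ _ mu _ _ _ (measurable_itv _) (iM X (Y y) cX) (iM Y (X y) cY)).
  by rewrite !RintegralZr.
have dU := is_derive_moving_itv cX b0.
have dV := is_derive_moving_itv cY b0.
have D0 : I ^+ 2 + K ^+ 2 != 0 by rewrite gt_eqF// ltr_wpDr ?sqr_ge0// exprn_gt0.
have XE : X = (fun y => (I / (I ^+ 2 + K ^+ 2)) * U y + (K / (I ^+ 2 + K ^+ 2)) * V y).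
  by apply/funext => y; rewrite UE VE; field.
have YE : Y = (fun y => (I / (I ^+ 2 + K ^+ 2)) * V y - (K / (I ^+ 2 + K ^+ 2)) * U y).
  by apply/funext => y; rewrite UE VE; field.
eexists; eexists; split.
- rewrite [X in is_derive _ _ X]XE; apply: is_deriveD; exact: is_deriveZ.
- rewrite [X in is_derive _ _ X]YE; apply: is_deriveB; exact: is_deriveZ.
Qed.

Lemma continuous_character : exists q : R, forall x, X x = cos (q * x) /\ Y x = sin (q * x).
Proof.
have [X0 Y0] := character0; have [p [q [dX0 dY0]]] := character_derive0.
have sh (Z : R -> R) (d x : R) : is_derive (0 : R) 1 Z d -> is_derive x 1 (fun y => Z (y - x)) d.
  move=> h; have h' : is_derive (x - x : R) 1 Z d by rewrite subrr.
  have hg : is_derive x 1 (fun y : R => y - x) 1 by apply: is_derive_eq; rewrite oppr0 addr0.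
  by rewrite -[d]mulr1; apply: (@is_derive1_comp R Z (fun y => y - x) x d 1 h' hg).
have dX (x : R) : is_derive x (1 : R) X (X x * p - Y x * q).
  have -> : X = (fun y => X x * X (y - x) - Y x * Y (y - x)).
    by apply/funext => y; rewrite -XD addrC subrK.
  by rewrite subrr X0 Y0 mulr1 mulr0 subr0; apply: is_deriveB; apply: is_deriveZ; exact: sh.
have dY (x : R) : is_derive x (1 : R) Y (X x * q + Y x * p).
  have -> : Y = (fun y => X x * Y (y - x) + Y x * X (y - x)).
    by apply/funext => y; rewrite -YD addrC subrK.
  by rewrite subrr X0 Y0 mulr1 mulr0 add0r; apply: is_deriveD; apply: is_deriveZ; exact: sh.
(* Differentiate [X^2 + Y^2 = 1] at 0. *)
have p0 : p = 0.
  have : is_derive (0 : R) 1 (fun x => X x ^+ 2 + Y x ^+ 2) (2 * p).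
    apply: is_derive_eq; rewrite X0 Y0 /GRing.scale/=; ring.
  rewrite (_ : (fun x => _) = cst 1); last by apply/funext => x; rewrite XY1.
  move=> h; have := @derive_val _ _ _ _ _ _ _ h; rewrite derive_cst => h2.
  have lin (z : R) : 0 = 2 * z -> z = 0 by lra.
  exact: lin.
(* Real and imaginary parts of [(X + i Y) e^(- i q x)], whose derivative vanishes. *)
pose A (x : R) := X x * cos (q * x) + Y x * sin (q * x).
pose B (x : R) := Y x * cos (q * x) - X x * sin (q * x).
have dqx (x : R) : is_derive x 1 (fun x => q * x) q.
  by apply: is_derive_eq; rewrite /GRing.scale/= mulr1.
have dc (x : R) : is_derive x 1 (fun x => cos (q * x)) (- sin (q * x) * q).
  exact: (@is_derive1_comp R cos (fun x => q * x)).
have ds (x : R) : is_derive x 1 (fun x => sin (q * x)) (cos (q * x) * q).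
  exact: (@is_derive1_comp R sin (fun x => q * x)).
have AE x : A x = 1.
  have dA (y : R) : is_derive y (1 : R) A 0.
    by apply: is_derive_eq; rewrite p0 /GRing.scale/=; ring.
  have e : A x = A 0 by exact: is_derive_0_is_cst.
  by rewrite e /A X0 Y0 mulr0 cos0 sin0; ring.
have BE x : B x = 0.
  have dB (y : R) : is_derive y (1 : R) B 0.
    by apply: is_derive_eq; rewrite p0 /GRing.scale/=; ring.
  have e : B x = B 0 by exact: is_derive_0_is_cst.
  by rewrite e /B X0 Y0 mulr0 cos0 sin0; ring.
exists q => x; have := AE x; have := BE x; have := cos2Dsin2 (q * x).
rewrite /A /B; set c := cos _; set s := sin _ => cs b a.
split.
- rewrite -[LHS]mulr1 -cs (_ : _ * _ = (X x * c + Y x * s) * c - (Y x * c - X x * s) * s); last by ring.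
  by rewrite a b; ring.
- rewrite -[LHS]mulr1 -cs (_ : _ * _ = (X x * c + Y x * s) * s + (Y x * c - X x * s) * c); last by ring.
  by rewrite a b; ring.
Qed.

End ContinuousCharacter.

(** * From an aligned convolution square to an affine phase *)

Section Phase.
Variable R : realType.
Local Notation mu := (@lebesgue_measure R).
Local Notation L1 f := (integrable mu setT (EFin \o f)).
Implicit Types f g h u q : R -> cplx R.

Lemma continuous_ae_eq (f g : R -> R) : continuous f -> continuous g ->
  {ae mu, forall x, f x = g x} -> forall x, f x = g x.
Proof.
move=> cf cg H x; apply/eqP; rewrite -subr_eq0; apply/negPn/negP => n0.
have c : f y - g y @[y --> x] --> f x - g x by apply: cvgB; [exact: cf|exact: cg].
have p : 0 < `|f x - g x| by rewrite normr_gt0.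
move/cvgrPdist_lt : c => /(_ _ p) [d /= d0 hd].
have [t /andP[t1 t2] ft] := @ae_exists_itv R _ x (x + d) H ltac:(by rewrite ltrDl).
have := hd t; rewrite /= ft subrr subr0 ltxx => /(_ _)/negP; apply => //.
by rewrite distrC ger0_norm ?subr_ge0 ?(ltW t1)// ltrBlDl.
Qed.

Lemma ae_eq_Rint (f g : R -> R) : measurable_fun setT f -> measurable_fun setT g ->
  {ae mu, forall x, f x = g x} -> Rintegral mu setT f = Rintegral mu setT g.
Proof.
move=> mf mg H; congr fine; apply: ae_eq_integral => //; try exact/measurable_EFinP.
by apply: (ae_mono H) => x /= -> _.
Qed.

Lemma ae_eq_Cint f g : cmeas f -> cmeas g -> {ae mu, forall x, f x = g x} -> Cint f = Cint g.
Proof.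
move=> [f1 f2] [g1 g2] H; rewrite /Cint; congr pair; apply: ae_eq_Rint => //.
- by apply: (ae_mono H) => x ->.
- by apply: (ae_mono H) => x ->.
Qed.

Lemma measurable_invr_comp (f : R -> R) : measurable_fun setT f ->
  measurable_fun setT (fun x => (f x)^-1).
Proof.
move=> mf; have -> : (fun x => (f x)^-1) = (fun x => f x * (f x ^+ 2) `^ (- 1)).
  apply/funext => x; have [->|n0] := eqVneq (f x) 0; first by rewrite invr0 mul0r.
  by rewrite powR_inv1 ?sqr_ge0// expr2 invfM mulrA mulfV// mul1r.
apply: measurable_funM => //; apply: mpowR; exact: measurable_funX.
Qed.

(** Tonelli: the two iterated integrals of the nonnegative [H] vanish together. *)
Lemma ae_swap (H : R * R -> R) : measurable_fun setT H -> (forall z, 0 <= H z) ->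
  {ae mu, forall x, {ae mu, forall y, H (x, y) = 0}} ->
  {ae mu, forall y, {ae mu, forall x, H (x, y) = 0}}.
Proof.
move=> mH H0 aeH.
have mE : measurable_fun setT (EFin \o H) by exact/measurable_EFinP.
have E0 z : (0 <= (EFin \o H) z)%E by rewrite lee_fin.
have F := @fubini_tonelli _ _ _ _ R mu mu _ mE E0.
have mF := @measurable_fun_fubini_tonelli_F _ _ _ _ R mu _ mE E0.
have mG := @measurable_fun_fubini_tonelli_G _ _ _ _ R mu _ mE E0.
have z : (\int[mu]_x fubini_F mu (EFin \o H) x = 0)%E.
  apply: int0_ae_ge0 => //; apply: (ae_mono aeH) => x hx.
  apply: int0_ae_ge0; first by apply/measurable_EFinP; exact: measurableT_comp.
  by apply: (ae_mono hx) => y /= ->.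
have z' : (\int[mu]_y fubini_G mu (EFin \o H) y = 0)%E by rewrite -z [RHS]F.
have G0 y : (0 <= fubini_G mu (EFin \o H) y)%E by apply: integral_ge0 => x _; exact: (E0 (x, y)).
have h := ae_ge0_int0 mG G0 z'.
apply: (ae_mono h) => y hy.
have my : measurable_fun setT (fun x => (H (x, y))%:E).
  by apply/measurable_EFinP; exact: measurableT_comp.
by apply: (ae_mono (ae_ge0_int0 my (fun x => E0 (x, y)) hy)) => x [].
Qed.

Section MeasurableCharacter.
Variable psi : R -> cplx R.
Hypothesis mpsi : cmeas psi.
Hypothesis psi_le1 : forall x, cabs (psi x) <= 1.
Hypothesis psi1 : {ae mu, forall x, cabs (psi x) = 1}.
Hypothesis psiD : {ae mu, forall y, {ae mu, forall x, psi (x + y) = cmul (psi x) (psi y)}}.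

Let k : R -> cplx R := cutf `[0, 1] (fun x => cconj (psi x)).

Let nk : nice k.
Proof.
split; first by apply: cmeas_cut => //; exact: cmeas_conj.
exists 1; split => // x.
- by apply: le_trans (cabs_cut_le _ _ _) _; rewrite cabs_conj.
- move=> x1; rewrite /k /cutf mem_setE in_itv/=; case: ifP => // /andP[x0 x2].
  by move: x1; rewrite ger0_norm// ltNge x2.
Qed.
Let mk : cmeas k. Proof. by case: nk. Qed.

Let Cint_k : Cint (fun x => cmul (k x) (psi x)) = (1, 0).
Proof.
have e : Cint (fun x => cmul (k x) (psi x)) = Cint (fun x => (\1_(`[0, 1]%classic : set R) x, 0)).
  apply: ae_eq_Cint; first exact: cmeas_mul.
  - by apply: cmeas_pair => //; exact: measurable_indic.
  - apply: (ae_mono psi1) => x hx; rewrite /k /cutf indicE.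
    case: (boolP (x \in _)) => _; last by rewrite cmul0.
    by rewrite cmulconj -cabs_sqr hx expr1n.
rewrite e /Cint /=; congr pair; last by rewrite Rintegral_cst// mul0r.
by rewrite /Rintegral integral_indic//= setIT lebesgue_measure_itv/= lte_fin ltr01 -EFinD subr0.
Qed.

(* Pairing [psi (x + y) = psi x psi y] with [k = conj psi 1_[0,1]] yields a continuous
   representative [chi] of [psi]. *)
Let chi y := Cint (fun x : R => cmul (k (x - y)) (psi x)).

Let mks (y : R) : cmeas (fun x : R => k (x - y)).
Proof. exact: cmeas_comp (mshift (- y)). Qed.

Let ik (y : R) : CL1 (fun x : R => k (x - y)).
Proof.
split; first exact: mks.
rewrite (@ge0_int_preserving R (fun x => x - y) (mshift (- y)) (leb_shift (- y)) (fun x => (cabs (k x))%:E)).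
- by case: (nice_CL1 nk).
- exact: emeasurable_cabs.
- by move=> x; rewrite lee_fin cabs_ge0.
Qed.

Let ikp y : CL1 (fun x : R => cmul (k (x - y)) (psi x)).
Proof.
apply: (@le_CL1 _ _ (fun x : R => cabs (k (x - y)))); first exact: cmeas_mul.
- by move=> x; rewrite cabsM ler_piMr ?cabs_ge0.
- exact: CL1_cabs.
Qed.

Let chi_psi : {ae mu, forall y, chi y = psi y}.
Proof.
apply: (ae_mono psiD) => y hy.
have ms : cmeas (fun x : R => psi (x + y)) by exact: cmeas_comp (mshift y).
transitivity (Cint (fun x : R => cmul (k x) (psi (x + y)))).
  rewrite -(@Cint_preserving R (fun x => x - y) (mshift (- y)) (leb_shift (- y))); last exact: cmeas_mul.
  by apply: eq_Cint => x; rewrite subrK.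
transitivity (Cint (fun x : R => cmul (psi y) (cmul (k x) (psi x)))).
  apply: ae_eq_Cint.
  - exact: cmeas_mul.
  - by apply: cmeas_mul; [exact: cmeas_cst|exact: cmeas_mul].
  - by apply: (ae_mono hy) => x ->; rewrite cmulA cmulC.
rewrite Cint_cmul; first by rewrite Cint_k cmulC cmul1.
by have := ikp 0; congr CL1; apply/funext => x; rewrite subr0.
Qed.

(** As [psi] has modulus at most 1, the increment of [chi] is bounded by the [L^1] distance of two
    translates of [k]. *)
Let chi_continuous (y0 eta : R) : 0 < eta ->
  exists2 d, 0 < d & forall y, `|y0 - y| < d -> cabs (csub (chi y) (chi y0)) <= eta.
Proof.
move=> eta0; have [[k1 k2] [M [M0 kM kM0]]] := nk.
have e2 : 0 < eta / 2 by rewrite divr_gt0.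
have [d1 d10 h1] := L1_translation k1 M0 (fun x => le_trans (cabs_re _) (kM x))
  (fun x xM => f_equal fst (kM0 x xM)) e2.
have [d2 d20 h2] := L1_translation k2 M0 (fun x => le_trans (cabs_im _) (kM x))
  (fun x xM => f_equal snd (kM0 x xM)) e2.
exists (Num.min d1 d2); first by rewrite lt_min d10 d20.
move=> y; rewrite lt_min => /andP[y1 y2].
rewrite -Cint_sub// -lee_fin.
have mD : cmeas (fun x : R => csub (cmul (k (x - y)) (psi x)) (cmul (k (x - y0)) (psi x))).
  by apply: cmeas_sub; exact: cmeas_mul.
apply: le_trans (cabs_Cint mD) _.
have msh (f : R -> R) (t : R) : measurable_fun setT f -> measurable_fun setT (fun x : R => (`|f (x + t) - f x|)%:E).
  move=> mf; apply/measurable_EFinP; apply: measurableT_comp => //; apply: measurable_funB => //.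
  exact: measurableT_comp mf (mshift t).
have msh' (f : R -> R) (t : R) : measurable_fun setT f -> measurable_fun setT (fun x : R => (`|f (x - y) - f (x - y0)|)%:E).
  move=> mf; apply/measurable_EFinP; apply: measurableT_comp => //; apply: measurable_funB.
  - exact: measurableT_comp mf (mshift (- y)).
  - exact: measurableT_comp mf (mshift (- y0)).
have sh (f : R -> R) : measurable_fun setT f ->
    (\int[mu]_x (`|f (x - y)%R - f (x - y0)%R|)%:E = \int[mu]_x (`|f (x + (y0 - y))%R - f x|)%:E)%E.
  move=> mf.
  rewrite -(@ge0_int_preserving R (fun x => x - y0) (mshift (- y0)) (leb_shift (- y0)) (fun x => (`|f (x + (y0 - y))%R - f x|)%:E)).
  - by apply: eq_integral => x _; rewrite (_ : x - y0 + (y0 - y) = x - y)//; ring.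
  - exact: msh.
  - by move=> x; rewrite lee_fin.
apply: (@le_trans _ _ (\int[mu]_x ((`|(k (x - y)%R).1 - (k (x - y0)%R).1|)%:E + (`|(k (x - y)%R).2 - (k (x - y0)%R).2|)%:E))%E).
  apply: le_int_ge0.
  - exact: emeasurable_cabs.
  - by apply: emeasurable_funD; [exact: (msh' (fun x => (k x).1))|exact: (msh' (fun x => (k x).2))].
  - by move=> x; rewrite lee_fin cabs_ge0.
  - move=> x; rewrite -EFinD lee_fin.
    rewrite (_ : csub _ _ = cmul (csub (k (x - y)) (k (x - y0))) (psi x)); last by rewrite /csub /cmul /=; congr pair; ring.
    rewrite cabsM; apply: le_trans (cabs_le (csub _ _)).
    by rewrite ler_piMr ?cabs_ge0.
rewrite (@ge0_integralD _ _ R mu setT measurableT); last 4 first.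
- by move=> x _; rewrite lee_fin.
- exact: (msh' (fun x => (k x).1)).
- by move=> x _; rewrite lee_fin.
- exact: (msh' (fun x => (k x).2)).
rewrite (sh (fun x => (k x).1))// (sh (fun x => (k x).2))//.
have -> : eta%:E = ((eta / 2)%:E + (eta / 2)%:E)%E by rewrite -EFinD -splitr.
by apply: leeD; [exact: h1|exact: h2].
Qed.

Let c1 : continuous (fun y => (chi y).1).
Proof.
move=> y0; apply/cvgrPdist_le => e e0; have [d d0 hd] := chi_continuous y0 e0.
exists d => //= y yd; rewrite distrC.
exact: le_trans (cabs_re (csub (chi y) (chi y0))) (hd y yd).
Qed.

Let c2 : continuous (fun y => (chi y).2).
Proof.
move=> y0; apply/cvgrPdist_le => e e0; have [d d0 hd] := chi_continuous y0 e0.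
exists d => //= y yd; rewrite distrC.
exact: le_trans (cabs_im (csub (chi y) (chi y0))) (hd y yd).
Qed.

Lemma measurable_character : exists q : R, {ae mu, forall x, psi x = cexpi (q * x)}.
Proof.
have n1 : forall x, (chi x).1 ^+ 2 + (chi x).2 ^+ 2 = 1.
  apply: (@continuous_ae_eq _ (cst 1)).
  - by move=> x; apply: cvgD; apply: cvgM; [exact: c1|exact: c1|exact: c2|exact: c2].
  - exact: cst_continuous.
  - apply: (ae_mono (ae_and chi_psi psi1)) => x [-> h].
    by rewrite /= -[LHS]/(cnorm2 (psi x)) -cabs_sqr h expr1n.
have cs1 (y : R) : continuous (fun x : R => (chi (x + y)).1).
  move=> x; apply: (@continuous_comp _ _ _ (fun x : R => x + y) (fun y => (chi y).1)); last exact: c1.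
  by apply: cvgD; [exact: cvg_id|exact: cvg_cst].
have cs2 (y : R) : continuous (fun x : R => (chi (x + y)).2).
  move=> x; apply: (@continuous_comp _ _ _ (fun x : R => x + y) (fun y => (chi y).2)); last exact: c2.
  by apply: cvgD; [exact: cvg_id|exact: cvg_cst].
have cc1 (z : cplx R) : continuous (fun x => (chi x).1 * z.1 - (chi x).2 * z.2).
  by move=> x; apply: cvgB; apply: cvgM; [exact: c1|exact: cvg_cst|exact: c2|exact: cvg_cst].
have cc2 (z : cplx R) : continuous (fun x => (chi x).1 * z.2 + (chi x).2 * z.1).
  by move=> x; apply: cvgD; apply: cvgM; [exact: c1|exact: cvg_cst|exact: c2|exact: cvg_cst].
(* Continuous functions that agree almost everywhere agree everywhere. This is applied in [x] for
   almost every fixed [y], and afterwards in [y]. *)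
have aeD : {ae mu, forall y, forall x, chi (x + y) = cmul (chi x) (chi y)}.
  apply: (ae_mono (ae_and psiD chi_psi)) => y [hy cy].
  have A : {ae mu, forall x, chi (x + y) = cmul (chi x) (chi y)}.
    have s := @ae_preserving R _ (mshift y) (leb_shift y) _ chi_psi.
    by apply: (ae_mono (ae_and (ae_and hy chi_psi) s)) => x [[e1 e2] e3]; rewrite e3 e1 e2 cy.
  move=> x; rewrite [LHS]surjective_pairing; congr pair.
  - apply: (continuous_ae_eq (cs1 y) (cc1 (chi y))); by apply: (ae_mono A) => t ->.
  - apply: (continuous_ae_eq (cs2 y) (cc2 (chi y))); by apply: (ae_mono A) => t ->.
have D x y : chi (x + y) = cmul (chi x) (chi y).
  rewrite addrC cmulC [LHS]surjective_pairing; congr pair.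
  - apply: (continuous_ae_eq (cs1 x) (cc1 (chi x))); by apply: (ae_mono aeD) => t h; rewrite addrC h cmulC.
  - apply: (continuous_ae_eq (cs2 x) (cc2 (chi x))); by apply: (ae_mono aeD) => t h; rewrite addrC h cmulC.
have [q hq] := @continuous_character R (fun x => (chi x).1) (fun x => (chi x).2) c1 c2 n1
  (fun x y => f_equal fst (D x y)) (fun x y => etrans (f_equal snd (D x y)) (erefl _)).
exists q; apply: (ae_mono chi_psi) => x <-; have [e1 e2] := hq x.
by rewrite [LHS]surjective_pairing e1 e2.
Qed.

End MeasurableCharacter.

Lemma csub_eq0 (z t : cplx R) : cnorm2 (csub z t) = 0 -> z = t.
Proof.
move/eqP; rewrite cnorm2_eq0; case: z t => [a b] [c d] /eqP[] /eqP + /eqP.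
by rewrite !subr_eq0 => /eqP -> /eqP ->.
Qed.

Lemma cexpi_onto (z : cplx R) : cabs z = 1 -> exists t, z = cexpi t.
Proof.
move=> z1; have n1 : z.1 ^+ 2 + z.2 ^+ 2 = 1 by rewrite -[LHS]/(cnorm2 z) -cabs_sqr z1 expr1n.
have b : -1 <= z.1 <= 1 by rewrite -ler_norml -z1 cabs_re.
have s2 : 1 - z.1 ^+ 2 = z.2 ^+ 2 by rewrite -n1 addrC addKr.
have [p|n] := leP 0 z.2.
  exists (acos z.1); rewrite [LHS]surjective_pairing /cexpi acosK// sin_acos// s2.
  by rewrite sqrtr_sqr ger0_norm.
exists (- acos z.1); rewrite [LHS]surjective_pairing /cexpi cosN sinN acosK// sin_acos// s2.
by rewrite sqrtr_sqr ltr0_norm// opprK.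
Qed.

(** With [u] the direction of [Cint f], the function [cabs (f x) - cdot (f x) u] is nonnegative with
    integral 0, hence vanishes almost everywhere; equality in Cauchy-Schwarz then puts [f x] on the
    ray of [u]. *)
Lemma Cint_aligned f : CL1 f -> Cint f <> (0, 0) ->
  ((cabs (Cint f))%:E = \int[mu]_x (cabs (f x))%:E)%E ->
  {ae mu, forall x, f x = cscalec (cabs (f x)) (cscalec (cabs (Cint f))^-1 (Cint f))}.
Proof.
move=> fi z0 e; set z := Cint f; set u := cscalec _ z.
have az : 0 < cabs z.
  by rewrite lt_neqAle cabs_ge0 andbT eq_sym; apply/negP; rewrite cabs_eq0 => /eqP.
have u1 : cabs u = 1.
  by rewrite /u cabs_scale ger0_norm ?invr_ge0 ?cabs_ge0// mulVf ?gt_eqF.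
have uz : cdot z u = cabs z.
  have -> : cdot z u = (cabs z)^-1 * cnorm2 z by rewrite /cdot /u /cnorm2 /cscalec /=; ring.
  by rewrite -cabs_sqr expr2 mulKf ?gt_eqF.
have mf : cmeas f by case: fi.
have ii : L1 (fun x => cdot (f x) u).
  apply: (le_L1 (g := fun x => cabs (f x))).
  - by apply: measurable_cdot => //; exact: cmeas_cst.
  - by move=> x; rewrite (le_trans (cdot_abs _ _))// u1 mulr1.
  - exact: CL1_cabs.
have ic := CL1_cabs fi.
have d0 x : 0 <= cabs (f x) - cdot (f x) u.
  by rewrite subr_ge0 (le_trans (cdot_le _ _))// u1 mulr1.
have h : (\int[mu]_x (cabs (f x) - cdot (f x) u)%:E = 0)%E.
  rewrite -ge0_Rint_EFin; last exact: L1_sub.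
  rewrite RintegralB// Rint_cdot// -/z uz.
  have -> : Rintegral mu setT (fun x => cabs (f x)) = cabs z by rewrite /Rintegral -e.
  by rewrite subrr.
have md : measurable_fun setT (fun x => (cabs (f x) - cdot (f x) u)%:E).
  by apply/measurable_EFinP; apply: L1_measurable; exact: L1_sub.
apply: (ae_mono (ae_ge0_int0 md (fun x => d0 x) h)) => x [/eqP]; rewrite subr_eq0 => /eqP hx.
have : cnorm2 (csub (f x) (cscalec (cabs (f x)) u)) = 0.
  have -> : cnorm2 (csub (f x) (cscalec (cabs (f x)) u)) =
      cnorm2 (f x) - 2 * cabs (f x) * cdot (f x) u + cabs (f x) ^+ 2 * cnorm2 u.
    by rewrite /cnorm2 /csub /cdot /cscalec /=; ring.
  by rewrite -hx -(cabs_sqr u) u1 -cabs_sqr; ring.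
exact: csub_eq0.
Qed.

Section Aligned.
Variable w : R -> cplx R.
Hypothesis mw : cmeas w.
Hypothesis wn0 : {ae mu, forall x, w x <> (0, 0)}.
Hypothesis aligned : {ae mu, forall x, eabs (cconv w w) x = econv (eabs w) (eabs w) x /\
  (econv (eabs w) (eabs w) x < +oo)%E}.

(** At zeros of [w] this is 0, because the inverse of 0 is 0, so the bound by 1 holds everywhere. *)
Let phi x := cscalec (cabs (w x))^-1 (w x).
Let mphi : cmeas phi.
Proof.
apply: cmeas_scale => //; apply: measurable_invr_comp; exact: measurable_cabs.
Qed.

Let phi_abs x : w x <> (0, 0) -> cabs (phi x) = 1.
Proof.
move=> n; rewrite /phi cabs_scale ger0_norm ?invr_ge0 ?cabs_ge0// mulVf//.
by apply/negP; rewrite cabs_eq0 => /eqP.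
Qed.

Let phi_le1 x : cabs (phi x) <= 1.
Proof.
have [e|/eqP n] := eqVneq (w x) (0, 0); last by rewrite phi_abs.
by rewrite /phi e /cscalec !mulr0 cabs0.
Qed.

Let wphi x : w x = cscalec (cabs (w x)) (phi x).
Proof.
have [->|n] := eqVneq (w x) (0, 0); first by rewrite /cscalec cabs0 !mul0r.
have n' : cabs (w x) != 0 by rewrite cabs_eq0.
by rewrite /phi /cscalec /= !mulrA divff// !mul1r; case: (w x).
Qed.

Let z := cconv w w.
Let c x := cscalec (cabs (z x))^-1 (z x).
Let mc : cmeas c.
Proof.
have mz : cmeas z by exact: (cmeas_Cint2 (cmeas_conv_kernel mw mw)).
apply: cmeas_scale => //; apply: measurable_invr_comp; exact: measurable_cabs.
Qed.

Let phi_mul : {ae mu, forall x, {ae mu, forall y : R, cmul (phi (x - y)) (phi y) = c x}}.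
Proof.
apply: (ae_mono aligned) => x [e fin].
pose f (y : R) := cmul (w (x - y)) (w y).
have mf : cmeas f by apply: cmeas_mul => //; exact: cmeas_comp (mreflect x).
have efE : (econv (eabs w) (eabs w) x = \int[mu]_y (cabs (f y))%:E)%E.
  by apply: eq_integral => y _; rewrite cabsM EFinM.
have fi : CL1 f by split => //; rewrite -efE.
have fn0 : {ae mu, forall y, f y <> (0, 0)}.
  have s := @ae_preserving R _ (mreflect x) (leb_reflect x) _ wn0.
  apply: (ae_mono (ae_and wn0 s)) => y [h1 h2]; rewrite /f => /eqP; rewrite -cabs_eq0 cabsM mulf_eq0 !cabs_eq0.
  by move=> /orP[] /eqP.
(* Otherwise alignment would make [w (x - y) w y] vanish for almost every [y], against the full
   support of [w]. *)
have zn0 : Cint f <> (0, 0).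
  move=> z0; have i0 : (\int[mu]_y (cabs (f y))%:E = 0)%E.
    by rewrite -efE -e /eabs (_ : cconv w w x = (0, 0)) ?cabs0.
  have h := ae_ge0_int0 (emeasurable_cabs mf) (fun y => eabs_ge0 f y) i0.
  have [t _ [h1 h2]] := @ae_exists_itv R _ 0 1 (ae_and h fn0) ltr01.
  by apply: h2; apply/eqP; rewrite -cabs_eq0; move: h1 => [] ->.
have h := Cint_aligned fi zn0 (etrans e efE).
apply: (ae_mono (ae_and h fn0)) => y [hy n].
have an : cabs (f y) != 0 by rewrite cabs_eq0; exact/eqP.
have -> : cmul (phi (x - y)) (phi y) = cscalec (cabs (f y))^-1 (f y).
  by rewrite /phi /f cabsM invfM /cmul /cscalec /=; congr pair; ring.
rewrite {2}hy /c /z /cconv -/f /cscalec /=.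
by congr pair; rewrite [LHS]mulrA mulVf// mul1r.
Qed.

Lemma phase_affine : exists al be : R,
  {ae mu, forall x, w x = cmul (cexpi (al + be * x)) (cabs (w x), 0)}.
Proof.
pose H (p : R * R) : R := cnorm2 (csub (cmul (phi (p.1 - p.2)) (phi p.2)) (c p.1)).
have mH : measurable_fun setT H.
  apply: measurable_cnorm2; apply: cmeas_sub; first exact: (cmeas_conv_kernel mphi mphi).
  exact: (cmeas_comp mc measurable_fst).
have HP x y : H (x, y) = 0 <-> cmul (phi (x - y)) (phi y) = c x.
  rewrite /H /=; split => [/csub_eq0//|->]; by rewrite /csub !subrr /cnorm2 /= expr0n addr0.
have sw : {ae mu, forall y, {ae mu, forall x : R, cmul (phi x) (phi y) = c (x + y)}}.
  have := @ae_swap H mH (fun p => cnorm2_ge0 _) => /(_ _)/wrap[].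
    by apply: (ae_mono phi_mul) => x h; apply: (ae_mono h) => y /HP.
  move=> h; apply: (ae_mono h) => y hy.
  have := @ae_preserving R _ (mshift y) (leb_shift y) _ hy.
  by move=> hy'; apply: (ae_mono hy') => x /HP; rewrite addrK.
have [y0 _ [wy0 hy0]] := @ae_exists_itv R _ 0 1 (ae_and wn0 sw) ltr01.
have u0 := phi_abs wy0.
have u0' : cmul (cconj (phi y0)) (phi y0) = (1, 0) by rewrite cmulconj -cabs_sqr u0 expr1n.
(* From [phi x phi y = c (x + y)] follows [phi (x + y0) phi (y + y0) = phi (x + y + y0) phi y0];
   dividing the shifted phase by [phi y0] therefore gives a character. *)
pose psi (x : R) := cmul (phi (x + y0)) (cconj (phi y0)).
have mpsi : cmeas psi by apply: cmeas_mul; [exact: cmeas_comp (mshift y0)|exact: cmeas_cst].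
have psi_abs x : cabs (psi x) = cabs (phi (x + y0)) by rewrite cabsM cabs_conj u0 mulr1.
have psi_le1 x : cabs (psi x) <= 1 by rewrite psi_abs.
have psi1 : {ae mu, forall x, cabs (psi x) = 1}.
  have := @ae_preserving R _ (mshift y0) (leb_shift y0) _ wn0.
  by move=> h; apply: (ae_mono h) => x hx; rewrite psi_abs phi_abs.
have psiD : {ae mu, forall y, {ae mu, forall x, psi (x + y) = cmul (psi x) (psi y)}}.
  have sw' := @ae_preserving R _ (mshift y0) (leb_shift y0) _ sw.
  apply: (ae_mono sw') => y hy.
  have h1 := @ae_preserving R _ (mshift y0) (leb_shift y0) _ hy.
  have h2 := @ae_preserving R _ (mshift (y + y0)) (leb_shift (y + y0)) _ hy0.
  apply: (ae_mono (ae_and h1 h2)) => x [e1 e2].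
  have E : cmul (phi (x + y0)) (phi (y + y0)) = cmul (phi (x + y + y0)) (phi y0).
    by rewrite e1 -[x + y + y0]addrA e2; congr c; ring.
  rewrite /psi.
  transitivity (cmul (cmul (cmul (phi (x + y + y0)) (phi y0)) (cconj (phi y0))) (cconj (phi y0))).
    by rewrite -(cmulA _ (phi y0)) (cmulC (phi y0)) u0' (cmulC _ (1, 0)) cmul1.
  by rewrite -E -!cmulA; congr cmul; rewrite !cmulA; congr cmul; exact: cmulC.
have [q hq] := measurable_character mpsi psi_le1 psi1 psiD.
have [t ht] := cexpi_onto u0.
exists (t - q * y0), q.
have := @ae_preserving R _ (mshift (- y0)) (leb_shift (- y0)) _ hq => H1.
apply: (ae_mono H1) => x; rewrite /psi subrK => e.
have -> : cexpi (t - q * y0 + q * x) = phi x.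
  have -> : t - q * y0 + q * x = q * (x - y0) + t by ring.
  by rewrite cexpiD -e -ht -cmulA u0' cmulC cmul1.
by rewrite [LHS]wphi /cmul /cscalec /=; congr pair; ring.
Qed.

End Aligned.

End Phase.

(** * Translation, modulation and conjugation under the transform *)

Section FourierSymmetries.
Variable R : realType.
Local Notation mu := (@lebesgue_measure R).
Local Notation L1 f := (integrable mu setT (EFin \o f)).
Implicit Types f g h u w : R -> cplx R.

Lemma L2_cnorm2 f g : cmeas g -> L2 f -> (forall x, cnorm2 (g x) = cnorm2 (f x)) -> L2 g.
Proof.
move=> mg f2 e; apply: (le_L2 (g := fun x => cnorm2 (f x))) => //; last exact: L2_n2.
by move=> x; rewrite e.
Qed.

Lemma L2_conj f : L2 f -> L2 (fun x => cconj (f x)).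
Proof.
move=> f2; apply: (L2_cnorm2 _ f2); first by apply: cmeas_conj; exact: L2_cmeas.
by move=> x; rewrite cnorm2_conj.
Qed.

Lemma L2_preserving f (phi : R -> R) : measurable_fun setT phi ->
  (forall A : set R, measurable A -> mu (phi @^-1` A) = mu A) ->
  L2 f -> L2 (fun x => f (phi x)).
Proof.
move=> mphi phiP /L2P[mf fi]; apply/L2P; split; first exact: cmeas_comp.
by rewrite (ge0_int_preserving mphi phiP (F := fun x => (cnorm2 (f x))%:E))// => [|x];
  [exact: emeasurable_cnorm2|rewrite lee_fin cnorm2_ge0].
Qed.

Lemma L2_crefl u : L2 u -> L2 (crefl u).
Proof.
by move=> u2; apply: L2_conj; exact: (L2_preserving (mreflect 0) (leb_reflect 0)).
Qed.

Lemma is_FT_crefl u w : is_FT u w -> is_FT (crefl u) (fun x => cconj (w x)).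
Proof.
move=> uw; have u2 : L2 u by case: uw. have w2 : L2 w by case: uw => _ [].
apply: is_FTI; [exact: L2_crefl|exact: L2_conj|].
rewrite (_ : (fun N => _) = (fun N => n2 (fun x => csub (w x) (FT (cutf (box N) u) x)))).
  exact: is_FT_n2_cvg.
apply/funext => N; apply: eq_Rintegral => x _.
have -> : cutf (box N) (crefl u) = crefl (cutf (box N) u).
  apply/funext => y; rewrite /crefl /cutf !mem_setE !in_itv/= -!ler_norml sub0r normrN.
  by case: ifP => // _; rewrite /cconj /= oppr0.
rewrite /FT FI_crefl; last exact: CL1_cut_itv.
by rewrite /cnorm2 /csub /cconj /cscalec /=; ring.
Qed.

Lemma FT_cmul (z : cplx R) u x : CL1 u -> FT (fun x => cmul z (u x)) x = cmul z (FT u x).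
Proof.
move=> u1; rewrite /FT /FI; under eq_Cint do rewrite -cmulA.
rewrite Cint_cmul; last by apply: CL1_expi => //; mfun.
by rewrite /cscalec /cmul /=; congr pair; ring.
Qed.

Lemma FT_shift (b : R) u x : CL1 u ->
  FT (fun y => u (y - b)) x = cmul (cexpi (- (x * b))) (FT u x).
Proof.
move=> u1; rewrite /FT /FI.
rewrite -(@Cint_preserving R (fun y => y + b) (mshift b) (leb_shift b)); last first.
  apply: cmeas_mul; last by apply: cmeas_expi; mfun.
  by case: u1 => mu1 _; exact: cmeas_comp mu1 (mshift (- b)).
have -> : Cint (fun y : R => cmul (u (y + b - b)) (cexpi (- (x * (y + b))))) =
    Cint (fun y => cmul (cexpi (- (x * b))) (cmul (u y) (cexpi (- (x * y))))).
  apply: eq_Cint => y; rewrite addrK mulrDr opprD cexpiD.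
  by rewrite cmulA cmulC.
rewrite Cint_cmul; last by apply: CL1_expi => //; mfun.
by rewrite /cscalec /cmul /=; congr pair; ring.
Qed.

(** The transform is defined through the symmetric intervals [box N], which a translation does not
    preserve. By Plancherel other exhausting sets of finite measure give the same limit, since both
    cut functions tend to [u] in [L^2]. *)
Lemma is_FT_cut_cvg (D : nat -> set R) u w : (forall N, measurable (D N)) ->
  (forall N, L1 (\1_(D N))) -> (forall x, \forall N \near \oo, D N x) -> is_FT u w ->
  n2 (fun x => csub (w x) (FT (cutf (D N) u) x)) @[N --> \oo] --> 0.
Proof.
move=> mD D1 Dnear uw; have u2 : L2 u by case: uw. have w2 : L2 w by case: uw => _ [].
have b1 N : CL1 (cutf (box N) u) by exact: CL1_cut_itv.
have b2 N : L2 (cutf (box N) u) by apply: L2_cut => //; exact: measurable_box.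
have d1 N : CL1 (cutf (D N) u) by exact: CL1_cut.
have d2 N : L2 (cutf (D N) u) by exact: L2_cut.
have H1 := is_FT_n2_cvg uw.
have H2 : n2 u - n2 (cutf (box N) u) @[N --> \oo] --> (0 : R).
  rewrite -(subrr (n2 u)); apply: cvgB; first exact: cvg_cst.
  by apply: n2_cut_cvg => //; [exact: measurable_box|exact: box_near].
have H3 : n2 u - n2 (cutf (D N) u) @[N --> \oo] --> (0 : R).
  rewrite -(subrr (n2 u)); apply: cvgB; first exact: cvg_cst.
  exact: n2_cut_cvg.
have H : 2 * n2 (fun x => csub (w x) (FT (cutf (box N) u) x)) +
  2 * (2 * (n2 u - n2 (cutf (D N) u)) + 2 * (n2 u - n2 (cutf (box N) u))) @[N --> \oo] --> (0 : R).
  have -> : (0 : R) = 2 * 0 + 2 * (2 * 0 + 2 * 0) by ring.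
  by apply: cvgD; apply: cvgMr => //; apply: cvgD; apply: cvgMr.
apply: (squeeze_cvgr _ (cvg_cst 0) H); apply: nearW => N; rewrite n2_ge0/=.
have s1 := L2_sub w2 (L2_FT (b1 N) (b2 N)).
have s2 := L2_sub (L2_FT (d1 N) (d2 N)) (L2_FT (b1 N) (b2 N)).
have e : n2 (fun x => csub (FT (cutf (D N) u) x) (FT (cutf (box N) u) x)) =
   n2 (fun x => csub (cutf (D N) u x) (cutf (box N) u x)).
  rewrite -[RHS]n2_FT; [|exact: CL1_sub|exact: L2_sub].
  by apply: eq_Rintegral => x _; rewrite FT_sub.
have le2 : n2 (fun x => csub (cutf (D N) u x) (cutf (box N) u x)) <=
    2 * (n2 u - n2 (cutf (D N) u)) + 2 * (n2 u - n2 (cutf (box N) u)).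
  rewrite -!n2_sub_cut//; last exact: measurable_box.
  have := n2_sub_le (L2_sub u2 (b2 N)) (L2_sub u2 (d2 N)).
  rewrite addrC; apply: le_trans; rewrite le_eqVlt; apply/orP; left; apply/eqP.
  by apply: eq_Rintegral => x _; rewrite /cnorm2 /csub /=; ring.
have := n2_sub_le s1 s2; rewrite e => h.
have -> : n2 (fun x => csub (w x) (FT (cutf (D N) u) x)) =
  n2 (fun x => csub (csub (w x) (FT (cutf (box N) u) x)) (csub (FT (cutf (D N) u) x) (FT (cutf (box N) u) x))).
  by apply: eq_Rintegral => x _; rewrite /cnorm2 /csub /=; ring.
by apply: (le_trans h); rewrite lerD2l ler_wpM2l.
Qed.

Lemma is_FT_modulate u w v (al be : R) : is_FT u w -> L2 v ->
  {ae mu, forall x, w x = cmul (cexpi (al + be * x)) (v x)} ->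
  is_FT (fun x => cmul (cexpi (- al)) (u (x - be))) v.
Proof.
move=> uw v2 wv; have u2 : L2 u by case: uw. have w2 : L2 w by case: uw => _ [].
have us2 : L2 (fun x => u (x - be)) := L2_preserving (mshift (- be)) (leb_shift (- be)) u2.
have q2 : L2 (fun x => cmul (cexpi (- al)) (u (x - be))).
  apply: (L2_cnorm2 _ us2) => [|x]; last by rewrite cnorm2M cnorm2_expi mul1r.
  by apply: cmeas_mul; [exact: cmeas_cst|exact: L2_cmeas].
apply: is_FTI => //.
(* Cutting the translate of [u] to [box N] is the same as cutting [u] to [D N] and translating. *)
pose D N : set R := `[- N%:R - be, N%:R - be]%classic.
have D1 N : L1 (\1_(D N)) by exact: integrable_indic_itv.
have mD N : measurable (D N) by exact: measurable_itv.
have Dn (x : R) : \forall N \near \oo, D N x.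
  apply: filterS (box_near (x + be)) => N; rewrite /box /D /= !in_itv/= => /andP[h1 h2].
  by rewrite lerBlDr h1 lerBrDr h2.
have H := is_FT_cut_cvg mD D1 Dn uw.
have d1 N : CL1 (cutf (D N) u) by exact: CL1_cut.
have d2 N : L2 (cutf (D N) u) by exact: L2_cut.
rewrite (_ : (fun N => _) = (fun N => n2 (fun x => csub (w x) (FT (cutf (D N) u) x)))); first exact: H.
apply/funext => N.
have -> : cutf (box N) (fun x => cmul (cexpi (- al)) (u (x - be))) =
    (fun x => cmul (cexpi (- al)) (cutf (D N) u (x - be))).
  apply/funext => x; rewrite /cutf !mem_setE !in_itv/= !lerD2r.
  by case: ifP => // _; rewrite cmulC cmul0.
have ds1 : CL1 (fun x : R => cutf (D N) u (x - be)).
  have [dm di] := d1 N; split; first exact: cmeas_comp dm (mshift (- be)).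
  rewrite (@ge0_int_preserving R _ (mshift (- be)) (leb_shift (- be)) (fun x => (cabs (cutf (D N) u x))%:E))//.
    exact: emeasurable_cabs.
  by move=> x; rewrite lee_fin cabs_ge0.
have FE x : FT (fun x => cmul (cexpi (- al)) (cutf (D N) u (x - be))) x =
   cmul (cexpi (- (al + be * x))) (FT (cutf (D N) u) x).
  by rewrite FT_cmul// FT_shift// cmulA -cexpiD opprD (mulrC be).
have mFD := L2_cmeas (L2_FT (d1 N) (d2 N)).
apply: ae_eq_Rint.
- apply: measurable_cnorm2; apply: cmeas_sub; first exact: L2_cmeas.
  rewrite (_ : FT _ = fun x => cmul (cexpi (- (al + be * x))) (FT (cutf (D N) u) x)); last exact/funext.
  by apply: cmeas_mul => //; apply: cmeas_expi; mfun.
- by apply: measurable_cnorm2; apply: cmeas_sub => //; exact: L2_cmeas.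
apply: (ae_mono wv) => x ->; rewrite FE.
set F := FT _ x; set t := al + be * x.
have -> : csub (cmul (cexpi t) (v x)) F = cmul (cexpi t) (csub (v x) (cmul (cexpi (- t)) F)).
  have e : cmul (cexpi t) (cmul (cexpi (- t)) F) = F by rewrite cmulA -cexpiD subrr cexpi0 cmul1.
  rewrite -[in LHS]e; set G := cmul (cexpi (- t)) F.
  by rewrite /csub /cmul /=; congr pair; ring.
by rewrite cnorm2M cnorm2_expi mul1r.
Qed.

End FourierSymmetries.

(** * Bounds on the symbol *)

Section Symbol.
Variable R : realType.
Variables (s A B c v : R) (p : R -> R).
Hypothesis s_ge : 1 / 2 <= s.
Hypothesis A0 : 0 < A.
Hypothesis B0 : 0 < B.
Hypothesis p_bnd : forall xi : R, A * (`|xi| `^ (2 * s)) + c <= p xi /\ p xi <= B * (`|xi| `^ (2 * s)).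
Hypothesis v_lt : s = 1 / 2 -> `|v| < A.

(** Guarantees that the [inf] over the range is a genuine infimum and not a default value. For
    [s = 1/2] the linear term is absorbed thanks to [|v| < A], otherwise by the higher order of the
    symbol. *)
Lemma symbol_lbound : exists l, forall xi, l <= p xi - v * xi.
Proof.
have vx xi : - (`|v| * `|xi|) <= - (v * xi) by rewrite lerN2 -normrM ler_norm.
have [s12|s12] := eqVneq s (1 / 2).
  exists c => xi; have [h _] := p_bnd xi.
  have e : 2 * s = 1 by rewrite s12; field.
  rewrite e powRr1// in h; have hx := vx xi.
  have h2 : `|v| * `|xi| <= A * `|xi| by rewrite ler_wpM2r// ltW// v_lt.
  by lra.
have d0 : 0 < 2 * s - 1.
  have : 1 / 2 < s by rewrite lt_neqAle eq_sym s12.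
  by lra.
(* Beyond this radius [A |xi|^(2 s - 1) >= |v|], so the leading term dominates [v xi]; inside it
   [|v xi|] is at most [|v| T]. *)
pose T := (`|v| / A) `^ (2 * s - 1)^-1.
exists (c - `|v| * T) => xi; have [h _] := p_bnd xi; have hx := vx xi.
have T0 : 0 <= T by exact: powR_ge0.
have [xT|Tx] := leP `|xi| T.
  have h1 : `|v| * `|xi| <= `|v| * T by rewrite ler_wpM2l.
  have h2 : 0 <= A * `|xi| `^ (2 * s) by rewrite mulr_ge0 ?powR_ge0// ltW.
  by lra.
have x0 : 0 < `|xi| by exact: le_lt_trans T0 Tx.
have e : `|xi| `^ (2 * s) = `|xi| * `|xi| `^ (2 * s - 1).
  rewrite -{2}[`|xi|]powRr1// -powRD ?(gt_eqF x0) ?implybT//.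
  by congr (_ `^ _); ring.
have h1 : `|v| / A <= `|xi| `^ (2 * s - 1).
  have -> : `|v| / A = T `^ (2 * s - 1).
    by rewrite /T -powRrM mulVf ?gt_eqF// powRr1// divr_ge0// ltW.
  by apply: ge0_ler_powR; rewrite ?nnegrE//; exact: ltW.
have h2 : `|v| * `|xi| <= A * `|xi| `^ (2 * s).
  rewrite e mulrCA mulrC ler_wpM2l// -ler_pdivrMl// mulrC//.
have h3 : 0 <= `|v| * T by rewrite mulr_ge0.
by lra.
Qed.

Definition sweight (xi : R) : R := (1 + xi ^+ 2) `^ s.

Let one_le (xi : R) : 1 <= 1 + xi ^+ 2. Proof. by rewrite lerDl sqr_ge0. Qed.
Let s_ge0 : 0 <= s. Proof. by apply: le_trans s_ge; rewrite divr_ge0. Qed.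

Lemma sweight_ge1 xi : 1 <= sweight xi.
Proof. by rewrite /sweight -[X in X <= _](powRr0 (1 + xi ^+ 2)) ler_powR. Qed.

(** Since [s >= 1/2], the Sobolev weight controls [|xi|], and thereby the weight [jap] from which
    [sobolev] starts. *)
Lemma abs_le_sweight xi : `|xi| <= sweight xi.
Proof.
apply: (@le_trans _ _ ((1 + xi ^+ 2) `^ 2^-1)); last first.
  by rewrite /sweight ler_powR//; move: s_ge; rewrite div1r.
rewrite powR12_sqrt; last by rewrite (le_trans _ (one_le xi)).
by rewrite -sqrtr_sqr ler_wsqrtr// lerDr.
Qed.

Lemma powR_le_sweight xi : `|xi| `^ (2 * s) <= sweight xi.
Proof.
rewrite powRrM /sweight (_ : `|xi| `^ 2 = xi ^+ 2); last by rewrite powR_mulrn// real_normK ?num_real.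
by apply: ge0_ler_powR; rewrite ?nnegrE ?sqr_ge0 ?addr_ge0 ?lerDr// sqr_ge0.
Qed.

Lemma jap_le_sweight xi : jap xi <= 2 * sweight xi.
Proof. by rewrite /jap mulr_natl mulr2n lerD ?sweight_ge1 ?abs_le_sweight. Qed.

Lemma symbol_le_sweight omega xi : p xi - v * xi + omega <= (B + `|v| + `|omega|) * sweight xi.
Proof.
have [_ h] := p_bnd xi.
have h1 : p xi <= B * sweight xi by rewrite (le_trans h)// ler_wpM2l ?powR_le_sweight// ltW.
have h2 : - (v * xi) <= `|v| * sweight xi.
  rewrite (le_trans (ler_norm _))// normrN normrM ler_wpM2l ?abs_le_sweight//.
have h3 : omega <= `|omega| * sweight xi.
  by rewrite (le_trans (ler_norm _))// ler_peMr ?sweight_ge1.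
by rewrite !mulrDl; lra.
Qed.

Lemma measurable_sweight : measurable_fun setT sweight.
Proof. by apply: mpowR; apply: measurable_funD => //; exact: measurable_funX. Qed.

Lemma sweight_bounded (M xi : R) : `|xi| <= M -> sweight xi <= sweight M.
Proof.
move=> xM; rewrite /sweight; apply: ge0_ler_powR; rewrite ?nnegrE ?addr_ge0 ?sqr_ge0//.
rewrite lerD2l -[xi ^+ 2]real_normK ?num_real//; apply: lerXn2r; rewrite ?nnegrE//.
exact: le_trans xM.
Qed.

End Symbol.

(** * Boosted ground states *)

Section GroundState.
Variable R : realType.
Local Notation mu := (@lebesgue_measure R).
Local Notation L1 f := (integrable mu setT (EFin \o f)).
Implicit Types f g h u q : R -> cplx R.
Variables (m W : R -> R) (C : R) (sigma : nat) (Q w : R -> cplx R).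
Hypothesis mm : measurable_fun setT m.
Hypothesis mW : measurable_fun setT W.
Hypothesis m0 : forall x, 0 < m x.
Hypothesis mCW : forall x, m x <= C * W x.
Hypothesis japW : forall x, jap x <= 2 * W x.
Hypothesis Wb : forall M, exists K, forall x, `|x| <= M -> W x <= K.
Hypothesis QW : is_FT Q w.
Hypothesis Ww : L1 (fun x => W x * cnorm2 (w x)).
Hypothesis Qn0 : ~ ae_zero Q.
Let energy u := Rintegral mu setT (fun x => m x * cnorm2 (u x)).
Let power u := Rintegral mu setT (fun x => cnorm2 (u x) ^+ sigma.+2).
Hypothesis Qmin : forall u wu, is_FT u wu -> L1 (fun x => W x * cnorm2 (wu x)) -> ~ ae_zero u ->
  energy w ^+ sigma.+2 / power Q <= energy wu ^+ sigma.+2 / power u.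

Let Q2 : L2 Q. Proof. by case: QW. Qed.
Let w2 : L2 w. Proof. by case: QW => _ []. Qed.
Let mw : cmeas w. Proof. exact: L2_cmeas. Qed.
Let mQ : cmeas Q. Proof. exact: L2_cmeas. Qed.

Let L1_weight f (k : R -> R) (K : R) : measurable_fun setT k -> (forall x, 0 <= k x) ->
  (forall x, k x <= K * W x) -> cmeas f -> L1 (fun x => W x * cnorm2 (f x)) ->
  L1 (fun x => k x * cnorm2 (f x)).
Proof.
move=> mk k0 kW mf Wf; apply: (le_L1 (g := fun x => K * (W x * cnorm2 (f x)))).
- by apply: measurable_funM => //; exact: measurable_cnorm2.
- by move=> x; rewrite ger0_norm ?mulr_ge0 ?cnorm2_ge0// mulrA ler_wpM2r ?cnorm2_ge0.
- exact: L1_scale.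
Qed.

Let mw1 : L1 (fun x => m x * cnorm2 (w x)).
Proof. by apply: (L1_weight mm _ mCW) => // x; rewrite ltW. Qed.

Let jw1 : L1 (fun x => jap x * cnorm2 (w x)).
Proof. by apply: (L1_weight (@measurable_jap R) _ japW) => // x; rewrite ltW// jap_gt0. Qed.

Let W0 x : 0 <= W x.
Proof. by have := le_trans (ltW (jap_gt0 x)) (japW x); rewrite pmulr_rge0. Qed.

Let nice_weight f : nice f -> L1 (fun x => W x * cnorm2 (f x)).
Proof.
move=> nf; have [mf [M [M0' fM fM0]]] := nf; have [K hK] := Wb M.
apply: (le_L1 (g := fun x => K * cnorm2 (f x))).
- by apply: measurable_funM => //; exact: measurable_cnorm2.
- move=> x; rewrite ger0_norm ?mulr_ge0 ?cnorm2_ge0//.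
  have [xM|xM] := leP `|x| M; first by rewrite ler_wpM2r ?cnorm2_ge0// hK.
  by rewrite fM0// /cnorm2 /= expr0n addr0 !mulr0.
- by apply: L1_scale; apply: L2_n2; exact: nice_L2.
Qed.

Let wn0 : ~ {ae mu, forall x, w x = (0, 0)}.
Proof.
move=> h; apply: Qn0; apply: n2_eq0 => //; rewrite (is_FT_n2 QW).
transitivity (Rintegral mu setT (fun=> 0 : R)); last by rewrite Rintegral_cst// mul0r.
apply: ae_eq_Rint => //; first exact: measurable_cnorm2.
by apply: (ae_mono h) => x ->; rewrite /cnorm2 /= expr0n addr0.
Qed.

(** The normalisation in [power_FTi] for convolution powers with [sigma.+2] factors. *)
Let P : R := (2 * pi) ^+ sigma.+1.
Let P0 : 0 < P. Proof. by rewrite exprn_gt0// two_pi_gt0. Qed.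

Let nt n : nice (truncf w n). Proof. exact: nice_trunc. Qed.
Let b n := P^-1 * n2 (cpw (truncf w n) sigma.+1).

Let power_lsc_M (M : nat) : exists2 r : nat -> R, r n @[n --> \oo] --> 0 &
  forall n, Rintegral mu setT (fun x => cnorm2 (truncf Q M x) ^+ sigma.+2) <= b n + r n.
Proof.
apply: (@power_lsc R Q (fun n => FTi (truncf w n)) b sigma.+1 M Q2).
- by move=> n; apply: L2_FTi; [exact: nice_CL1|exact: nice_L2].
- exact: FTi_trunc_cvg QW.
- by move=> n; rewrite power_FTi.
Qed.

(** The powers of the truncations stay below that of [|w|], which is finite by [sobolev]. *)
Let b_bounded : exists K, forall n, b n <= K.
Proof.
have fin := sobolev sigma.+1 (measurable_eabs mw) (@eabs_ge0 R w) (jw_fin jw1).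
exists (P^-1 * fine (\int[mu]_x esq (epw (eabs w) sigma.+1 x))%E) => n.
rewrite ler_wpM2l ?invr_ge0 ?(ltW P0)// -lee_fin (@fineK _ (\int[mu]_x esq (epw (eabs w) sigma.+1 x))%E); last first.
  rewrite ge0_fin_numE// integral_ge0// => x _; apply: esq_ge0; apply: epw_ge0; exact: eabs_ge0.
exact: le_trans (cpw_energy_le sigma w2 n) (gn_le_energy sigma w2 n).
Qed.

Let EQ_ge0 (x : R) : (0 <= (cnorm2 (Q x) ^+ sigma.+2)%:E)%E.
Proof. by rewrite lee_fin exprn_ge0// cnorm2_ge0. Qed.

(** The Sobolev embedding for [Q], by lower semicontinuity and the bound on [b]. It rules out an
    infinite power integral, which [Rintegral] would turn into 0. *)
Let powQ1 : L1 (fun x => cnorm2 (Q x) ^+ sigma.+2).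
Proof.
have [K hK] := b_bounded.
apply: L1_of_lty; first by apply: measurable_funX; exact: measurable_cnorm2.
under eq_integral do rewrite ger0_norm ?exprn_ge0 ?cnorm2_ge0//.
apply: (@le_lt_trans _ _ K%:E); last by rewrite ltry.
have cv := @pow_trunc_cvg R Q sigma.+1 mQ.
apply: (cvge_to_le cv); apply: nearW => M.
rewrite -ge0_Rint_EFin; last by apply: nice_pow_L1; exact: nice_trunc.
rewrite lee_fin; have [r r0 hr] := power_lsc_M M.
have : K + r n @[n --> \oo] --> K + 0 by apply: cvgD => //; exact: cvg_cst.
rewrite addr0 => cK; apply: (cvgr_to_ge cK); apply: nearW => n.
by apply: le_trans (hr n) _; rewrite lerD2r.
Qed.

Let powQ_cvg : Rintegral mu setT (fun x => cnorm2 (truncf Q M x) ^+ sigma.+2) @[M --> \oo] --> power Q.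
Proof.
have cv := @pow_trunc_cvg R Q sigma.+1 mQ.
rewrite -(ge0_Rint_EFin powQ1) in cv; exact: (fine_cvg cv).
Qed.

Let powQ_gt0 : 0 < power Q.
Proof.
rewrite lt_neqAle; apply/andP; split; last first.
  by apply: Rintegral_ge0 => x _; rewrite exprn_ge0 ?cnorm2_ge0.
apply/eqP => e; apply: Qn0.
have z : (\int[mu]_x (cnorm2 (Q x) ^+ sigma.+2)%:E = 0)%E by rewrite -ge0_Rint_EFin// -/(power Q) -e.
have md : measurable_fun setT (fun x => (cnorm2 (Q x) ^+ sigma.+2)%:E).
  by apply/measurable_EFinP; apply: measurable_funX; exact: measurable_cnorm2.
apply: (ae_mono (ae_ge0_int0 md EQ_ge0 z)) => x [/eqP].
by rewrite expf_eq0/= cnorm2_eq0 => /eqP.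
Qed.

Let energy_gt0 : 0 < energy w.
Proof.
rewrite lt_neqAle; apply/andP; split; last first.
  by apply: Rintegral_ge0 => x _; rewrite mulr_ge0 ?cnorm2_ge0// ltW.
apply/eqP => e; apply: wn0.
have ge x : (0 <= (m x * cnorm2 (w x))%:E)%E by rewrite lee_fin mulr_ge0 ?cnorm2_ge0// ltW.
have z : (\int[mu]_x (m x * cnorm2 (w x))%:E = 0)%E by rewrite -ge0_Rint_EFin// -/(energy w) -e.
have md : measurable_fun setT (fun x => (m x * cnorm2 (w x))%:E).
  by apply/measurable_EFinP; apply: measurable_funM => //; exact: measurable_cnorm2.
apply: (ae_mono (ae_ge0_int0 md ge z)) => x [/eqP].
by rewrite mulf_eq0 (gt_eqF (m0 x))/= cnorm2_eq0 => /eqP.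
Qed.

Let NK := P * power Q.
Let J := energy w ^+ sigma.+2 / NK.

Let NK0 : 0 < NK. Proof. exact: mulr_gt0. Qed.
Let J0 : 0 < J. Proof. by rewrite divr_gt0// exprn_gt0. Qed.

Let JNK : J * NK = energy w ^+ sigma.+2.
Proof. by rewrite /J divfK// gt_eqF. Qed.

Let lsc (eta : R) : 0 < eta ->
  \forall n \near \oo, NK - eta <= n2 (cpw (truncf w n) sigma.+1).
Proof.
(* One [e] pays for truncating [Q], the other for [r n]; multiplication by [P] turns the sum into
   [eta]. *)
move=> eta0; pose e := eta / P / 2.
have e0 : 0 < e by rewrite !divr_gt0.
have [M _ /(_ M (leqnn M)) hM] : \forall M \near \oo,
    power Q - e <= Rintegral mu setT (fun x => cnorm2 (truncf Q M x) ^+ sigma.+2).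
  by apply: (cvgr_ge _ powQ_cvg); rewrite ltrBlDr ltrDl.
have [r r0 hr] := power_lsc_M M.
have hrn : \forall n \near \oo, r n <= e by apply: (cvgr_le _ r0).
apply: filterS hrn => n hn.
have h : power Q - e <= b n + e by rewrite (le_trans hM)// (le_trans (hr n))// lerD2l.
have h2 : P * (power Q - e) <= P * (b n + e) by rewrite ler_wpM2l// ltW.
have h3 : P * b n = n2 (cpw (truncf w n) sigma.+1) by rewrite /b mulVKf// gt_eqF.
have h4 : P * e = eta / 2 by rewrite /e; field; rewrite gt_eqF.
have lin (a q d t : R) : a - d <= q + d -> d = t / 2 -> a - t <= q by lra.
rewrite mulrBr mulrDr h4 h3 -/NK in h2.
exact: (lin _ _ _ _ h2).
Qed.

(** The competitor is [FTi f], whose transform is [f]. It is admissible as soon as its power does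
    not vanish, and otherwise the left-hand side is 0. *)
Let test f : nice f -> (forall x, (f x).2 = 0 /\ 0 <= (f x).1) ->
  L1 (fun x => m x * cnorm2 (f x)) -> J * n2 (cpw f sigma.+1) <= energy f ^+ sigma.+2.
Proof.
move=> nf _ _.
have ef0 : 0 <= energy f by apply: Rintegral_ge0 => x _; rewrite mulr_ge0 ?cnorm2_ge0// ltW.
have [z|nz] := eqVneq (n2 (cpw f sigma.+1)) 0; first by rewrite z mulr0 exprn_ge0.
have pf := power_FTi sigma.+1 nf.
have pE : power (FTi f) = P^-1 * n2 (cpw f sigma.+1) by rewrite /power /Rintegral pf.
have u0 : ~ ae_zero (FTi f).
  move=> h; move: nz; apply/negP; rewrite negbK.
  have : power (FTi f) = 0.
    transitivity (Rintegral mu setT (fun=> 0 : R)); last by rewrite Rintegral_cst// mul0r.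
    apply: ae_eq_Rint => //.
      apply: measurable_funX; apply: measurable_cnorm2; apply: L2_cmeas.
      by apply: L2_FTi; [exact: nice_CL1|exact: nice_L2].
    by apply: (ae_mono h) => x ->; rewrite /cnorm2 /= expr0n addr0 expr0n.
  by move/eqP; rewrite pE mulf_eq0 invr_eq0 (gt_eqF P0).
have n0 : 0 < n2 (cpw f sigma.+1) by rewrite lt_neqAle eq_sym nz n2_ge0.
have := Qmin (is_FT_FTi nf) (nice_weight nf) u0.
rewrite pE ler_pdivlMr; last by rewrite mulr_gt0 ?invr_gt0.
apply: le_trans; rewrite /J /NK le_eqVlt; apply/orP; left; apply/eqP.
by field; rewrite !gt_eqF.
Qed.

Theorem ground_state_phase : exists al be : R,
  {ae mu, forall x, w x = cmul (cexpi (al + be * x)) (cabs (w x), 0)}.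
Proof.
have EI := energy_ineq mm m0 test.
have EE := energy_eq mm m0 w2 mw1 J0 test JNK lsc.
have al := conv_aligned mm m0 w2 mw1 jw1 wn0 J0 test JNK lsc.
have fs : {ae mu, forall x, w x <> (0, 0)}.
  apply: (full_support (sigma := sigma) mm m0 w2 mw1 wn0 J0 EI).
  by rewrite EE -EFinM JNK.
exact: phase_affine mw fs al.
Qed.

End GroundState.

Unset Implicit Arguments.

Theorem theorem1p3 (R : realType) (s A B c v omega : R) (sigma : nat)
    (p : R -> R) (Q : R -> cplx R) :
  1 / 2 <= s ->
  continuous p ->
  0 < A -> 0 < B ->
  (forall xi : R, A * (`|xi| `^ (2 * s)) + c <= p xi /\ p xi <= B * (`|xi| `^ (2 * s))) ->
  (s = 1 / 2 -> `|v| < A) ->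
  - inf (range (fun xi : R => p xi - v * xi)) < omega ->
  (0 < sigma)%N ->
  boosted_ground_state p s v omega sigma Q ->
  forall wQ : R -> cplx R, is_FT Q wQ ->
  (exists (alpha x0 : R) (Qb : R -> cplx R),
     is_FT Qb (fun xi => (cabs (wQ xi), 0)) /\
     {ae (@leb R), forall x, Q x = cmul (cexpi alpha) (Qb (x + x0))}) /\
  (exists alpha x0 : R,
     {ae (@leb R), forall x,
        cmul (cexpi alpha) (Q (x + x0)) = cconj (cmul (cexpi alpha) (Q (- x + x0)))}).
Proof.
move=> s_ge cp A0 B0 p_bnd v_lt omega_gt sigma0 [[_ [w0 [Qw0 W0]]] [Qn0 Qmin]] w Qw.
(* A positive exponent is a successor, so at least one genuine convolution [w * w] is available for
   the alignment. *)
case: sigma sigma0 Qmin => // sigma _ Qmin.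
pose m xi := p xi - v * xi + omega.
have mp : measurable_fun setT p by exact: continuous_measurable_fun.
have mm : measurable_fun setT m.
  apply: measurable_funD => //; apply: measurable_funB => //.
have m0 xi : 0 < m xi.
  have [l hl] := symbol_lbound s_ge A0 p_bnd v_lt.
  have hi : inf (range (fun xi : R => p xi - v * xi)) <= p xi - v * xi.
    by apply: ge_inf; [exists l => _ [y _ <-]; exact: hl|exists xi].
  have lin (i a o : R) : - i < o -> i <= a -> 0 < a + o by lra.
  exact: (lin _ _ _ omega_gt hi).
have mW := measurable_sweight s.
have W1 xi : 1 <= sweight s xi by exact: sweight_ge1.
have w2 : L2 w by case: Qw => _ [].
have w02 : L2 w0 by case: Qw0 => _ [].
have mWw (f : R -> cplx R) : L2 f -> measurable_fun setT (fun x => sweight s x * cnorm2 (f x)).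
  by move=> f2; apply: measurable_funM => //; apply: measurable_cnorm2; exact: L2_cmeas.
(* [Hs] provides some transform [w0] with finite weighted norm; the given [w] agrees with it almost
   everywhere. *)
have Ww : (@lebesgue_measure R).-integrable setT (EFin \o (fun x => sweight s x * cnorm2 (w x))).
  apply: L1_of_lty; first exact: mWw.
  apply: le_lt_trans W0; rewrite le_eqVlt; apply/orP; left; apply/eqP.
  under eq_integral do rewrite ger0_norm ?mulr_ge0 ?cnorm2_ge0 ?(le_trans ler01 (W1 _))//.
  apply: ae_eq_integral => //.
  - by apply/measurable_EFinP; exact: mWw.
  - by apply/measurable_EFinP; exact: mWw.
  - by apply: (ae_mono (is_FT_unique Qw Qw0)) => x -> _.
have Wb (M : R) : exists K, forall x, `|x| <= M -> sweight s x <= K.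
  by exists (sweight s M) => x; exact: sweight_bounded.
have min u wu : is_FT u wu ->
    (@lebesgue_measure R).-integrable setT (EFin \o (fun x => sweight s x * cnorm2 (wu x))) ->
    ~ ae_zero u -> Jfun p v omega sigma.+1 Q w <= Jfun p v omega sigma.+1 u wu.
  move=> uwu Wu u0; apply: Qmin => //; split; first by case: uwu.
  exists wu; split => //; move: (L1_lty Wu).
  by under eq_integral do rewrite ger0_norm ?mulr_ge0 ?cnorm2_ge0 ?(le_trans ler01 (W1 _))//.
have [al [be wE]] := ground_state_phase mm mW m0
  (fun xi => symbol_le_sweight v s_ge B0 p_bnd omega xi) (jap_le_sweight s_ge) Wb Qw Ww Qn0 min.
have mw := L2_cmeas w2.
pose W x : cplx R := (cabs (w x), 0).
have W2 : L2 W.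
  apply: (L2_cnorm2 _ w2) => [|x]; first by apply: cmeas_pair => //; exact: measurable_cabs.
  by rewrite /cnorm2 /= cabs_sqr expr0n addr0.
pose Qb x := cmul (cexpi (- al)) (Q (x - be)).
have FTb : is_FT Qb W := is_FT_modulate Qw W2 wE.
split.
  exists al, be, Qb; split => //; apply: aeW => x.
  by rewrite /Qb addrK cmulA -cexpiD subrr cexpi0 cmul1.
(* With these constants the two sides are [Qb x] and the conjugate of [Qb (- x)]. *)
exists (- al), (- be).
have FTc : is_FT (crefl Qb) W.
  have := is_FT_crefl FTb; congr is_FT; apply/funext => x.
  by rewrite /cconj /W /= oppr0.
by apply: (ae_mono (is_FT_inj FTb FTc)) => x; rewrite /crefl sub0r.
Qed.
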